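(* Assume that $f$ is of the spatially periodic ignition type (as defined in the context). For each $n\in\mathbb{S}^{N-1}$ let $$u^*(t,x;n)=U^*(x\cdot n-c^*(n)t,x;n)$$ be the unique pulsating traveling wave in the direction $n$ of $$\partial_t u = \mathrm{div}(A(x)\nabla u) + q(x)\cdot\nabla u + f(x,u), \quad t\in\mathbb{R},\ x\in\mathbb{R}^N,$$ normalized by $\min_{x\in\mathbb{R}^N}U^*(0,x;n)=\frac{1+\theta}{2}$. Then the mapping $$n\in\mathbb{S}^{N-1}\mapsto U^*(z,x;n)$$ is continuous with respect to the uniform topology (that is, the topology of uniform convergence in $(z,x)\in\mathbb{R}\times\mathbb{R}^N$).
   Context: Setting. Let $L_1,\dots,L_N>0$ be given. A function $h:\mathbb{R}^N\to\mathbb{R}$ is called periodic if $h(x_1,\dots,x_k+L_k,\dots,x_N)=h(x_1,\dots,x_N)$ for all $1\le k\le N$ and all $x\in\mathbb{R}^N$; $\mathcal{C}=(0,L_1)\times\cdots\times(0,L_N)$ is the cell of periodicity. Consider $$(E)\qquad \partial_t u = \mathrm{div}(A(x)\nabla u) + q(x)\cdot\nabla u + f(x,u).$$ Standing assumptions: all $A_{i,j}$ and $q_i$ ($1\le i,j\le N$) are periodic, and $f(\cdot,u)$ is periodic for every $u\in\mathbb{R}_+=[0,\infty)$. The matrix field $A=(A_{i,j})$ is $C^3$, $A(x)$ is symmetric for every $x$, and there are $0<a_1\le a_2<\infty$ with $a_1|\xi|^2\le\sum_{i,j}A_{i,j}(x)\xi_i\xi_j\le a_2|\xi|^2$ for all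 $x,\xi\in\mathbb{R}^N$. The vector field $q=(q_1,\dots,q_N)$ is $C^{1,\delta}$ for some $\delta>0$, $\mathrm{div}\,q=0$ in $\mathbb{R}^N$ and $\int_{\mathcal{C}}q_i=0$ for all $1\le i\le N$. Ignition type: $f:\mathbb{R}^N\times\mathbb{R}_+\to\mathbb{R}$ is (periodic in $x$ and) locally Lipschitz-continuous on $\mathbb{R}^N\times\mathbb{R}_+$, and: (i) there is $0<\theta<1$ such that $f(x,u)=0$ for all $0\le u\le\theta$ and all $x\in\mathbb{R}^N$, and $f(x,1)=0$ for all $x\in\mathbb{R}^N$; (ii) for all $u\in(\theta,1)$ there is $x\in\mathbb{R}^N$ with $f(x,u)>0$; (iii) there is $\rho>0$ such that $f(x,u)$ is nonincreasing with respect to $u$ in $\mathbb{R}^N\times(1-\rho,1]$. (The $\theta$ in the claim is this $\theta$.) Pulsating traveling wave. A pulsating traveling wave with speed $c>0$ in the direction $n\in\mathbb{S}^{N-1}$ is an entire solution $u(t,x)$ ($t\in\mathbb{R}$, $x\in\mathbb{R}^N$) of $(E)$ such that $u(t,x)=u\left(t+\frac{k\cdot n}{c},x+k\right)$ for all $k\in\prod_{i=1}^N L_i\mathbb{Z}$, $t\in\mathbb{R}$, $x\in\mathbb{R}^N$, and $u(-\infty,\cdot)=0<u(\cdot,\cdot)<u(+\infty,\cdot)=1$, the limits being locally uniform in $x$. Such a wave can be written $u(t,x)=U(x\cdot n-ct,x)$, where $U(z,x)$ is periodic in $x$, $0<U<1$, and $U(z,x)\to1$ as $z\to-\infty$, $U(z,x)\to0$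 as $z\to+\infty$, uniformly in $x$. Known results (Berestycki–Hamel, Weinberger). In the ignition case, for every $n\in\mathbb{S}^{N-1}$ there is a unique (up to time shift) pulsating traveling wave in the direction $n$; its speed is denoted $c^*(n)>0$, and it is increasing in time (so $U^*$ is decreasing in $z$). *)

(* Defs.v *)
From HB Require Import structures.
From mathcomp Require Import all_boot all_order all_algebra.
From mathcomp Require Import all_classical all_reals all_analysis.
Set Implicit Arguments.
Unset Strict Implicit.
Unset Printing Implicit Defensive.
Import Order.TTheory GRing.Theory Num.Theory.
Import numFieldNormedType.Exports.
Local Open Scope classical_set_scope.
Local Open Scope ring_scope.

(* R^N is 'rV[R]_N. The library norm `|x| on it is the sup norm; it is used
   below only for topology and in Lipschitz and Hölder conditions, where the
   choice of norm does not matter. Euclidean quantities go through dot. *)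

Section Space.
Context {R : realType} {N : nat}.
Implicit Types (L : 'I_N -> R) (x y : 'rV[R]_N) (g : 'rV[R]_N -> R).

Definition dot x y : R := \sum_(i < N) x 0 i * y 0 i.

Definition unit_sphere : set 'rV[R]_N := [set n | dot n n = 1].

Definition basis_vec (i : 'I_N) : 'rV[R]_N := delta_mx 0 i.

Definition partial (i : 'I_N) g : 'rV[R]_N -> R :=
  'D_(basis_vec i) g.

Definition grad g x : 'rV[R]_N := \row_i partial i g x.

Definition divergence (F : 'rV[R]_N -> 'rV[R]_N) x : R :=
  \sum_(i < N) partial i (fun y => F y 0 i) x.

Definition has_partials g : Prop :=
  forall x (i : 'I_N), derivable g x (basis_vec i).

Fixpoint Ck (k : nat) g : Prop :=
  if k is k'.+1 then
    [/\ continuous g, has_partials g & forall i, Ck k' (partial i g)]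
  else continuous g.

(* Only applied to first derivatives of periodic C^1 functions, for which
   global and local Hölder continuity agree. *)
Definition hoelder_continuous (delta : R) g : Prop :=
  exists K : R, forall x y, `|g x - g y| <= K * `|x - y| `^ delta.

Definition C1_hoelder (delta : R) g : Prop :=
  Ck 1 g /\ forall i, hoelder_continuous delta (partial i g).

Definition periodic {T : Type} L (h : 'rV[R]_N -> T) : Prop :=
  forall (k : 'I_N) x, h (x + L k *: basis_vec k) = h x.

Definition lattice L : set 'rV[R]_N :=
  [set k | exists m : 'I_N -> int, forall i, k 0 i = L i * (m i)%:~R].

Definition set_coord x (i : 'I_N) (s : R) : 'rV[R]_N :=
  \row_j (if j == i then s else x 0 j).

(* Integral over the cell (0,L_1) x ... x (0,L_N), as an iterated integral;
   every coordinate of the base point 0 gets overwritten. The library has no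
   Lebesgue measure on 'rV[R]_N; for continuous g the two integrals agree. *)
Definition cell_integral L g : R :=
  foldr (fun (i : 'I_N) (h : 'rV[R]_N -> R) x =>
           \int[@lebesgue_measure R]_(s in `]0, L i[) h (set_coord x i s))
        g (enum 'I_N) 0.

End Space.

Section Equation.
Context {R : realType} {N : nat}.
Variables (L : 'I_N -> R) (A : 'rV[R]_N -> 'M[R]_N) (q : 'rV[R]_N -> 'rV[R]_N).
(* f is only meaningful on R^N x [0, +oo[; its values at u < 0 are never
   constrained nor used. *)
Variable f : 'rV[R]_N -> R -> R.

Definition diffusion_hyp : Prop :=
  [/\ periodic L A,
      forall i j, Ck 3 (fun x => A x i j),
      forall x, (A x)^T = A x
    & exists a1 a2 : R, [/\ 0 < a1, a1 <= a2 &
        forall x xi : 'rV[R]_N,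
          a1 * dot xi xi <= \sum_(i < N) \sum_(j < N) A x i j * xi 0 i * xi 0 j
            <= a2 * dot xi xi]].

Definition advection_hyp : Prop :=
  [/\ periodic L q,
      exists2 delta : R, 0 < delta &
        forall i, C1_hoelder delta (fun x => q x 0 i),
      forall x, divergence q x = 0
    & forall i, cell_integral L (fun x => q x 0 i) = 0].

Definition ignition (theta : R) : Prop :=
  [/\ forall u, 0 <= u -> periodic L (f ^~ u)
    & forall xu0 : 'rV[R]_N * R, 0 <= xu0.2 ->
        exists2 B, nbhs xu0 B &
          [lipschitz f xu.1 xu.2 | xu in B `&` [set xu | 0 <= xu.2]]] /\
  [/\ 0 < theta < 1,
      forall x u, 0 <= u <= theta -> f x u = 0,
      forall x, f x 1 = 0,
      forall u, theta < u < 1 -> exists x, 0 < f x u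
    & exists2 rho : R, 0 < rho &
        forall x u v, 0 <= u -> 1 - rho < u -> u <= v -> v <= 1 ->
          f x v <= f x u].

(* Joint C^1 regularity in t and C^2 regularity in x. *)
Definition C12 (u : R -> 'rV[R]_N -> R) : Prop :=
  [/\ continuous (fun p : R * 'rV[R]_N => u p.1 p.2),
      (forall t x, derivable (u ^~ x) t 1) /\
      continuous (fun p : R * 'rV[R]_N => derive1 (u ^~ p.2) p.1),
      (forall t, has_partials (u t)) /\
      (forall i, continuous (fun p : R * 'rV[R]_N => partial i (u p.1) p.2))
    & (forall t i, has_partials (partial i (u t))) /\
      (forall i j, continuous (fun p : R * 'rV[R]_N =>
                                 partial j (partial i (u p.1)) p.2))].

Definition entire_solution (u : R -> 'rV[R]_N -> R) : Prop :=
  C12 u /\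
  forall t x,
    derive1 (u ^~ x) t =
      divergence (fun y => grad (u t) y *m (A y)^T) x
      + dot (q x) (grad (u t) x) + f x (u t x).

Definition pulsating_wave (n : 'rV[R]_N) (c : R) (u : R -> 'rV[R]_N -> R) :
    Prop :=
  [/\ 0 < c, entire_solution u,
      forall k t x, lattice L k -> u t x = u (t + dot k n / c) (x + k),
      forall t x, 0 < u t x < 1
    & {family compact, u t @[t --> -oo] --> (fun=> 0 : R)} /\
      {family compact, u t @[t --> +oo] --> (fun=> 1 : R)}].

End Equation.

(* Main.v *)
(* Only comparison at maximum points is used. Two profiles [U1(z, x)],
   [U2(z, x)] with nearby directions cannot be compared directly, because the
   equation of [U(z, x)] is degenerate in [z]; one maximizes instead
   [U1(z + s, x) - U2(z', x) - Gam(z') - (z - z')^2/eps], in which each wave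
   is differentiated only in its own time and both share the variable [x].

   A spatial Lipschitz bound, uniform over all waves (doubling of [x] and
   coupling of the two diffusions, after Ishii and Lions), controls the terms
   produced by [n1 - n2]. Sliding [s] leads to a contact where the two profiles
   almost touch, which the equation forces into a bounded range of [z]: behind
   the front [f] is nonincreasing, and ahead of it [f] vanishes and the waves
   decay exponentially, uniformly for [n] near [n0]. From the contact a barrier
   on a moving ball (a quantitative strong maximum principle) propagates
   closeness to any compact range of [z]. Sliding a wave against itself shows
   that [U] decreases in [z]; sliding the wave of [n] against that of [n0]
   bounds its speed from both sides, then shows that the two profiles are close
   up to a shift, and the normalization at [z = 0] makes the shift small. *)

Require Import Defs.
From HB Require Import structures.
From mathcomp Require Import all_boot all_order all_algebra.
From mathcomp Require Import all_classical all_reals all_analysis.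
From mathcomp Require Import ring lra.
Set Implicit Arguments.
Unset Strict Implicit.
Unset Printing Implicit Defensive.
Import Order.TTheory GRing.Theory Num.Theory.
Import numFieldNormedType.Exports.
Local Open Scope classical_set_scope.
Local Open Scope ring_scope.

(** * Euclidean norm and positive semidefinite matrices *)

Section LinearAlgebra.
Context {R : realType} {N : nat}.
Implicit Types (x y z : 'rV[R]_N) (M P : 'M[R]_N).

(** No limit of waves is taken. Every constant is computed from the wave of [n0] and from bounds in
    [S] that all waves share, so each estimate for nearby [n] is explicit. The order of choice
    matters: [del], the size of the perturbation in the gap, then the coupling [e], fixed by the
    modulus of continuity of the profile of [n0], and only then the admissible distance [sg] between
    directions, because the terms produced by [n - n0] carry a factor [1 / e].

    The obstacle at a contact is that the reaction gives no strict inequality: it vanishes ahead of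
    the front and is only nonincreasing behind it. Strictness has two sources. While the speeds
    differ, it is the difference of speeds times the positive time derivative of the wave of [n0].
    Once the speeds agree up to a small error of unknown sign, it is a concave weight added to the
    profile. This is why the speeds are settled before the profiles are compared, and why positivity
    of [ut] is needed before the speeds. *)

Lemma dotC x y : dot x y = dot y x.
Proof. by apply: eq_bigr => i _; rewrite mulrC. Qed.

Lemma dotDl x y z : dot (x + y) z = dot x z + dot y z.
Proof. by rewrite -big_split; apply: eq_bigr => i _; rewrite mxE mulrDl. Qed.

Lemma dotZl c x z : dot (c *: x) z = c * dot x z.
Proof. by rewrite mulr_sumr; apply: eq_bigr => i _; rewrite mxE mulrA. Qed.

Lemma dotDr x y z : dot z (x + y) = dot z x + dot z y.
Proof. by rewrite dotC dotDl !(dotC z). Qed.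

Lemma dotZr c x z : dot z (c *: x) = c * dot z x.
Proof. by rewrite dotC dotZl dotC. Qed.

Lemma dotNl x z : dot (- x) z = - dot x z.
Proof. by rewrite -scaleN1r dotZl mulN1r. Qed.

Lemma dotNr x z : dot z (- x) = - dot z x.
Proof. by rewrite dotC dotNl dotC. Qed.

Lemma dot0l x : dot 0 x = 0.
Proof. by rewrite -(scale0r x) dotZl mul0r. Qed.

Lemma dot0r x : dot x 0 = 0.
Proof. by rewrite dotC dot0l. Qed.

Lemma dot_ge0 x : 0 <= dot x x.
Proof. by apply: sumr_ge0 => i _; rewrite -expr2 sqr_ge0. Qed.

Lemma dot_basis (i : 'I_N) x : dot (basis_vec i) x = x 0 i.
Proof.
rewrite /dot (bigD1 i) //= big1 ?addr0 => [|j jni]; rewrite !mxE ?eqxx ?mul1r //.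
by rewrite (negbTE jni) mul0r.
Qed.

Definition nrm x : R := Num.sqrt (dot x x).

Lemma nrm_ge0 x : 0 <= nrm x. Proof. exact: sqrtr_ge0. Qed.

Lemma nrm_sqr x : nrm x ^+ 2 = dot x x.
Proof. by rewrite sqr_sqrtr ?dot_ge0. Qed.

Lemma dot_eq0 x : (dot x x == 0) = (x == 0).
Proof.
apply/eqP/eqP => [|->]; last by rewrite dot0l.
move=> /eqP; rewrite psumr_eq0 => [/allP h|i _]; last by rewrite -expr2 sqr_ge0.
apply/rowP => i; rewrite mxE.
by have := h i (mem_index_enum _); rewrite /= -expr2 sqrf_eq0 => /eqP.
Qed.

Lemma nrm_gt0 x : x != 0 -> 0 < nrm x.
Proof. by move=> x0; rewrite sqrtr_gt0 lt_neqAle eq_sym dot_eq0 x0 dot_ge0. Qed.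

Lemma nrm0 : nrm 0 = 0. Proof. by rewrite /nrm dot0l sqrtr0. Qed.

Lemma nrmN x : nrm (- x) = nrm x.
Proof. by rewrite /nrm dotNl dotNr opprK. Qed.

Lemma nrmZ c x : nrm (c *: x) = `|c| * nrm x.
Proof.
by rewrite /nrm dotZl dotZr mulrA -expr2 sqrtrM ?sqr_ge0 // sqrtr_sqr.
Qed.

Lemma dot_sqr_le x y : dot x y ^+ 2 <= dot x x * dot y y.
Proof.
have [->|y0] := eqVneq y 0; first by rewrite !dot0r expr0n mulr0.
have yy : 0 < dot y y by rewrite lt_neqAle eq_sym dot_eq0 y0 dot_ge0.
have := dot_ge0 (dot y y *: x - dot x y *: y).
rewrite !(dotDl, dotDr, dotNl, dotNr, dotZl, dotZr) (dotC y x).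
set a := dot x x; set b := dot x y; set c := dot y y => h.
have {}h : 0 <= c * (a * c - b ^+ 2) by apply: le_trans h _; rewrite le_eqVlt; apply/orP; left; apply/eqP; ring.
by rewrite -subr_ge0 -(pmulr_rge0 _ yy).
Qed.

Lemma cauchy_schwarz x y : `|dot x y| <= nrm x * nrm y.
Proof.
rewrite -ler_sqr ?nnegrE ?mulr_ge0 ?nrm_ge0 //.
by rewrite exprMn !nrm_sqr real_normK ?num_real // dot_sqr_le.
Qed.

Lemma dot_le_nrm x y : dot x y <= nrm x * nrm y.
Proof. exact: le_trans (ler_norm _) (cauchy_schwarz _ _). Qed.

Lemma nrmD x y : nrm (x + y) <= nrm x + nrm y.
Proof.
rewrite -ler_sqr ?nnegrE ?addr_ge0 ?nrm_ge0 // nrm_sqr sqrrD !nrm_sqr.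
rewrite !(dotDl, dotDr) (dotC y x); have := dot_le_nrm x y; lra.
Qed.

Lemma coord_le_nrm x i : `|x 0 i| <= nrm x.
Proof.
rewrite -dot_basis (le_trans (cauchy_schwarz _ _)) //.
suff -> : nrm (basis_vec i : 'rV[R]_N) = 1 by rewrite mul1r.
by rewrite /nrm dot_basis !mxE !eqxx sqrtr1.
Qed.

Lemma nrm_le_sum x : nrm x <= \sum_i `|x 0 i|.
Proof.
rewrite -ler_sqr ?nnegrE ?nrm_ge0 ?sumr_ge0 // nrm_sqr expr2 mulr_suml.
apply: ler_sum => i _; apply: le_trans (ler_norm _) _; rewrite normrM ler_wpM2l //.
by rewrite (bigD1 i) //= lerDl sumr_ge0.
Qed.

Lemma coord_le_norm x i : `|x 0 i| <= `|x|.
Proof.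
by rewrite [leRHS]/Num.norm /= mx_normrE; apply/bigmax_geP; right => /=; exists (0, i).
Qed.

Lemma norm_le_nrm x : `|x| <= nrm x.
Proof.
rewrite [leLHS]/Num.norm /= mx_normrE; apply/bigmax_leP; split; first exact: nrm_ge0.
by move=> [k i] _ /=; rewrite (ord1 k) coord_le_nrm.
Qed.

Lemma nrm_le_norm x : nrm x <= N%:R * `|x|.
Proof.
apply: (le_trans (nrm_le_sum x)).
apply: (@le_trans _ _ (\sum_(i < N) `|x|)).
  by apply: ler_sum => i _; exact: coord_le_norm.
by rewrite sumr_const card_ord mulr_natl.
Qed.

Definition bf M x y : R := (x *m M *m y^T) 0 0.
Definition qf M x : R := bf M x x.
Definition mtr M P : R := \sum_i \sum_j M i j * P i j.

Lemma bfE M x y : bf M x y = \sum_i \sum_j M i j * x 0 i * y 0 j.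
Proof.
rewrite /bf mxE exchange_big; apply: eq_bigr => j _; rewrite !mxE mulr_suml.
by apply: eq_bigr => i _; rewrite (mulrC (M i j)).
Qed.

Lemma qfE M x : qf M x = \sum_i \sum_j M i j * x 0 i * x 0 j.
Proof. exact: bfE. Qed.

Lemma bfDl M x y z : bf M (x + y) z = bf M x z + bf M y z.
Proof. by rewrite /bf !mulmxDl mxE. Qed.
Lemma bfZl M c x z : bf M (c *: x) z = c * bf M x z.
Proof. by rewrite /bf -!scalemxAl mxE. Qed.
Lemma bfDr M x y z : bf M z (x + y) = bf M z x + bf M z y.
Proof. by rewrite /bf linearD mulmxDr mxE. Qed.
Lemma bfZr M c x z : bf M z (c *: x) = c * bf M z x.
Proof. by rewrite /bf linearZ -scalemxAr mxE. Qed.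
Lemma bfDm M P x y : bf (M + P) x y = bf M x y + bf P x y.
Proof. by rewrite /bf mulmxDr mulmxDl mxE. Qed.
Lemma bfZm M c x y : bf (c *: M) x y = c * bf M x y.
Proof. by rewrite /bf -scalemxAr -scalemxAl mxE. Qed.
Lemma bfNm M x y : bf (- M) x y = - bf M x y.
Proof. by rewrite -scaleN1r bfZm mulN1r. Qed.
Lemma qfDm M P x : qf (M + P) x = qf M x + qf P x. Proof. exact: bfDm. Qed.
Lemma qfZm M c x : qf (c *: M) x = c * qf M x. Proof. exact: bfZm. Qed.
Lemma qfNm M x : qf (- M) x = - qf M x. Proof. exact: bfNm. Qed.
Lemma qfZ M c x : qf M (c *: x) = c ^+ 2 * qf M x.
Proof. by rewrite /qf bfZl bfZr mulrA. Qed.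

Lemma bf_outer u v x y : bf (u^T *m v) x y = dot u x * dot v y.
Proof.
rewrite bfE /dot big_distrl /=; apply: eq_bigr => i _; rewrite big_distrr /=.
apply: eq_bigr => j _; rewrite !mxE big_ord1 !mxE; ring.
Qed.
Lemma qf_outer u x : qf (u^T *m u) x = dot u x ^+ 2.
Proof. by rewrite /qf bf_outer. Qed.

Lemma qf1 x : qf 1%:M x = dot x x.
Proof. by rewrite /qf /bf /dot mulmx1 mxE; apply: eq_bigr => i _; rewrite !mxE. Qed.

Lemma bf_basis M i y : bf M (basis_vec i) y = \sum_j M i j * y 0 j.
Proof.
rewrite bfE (bigD1 i) //= [X in _ + X]big1 ?addr0 => [|k kni].
  by apply: eq_bigr => j _; rewrite !mxE !eqxx mulr1.
by rewrite big1 // => j _; rewrite !mxE (negbTE kni) andbF mulr0 mul0r.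
Qed.

Lemma bf_basis2 M i j : bf M (basis_vec i) (basis_vec j) = M i j.
Proof.
rewrite bf_basis (bigD1 j) //= big1 ?addr0 => [|k kni]; rewrite !mxE ?eqxx ?mulr1 //.
by rewrite (negbTE kni) mulr0.
Qed.

Lemma bf_trmx M x y : bf M^T x y = bf M y x.
Proof.
rewrite !bfE exchange_big /=; apply: eq_bigr => i _; apply: eq_bigr => j _.
by rewrite mxE; ring.
Qed.

Lemma mtrDl M P Q : mtr (M + P) Q = mtr M Q + mtr P Q.
Proof.
rewrite /mtr -big_split; apply: eq_bigr => i _; rewrite -big_split /=.
by apply: eq_bigr => j _; rewrite mxE mulrDl.
Qed.
Lemma mtrC M P : mtr M P = mtr P M.
Proof. by apply: eq_bigr => i _; apply: eq_bigr => j _; rewrite mulrC. Qed.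
Lemma mtrDr M P Q : mtr Q (M + P) = mtr Q M + mtr Q P.
Proof. by rewrite mtrC mtrDl !(mtrC Q). Qed.
Lemma mtrZl c M Q : mtr (c *: M) Q = c * mtr M Q.
Proof.
rewrite /mtr mulr_sumr; apply: eq_bigr => i _; rewrite mulr_sumr.
by apply: eq_bigr => j _; rewrite mxE mulrA.
Qed.
Lemma mtrZr c M Q : mtr Q (c *: M) = c * mtr Q M.
Proof. by rewrite mtrC mtrZl mtrC. Qed.
Lemma mtrNr M Q : mtr Q (- M) = - mtr Q M.
Proof. by rewrite -scaleN1r mtrZr mulN1r. Qed.
Lemma mtrNl M Q : mtr (- M) Q = - mtr M Q.
Proof. by rewrite -scaleN1r mtrZl mulN1r. Qed.

Lemma mtr_outer M u : mtr M (u^T *m u) = qf M u.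
Proof.
rewrite qfE; apply: eq_bigr => i _; apply: eq_bigr => j _.
by rewrite !mxE big_ord1 !mxE mulrA.
Qed.

Lemma mtr1 M : mtr M 1%:M = \tr M.
Proof.
apply: eq_bigr => i _; rewrite (bigD1 i) //= [X in _ + X]big1 ?addr0 => [|j jni].
  by rewrite mxE eqxx mulr1.
by rewrite mxE eq_sym (negbTE jni) mulr0.
Qed.

Definition psd M := (forall i j, M i j = M j i) /\ forall x, 0 <= qf M x.

Lemma psd_row0 M i j : psd M -> M i i = 0 -> M i j = 0.
Proof.
move=> [sym pos] Mii; apply/eqP; apply: contraT => Mij.
(* The coefficient makes the form equal to [M j j - (M j j + 1) = - 1] at this vector. *)
have := pos (basis_vec j - ((M j j + 1) / (2 * M i j)) *: basis_vec i).
rewrite -scaleNr /qf !(bfDl, bfDr, bfZl, bfZr) !bf_basis2 Mii (sym j i).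
have -> : (- ((M j j + 1) / (2 * M i j)) * M i j) = - (M j j + 1) / 2 by field.
lra.
Qed.

(* Symmetric Gaussian elimination: [M] is a sum of [d v v^T] with [d > 0]. *)
Lemma psd_mtr_le0 M P : psd M -> (forall x, qf P x <= 0) -> mtr M P <= 0.
Proof.
move=> psdM Pneg.
suff H k : forall M', psd M' -> (forall i j : 'I_N, (k <= i)%N -> M' i j = 0) ->
    mtr M' P <= 0.
  by apply: (H N) => // i j; rewrite leqNgt ltn_ord.
elim: k => [M' _ z|k IH M' pM z].
  by rewrite /mtr big1 // => i _; rewrite big1 // => j _; rewrite z ?mul0r.
have [kN|Nk] := ltnP k N; last first.
  by apply: IH => // i j ki; have := leq_ltn_trans (leq_trans Nk ki) (ltn_ord i); rewrite ltnn.
pose i0 := Ordinal kN.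
have [Mz|Mnz] := eqVneq (M' i0 i0) 0.
  apply: IH => // i j; rewrite leq_eqVlt => /orP[/eqP ik|]; last exact: z.
  have -> : i = i0 by apply: val_inj.
  exact: psd_row0.
have [sym pos] := pM.
have d0 : 0 < M' i0 i0.
  by rewrite lt_neqAle eq_sym Mnz -bf_basis2; exact: pos.
set d := M' i0 i0 in d0 Mnz.
pose v : 'rV[R]_N := \row_j (M' i0 j / d).
(* [M2] is the Schur complement: row [k] vanishes as well, and its form is that of [M'] after
   completing the square in coordinate [k]. *)
pose M2 := M' - d *: (v^T *m v).
have M2E i j : M2 i j = M' i j - d * (v 0 i * v 0 j).
  by rewrite !mxE big_ord1 !mxE.
have -> : mtr M' P = mtr M2 P + d * qf P v.
  by rewrite /M2 mtrDl mtrNl mtrZl (mtrC (v^T *m v)) mtr_outer subrK.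
have Hv : d * qf P v <= 0 by rewrite pmulr_rle0.
suff : mtr M2 P <= 0 by lra.
apply: IH => [|i j].
  split=> [i j|x]; first by rewrite !M2E (sym i j) (mulrC (v 0 i)).
  have -> : qf M2 x = qf M' (x - dot v x *: basis_vec i0).
    rewrite qfDm qfNm qfZm qf_outer -[- (_ *: basis_vec i0)]scaleNr /qf !(bfDl, bfDr, bfZl, bfZr) bf_basis2.
    have bE : bf M' (basis_vec i0) x = d * dot v x.
      rewrite bf_basis mulr_sumr; apply: eq_bigr => j _; rewrite !mxE; field.
      exact: Mnz.
    have bE' : bf M' x (basis_vec i0) = d * dot v x.
      rewrite -bE -bf_trmx; congr bf; apply/matrixP => i j; rewrite !mxE; exact: sym.
    rewrite bE bE' -/d; ring.
  exact: pos.
rewrite M2E !mxE leq_eqVlt => /orP[/eqP ik|ki].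
  have -> : i = i0 by apply: val_inj.
  by rewrite -/d; field; exact: Mnz.
by rewrite z // (sym i0) z // mul0r mul0r mulr0 subrr.
Qed.

Lemma psd_mtr_mono M P Q : psd M -> (forall x, qf P x <= qf Q x) ->
  mtr M P <= mtr M Q.
Proof.
move=> pM le; have := @psd_mtr_le0 M (P - Q) pM.
rewrite mtrDr mtrNr subr_le0; apply=> x; rewrite qfDm qfNm subr_le0; exact: le.
Qed.

Lemma psd_mtr_ge0 M P : psd M -> (forall x, 0 <= qf P x) -> 0 <= mtr M P.
Proof.
move=> pM le; have := @psd_mtr_le0 M (- P) pM; rewrite mtrNr oppr_le0; apply=> x.
by rewrite qfNm oppr_le0.
Qed.

(** By Cauchy-Schwarz [x^T x - |x|^2 1] is negative semidefinite, so its pairing with [M] is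
    nonpositive. *)
Lemma psd_le_tr M x : psd M -> qf M x <= \tr M * dot x x.
Proof.
move=> pM; have := @psd_mtr_le0 M (x^T *m x - dot x x *: 1%:M) pM.
rewrite mtrDr mtrNr mtrZr mtr1 mtr_outer subr_le0 (mulrC (\tr M)); apply=> y.
rewrite qfDm qfNm qfZm qf_outer qf1 subr_le0.
exact: dot_sqr_le.
Qed.

End LinearAlgebra.

(** * First and second order expansions at a point *)

Section Expansions.
Context {R : realType}.
Implicit Types (F G : R -> R) (p q r e d s : R).

(** Taylor expansions at 0 with a small remainder instead of derivatives. They ask nothing away from
    0, are stable under sums and rescaling, and are what the tests at a contact point consume; in
    [T2] the coefficient [r] plays the part of the second derivative. *)
Definition T1 F p := forall e, 0 < e -> exists2 d, 0 < d &
  forall s, `|s| < d -> `|F s - F 0 - p * s| <= e * `|s|.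

Definition T2 F p r := forall e, 0 < e -> exists2 d, 0 < d &
  forall s, `|s| < d -> `|F s - F 0 - p * s - r / 2 * s ^+ 2| <= e * s ^+ 2.

Lemma T1_ext F G p : F =1 G -> T1 F p -> T1 G p.
Proof. by move=> FG h e e0; have [d d0 hd] := h e e0; exists d => // s; rewrite -!FG; exact: hd. Qed.

Lemma T2_ext F G p r : F =1 G -> T2 F p r -> T2 G p r.
Proof. by move=> FG h e e0; have [d d0 hd] := h e e0; exists d => // s; rewrite -!FG; exact: hd. Qed.

Lemma T1D F G p q : T1 F p -> T1 G q -> T1 (fun s => F s + G s) (p + q).
Proof.
move=> hF hG e e0; have e20 : 0 < e / 2 by rewrite divr_gt0.
have [d d0 hd] := hF _ e20; have [d' d'0 hd'] := hG _ e20.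
exists (Num.min d d') => [|s]; rewrite lt_min ?d0 ?d'0 // => /andP[/hd sd /hd' sd'].
rewrite [X in `|X|](_ : _ = (F s - F 0 - p * s) + (G s - G 0 - q * s)); last ring.
by apply: (le_trans (ler_normD _ _)); lra.
Qed.

Lemma T1Z c F p : T1 F p -> T1 (fun s => c * F s) (c * p).
Proof.
move=> hF e e0; have c0 : 0 < `|c| + 1 by rewrite ltr_pwDr.
have [d d0 hd] := hF _ (divr_gt0 e0 c0); exists d => // s /hd h.
rewrite -mulrA -!mulrBr normrM; apply: (le_trans (ler_wpM2l (normr_ge0 _) h)).
rewrite mulrA ler_wpM2r // mulrA ler_pdivrMr // mulrC ler_wpM2l ?(ltW e0) //; lra.
Qed.

Lemma T2D F G p q r r' : T2 F p r -> T2 G q r' ->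
  T2 (fun s => F s + G s) (p + q) (r + r').
Proof.
move=> hF hG e e0; have e20 : 0 < e / 2 by rewrite divr_gt0.
have [d d0 hd] := hF _ e20; have [d' d'0 hd'] := hG _ e20.
exists (Num.min d d') => [|s]; rewrite lt_min ?d0 ?d'0 // => /andP[/hd sd /hd' sd'].
rewrite [X in `|X|](_ : _ = (F s - F 0 - p * s - r / 2 * s ^+ 2) +
   (G s - G 0 - q * s - r' / 2 * s ^+ 2)); last ring.
by apply: (le_trans (ler_normD _ _)); lra.
Qed.

Lemma T2Z c F p r : T2 F p r -> T2 (fun s => c * F s) (c * p) (c * r).
Proof.
move=> hF e e0; have c0 : 0 < `|c| + 1 by rewrite ltr_pwDr.
have [d d0 hd] := hF _ (divr_gt0 e0 c0); exists d => // s /hd h.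
rewrite [X in `|X|](_ : _ = c * (F s - F 0 - p * s - r / 2 * s ^+ 2)); last ring.
rewrite normrM; apply: (le_trans (ler_wpM2l (normr_ge0 _) h)).
rewrite mulrA ler_wpM2r ?sqr_ge0 // mulrA ler_pdivrMr // mulrC ler_wpM2l ?(ltW e0) //; lra.
Qed.

Lemma T2N F p r : T2 F p r -> T2 (fun s => - F s) (- p) (- r).
Proof. by move=> /(@T2Z (-1)); rewrite !mulN1r; apply: T2_ext => s; rewrite mulN1r. Qed.

Lemma T1N F p : T1 F p -> T1 (fun s => - F s) (- p).
Proof. by move=> /(@T1Z (-1)); rewrite !mulN1r; apply: T1_ext => s; rewrite mulN1r. Qed.

Lemma T2B F G p q r r' : T2 F p r -> T2 G q r' ->
  T2 (fun s => F s - G s) (p - q) (r - r').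
Proof. by move=> hF /T2N; exact: T2D. Qed.

Lemma T1B F G p q : T1 F p -> T1 G q -> T1 (fun s => F s - G s) (p - q).
Proof. by move=> hF /T1N; exact: T1D. Qed.

Lemma T2_quad c q r : T2 (fun s => c + q * s + r / 2 * s ^+ 2) q r.
Proof.
move=> e e0; exists 1 => // s _.
rewrite [X in `|X|](_ : _ = 0); first by rewrite normr0 mulr_ge0 ?sqr_ge0 // ltW.
ring.
Qed.

Lemma T1_lin c q : T1 (fun s => c + q * s) q.
Proof.
move=> e e0; exists 1 => // s _.
rewrite [X in `|X|](_ : _ = 0); first by rewrite normr0 mulr_ge0 // ltW.
ring.
Qed.

Lemma T2_T1 F p r : T2 F p r -> T1 F p.
Proof.
move=> h e e0; have [d d0 hd] := h 1 ltr01.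
have c0 : 0 < `|r| + 1 by rewrite ltr_pwDr.
exists (Num.min d (e / (`|r| + 1))) => [|s]; rewrite lt_min ?d0 ?divr_gt0 //.
move=> /andP[/hd sd]; rewrite ltr_pdivlMr // => se.
have -> : F s - F 0 - p * s = (F s - F 0 - p * s - r / 2 * s ^+ 2) + r / 2 * s ^+ 2 by ring.
apply: (le_trans (ler_normD _ _)); rewrite normrM normrX.
have -> : `|r / 2| = `|r| / 2 by rewrite normrM normfV (@ger0_norm _ 2).
have s2 : s ^+ 2 = `|s| ^+ 2 by rewrite real_normK ?num_real.
rewrite mul1r {2}s2 in sd; apply: (@le_trans _ _ ((`|s| * (`|r| + 1)) * `|s|)); last by rewrite ler_wpM2r // ltW.
have : 0 <= `|r| * `|s| ^+ 2 by rewrite mulr_ge0 ?sqr_ge0.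
by move: sd; lra.
Qed.

Lemma T2_scale F k p r : T2 F p r -> T2 (fun s => F (k * s)) (k * p) (k ^+ 2 * r).
Proof.
move=> h e e0; have c0 : 0 < `|k| + 1 by rewrite ltr_pwDr.
have [d d0 hd] := h _ (divr_gt0 e0 (exprn_gt0 2 c0)).
exists (d / (`|k| + 1)) => [|s]; rewrite ?divr_gt0 // ltr_pdivlMr // => sd.
have ks : `|k * s| < d.
  by rewrite normrM (le_lt_trans _ sd) // mulrC ler_wpM2l // lerDl.
have := hd _ ks; rewrite mulr0 => H.
rewrite [X in `|X|](_ : _ = F (k * s) - F 0 - p * (k * s) - r / 2 * (k * s) ^+ 2); last ring.
apply: (le_trans H); rewrite exprMn mulrA ler_wpM2r ?sqr_ge0 //.
rewrite mulrAC ler_pdivrMr ?exprn_gt0 // ler_wpM2l ?(ltW e0) //.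
by rewrite -[k ^+ 2]real_normK ?num_real // ler_sqr ?nnegrE ?(ltW c0) // lerDl.
Qed.

(** [F - G] has a local maximum at 0, so its first-order coefficient vanishes and its second-order
    one is nonpositive. Every comparison at a contact ends in this test or in one of the next
    two. *)
Lemma T2_touch F G p q r r' d : T2 F p r -> T2 G q r' -> 0 < d ->
  (forall s, `|s| < d -> F s - F 0 <= G s - G 0) -> p = q /\ r <= r'.
Proof.
move=> hF hG d0 le.
have hD : T2 (fun s => F s - G s) (p - q) (r - r') by exact: T2B.
have {}le s : `|s| < d -> F s - G s - (F 0 - G 0) <= 0 by move=> /le; lra.
move: hD le; set D := fun s => _; set a := p - q; set b := r - r' => hD le.
have aup t : `|t| = 1 -> a * t <= 0.
  move=> t1; rewrite leNgt; apply/negP => at0.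
  have [d' d'0 hd'] := T2_T1 hD (divr_gt0 at0 (ltr0n R 2)).
  pose m := Num.min d d' / 2.
  have m0 : 0 < m by rewrite divr_gt0 // lt_min d0.
  have [md md'] : m < d /\ m < d'.
    by split; rewrite /m; [have := ge_min d d d'|have := ge_min d' d d']; rewrite lexx ?orbT => mm; move: m0; rewrite /m; lra.
  have ns : `|t * m| = m by rewrite normrM t1 mul1r gtr0_norm.
  have := hd' (t * m); rewrite ns => /(_ md'); rewrite ler_norml => /andP[h _].
  have := le (t * m); rewrite ns => /(_ md) h2.
  have : 0 < a * t * m by rewrite mulr_gt0.
  by move: h h2; rewrite /D; nra.
have a0 : a = 0.
  have := aup 1 (normr1 _); have := aup (-1); rewrite normrN1 => /(_ erefl); lra.
split; first by apply/eqP; rewrite -subr_eq0 -/a a0.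
rewrite -subr_le0 -/b leNgt; apply/negP => b0.
have [d' d'0 hd'] := hD (b / 4) (divr_gt0 b0 (ltr0n R 4)).
pose m := Num.min d d' / 2.
have m0 : 0 < m by rewrite divr_gt0 // lt_min d0.
have [md md'] : m < d /\ m < d'.
  by split; rewrite /m; [have := ge_min d d d'|have := ge_min d' d d']; rewrite lexx ?orbT => mm; move: m0; rewrite /m; lra.
have ns : `|m| = m by rewrite gtr0_norm.
have := hd' m; rewrite ns => /(_ md'); rewrite ler_norml a0 => /andP[h _].
have := le m; rewrite ns => /(_ md) h2.
have : 0 < b * m ^+ 2 by rewrite mulr_gt0 // exprn_gt0.
by move: h h2; rewrite /D; lra.
Qed.

(** The allowance [C s^2] absorbs penalties and remainders; it is negligible against [s] on both
    sides of 0. *)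
Lemma T1_touch F p q C d : T1 F p -> 0 < d ->
  (forall s, `|s| < d -> F s - F 0 <= q * s + C * s ^+ 2) -> p = q.
Proof.
move=> hF d0 le.
have aup t : `|t| = 1 -> (p - q) * t <= 0.
  move=> t1; rewrite leNgt; apply/negP => at0.
  have [d' d'0 hd'] := hF _ (divr_gt0 at0 (ltr0n R 4)).
  have c0 : 0 < `|C| + 1 by rewrite ltr_pwDr.
  pose m := Num.min (Num.min d d') ((p - q) * t / (4 * (`|C| + 1))) / 2.
  have m0 : 0 < m by rewrite divr_gt0 // !lt_min d0 d'0 divr_gt0 // mulr_gt0.
  have mle : m < Num.min (Num.min d d') ((p - q) * t / (4 * (`|C| + 1))).
    by move: m0; rewrite /m; lra.
  move: mle; rewrite !lt_min => /andP[/andP[md md']].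
  rewrite ltr_pdivlMr ?mulr_gt0 // => mC.
  have ns : `|t * m| = m by rewrite normrM t1 mul1r gtr0_norm.
  have := hd' (t * m); rewrite ns => /(_ md'); rewrite ler_norml => /andP[h _].
  have := le (t * m); rewrite ns => /(_ md) h2.
  have t2 : t ^+ 2 = 1 by rewrite -(@real_normK _ t) ?num_real // t1 expr1n.
  have Ct : C * (t * m) ^+ 2 <= `|C| * m * m.
    by rewrite exprMn t2 mul1r expr2 mulrA !ler_wpM2r ?(ltW m0) // ler_norm.
  have : 0 < (p - q) * t * m by rewrite mulr_gt0.
  have : m * (4 * (`|C| + 1)) * m < (p - q) * t * m by rewrite ltr_pM2r.
  have : 0 < m * m by rewrite mulr_gt0.
  by move: h h2 Ct; nra.
have := aup 1 (normr1 _); have := aup (-1); rewrite normrN1 => /(_ erefl); lra.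
Qed.

(** One-sided version for a minimum over a time interval, which may sit at the final time, so that
    only earlier times can be tested. *)
Lemma T1_left F p q C d : T1 F p -> 0 < d ->
  (forall s, 0 < s < d -> - (q * s) - C * s ^+ 2 <= F (- s) - F 0) -> p <= q.
Proof.
move=> hF d0 le; rewrite leNgt -subr_gt0; apply/negP => at0.
have [d' d'0 hd'] := hF _ (divr_gt0 at0 (ltr0n R 4)).
have c0 : 0 < `|C| + 1 by rewrite ltr_pwDr.
pose m := Num.min (Num.min d d') ((p - q) / (4 * (`|C| + 1))) / 2.
have m0 : 0 < m by rewrite divr_gt0 // !lt_min d0 d'0 divr_gt0 // mulr_gt0.
have mle : m < Num.min (Num.min d d') ((p - q) / (4 * (`|C| + 1))).
  by move: m0; rewrite /m; lra.
move: mle; rewrite !lt_min => /andP[/andP[md md']].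
rewrite ltr_pdivlMr ?mulr_gt0 // => mC.
have ns : `|- m| = m by rewrite normrN gtr0_norm.
have := hd' (- m); rewrite ns => /(_ md'); rewrite ler_norml => /andP[_ h].
have := le m; rewrite m0 => /(_ md) h2.
have Ct : C * m ^+ 2 <= `|C| * m * m.
  by rewrite expr2 mulrA !ler_wpM2r ?(ltW m0) // ler_norm.
have : 0 < (p - q) * m by rewrite mulr_gt0.
have : m * (4 * (`|C| + 1)) * m < (p - q) * m by rewrite ltr_pM2r.
have : 0 < m * m by rewrite mulr_gt0.
by move: h h2 Ct; nra.
Qed.

Lemma T1_derivable (V : normedModType R) (g : V -> R) x v :
  derivable g x v -> T1 (fun s => g (x + s *: v)) ('D_v g x).
Proof.
move=> /cvg_ex[l gl]; have -> : 'D_v g x = l by exact/cvg_lim.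
move: gl => /cvgrPdist_le gl e e0.
have := gl _ e0; rewrite near_withinE => /nbhs_ballP[d /= d0 hd].
exists d => // s sd; rewrite scale0r addr0.
have [->|s0] := eqVneq s 0; first by rewrite scale0r addr0 subrr mulr0 subr0 normr0 mulr0.
have := hd s; rewrite /ball /= sub0r normrN => /(_ sd s0).
rewrite /= [s *: v + x]addrC => h.
have -> : g (x + s *: v) - g x - l * s = - (l - s^-1 * (g (x + s *: v) - g x)) * s.
  by field.
by rewrite normrM normrN ler_wpM2r.
Qed.

Lemma T1_is_derive F x p : T1 (fun s => F (x + s)) p -> is_derive x 1 F p.
Proof.
move=> h.
have H : (fun h => h^-1 *: ((F \o shift x) (h *: 1) - F x)) @ 0^' --> p.
  apply/cvgrPdist_le => e e0; have [d d0 hd] := h e e0.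
  rewrite near_withinE; apply/nbhs_ballP; exists d => //= s.
  rewrite /ball /= sub0r normrN => sd s0.
  have := hd s sd; rewrite addr0 => h1.
  have -> : p - s^-1 *: (F (s *: 1 + x) - F x) = - (F (x + s) - F x - p * s) / s.
    by rewrite /GRing.scale /= mulr1 (addrC s); field.
  by rewrite normrM normrN normfV ler_pdivrMr ?normr_gt0.
split; first by apply/cvg_ex; exists p.
exact/cvg_lim.
Qed.

Lemma T1_continuous F x p : T1 (fun s => F (x + s)) p -> {for x, continuous F}.
Proof.
move=> /T1_is_derive[dF _].
by apply: differentiable_continuous; exact/derivable1_diffP.
Qed.

(** The mean value theorem is applied to [F] minus its Taylor polynomial, whose derivative is
    [o(s)]. *)
Lemma T2_of_T1 F F' r : (exists2 d, 0 < d & forall s, `|s| < d ->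
    T1 (fun t => F (s + t)) (F' s)) -> T1 F' r -> T2 F (F' 0) r.
Proof.
move=> [d0 d00 hd0] h e e0; have [d1 d10 hd1] := h e e0.
exists (Num.min d0 d1) => [|s]; rewrite lt_min ?d00 // => /andP[sd0 sd1].
pose g t := F t - F' 0 * t - r / 2 * t ^+ 2.
have dg t : `|t| < d0 -> T1 (fun u => g (t + u)) (F' t - F' 0 - r * t).
  move=> td; rewrite /g.
  have h1 := hd0 t td.
  have h2 : T2 (fun u => F' 0 * t + r / 2 * t ^+ 2 + (F' 0 + r * t) * u + r / 2 * u ^+ 2)
    (F' 0 + r * t) r by exact: T2_quad.
  have := T1B h1 (T2_T1 h2).
  rewrite (_ : F' t - (F' 0 + r * t) = F' t - F' 0 - r * t); last ring.
  by apply: T1_ext => u; field.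
have key a b : a <= b -> (forall c, a <= c <= b -> `|c| <= `|s|) -> `|g b - g a| <= e * `|s| * (b - a).
  move=> ab hc.
  have bd c : a <= c <= b -> `|c| < d0 by move=> /hc/le_lt_trans; apply.
  have [||c cab ->] := @MVT_segment R g (fun t => F' t - F' 0 - r * t) a b ab.
  - move=> c; rewrite in_itv /= => /andP[/ltW ac /ltW cb]; apply: T1_is_derive; apply: dg; apply: bd.
    by rewrite ac.
  - apply: continuous_in_subspaceT => c; rewrite inE /= in_itv /= => /bd/dg.
    exact: T1_continuous.
  - move: cab; rewrite in_itv /= => cab.
    rewrite normrM [X in _ * X]ger0_norm ?subr_ge0 // ler_wpM2r ?subr_ge0 //.
    have cs := hc _ cab; apply: (le_trans (hd1 _ (le_lt_trans cs sd1))).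
    by rewrite ler_wpM2l // ltW.
have -> : F s - F 0 - F' 0 * s - r / 2 * s ^+ 2 = g s - g 0 by rewrite /g; ring.
have s2 : s ^+ 2 = `|s| * `|s| by rewrite -expr2 real_normK ?num_real.
have [s0|s0] := leP 0 s.
  apply: (le_trans (key 0 s s0 _)) => [c /andP[c0 cs]|]; first by rewrite !ger0_norm.
  by rewrite s2 (ger0_norm s0) subr0 mulrA.
rewrite distrC; apply: (le_trans (key s 0 (ltW s0) _)) => [c /andP[c0 cs]|].
  by rewrite !ler0_norm ?lerN2 // ltW.
by rewrite s2 (ltr0_norm s0) sub0r mulrA.
Qed.

Lemma T2_exp k c : T2 (fun s => expR (c + k * s)) (k * expR c) (k ^+ 2 * expR c).
Proof.
have dexp a s : T1 (fun t => a * expR (c + k * (s + t))) (a * (k * expR (c + k * s))).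
  apply: T1Z.
  have : T1 (fun t => expR (c + k * s + t * 1)) ('D_1 expR (c + k * s)).
    by apply: T1_derivable; exact: derivable_expR.
  rewrite derive_val => h.
  have := @T2_scale; move=> _.
  move=> e e0; have c0 : 0 < `|k| + 1 by rewrite ltr_pwDr.
  have [d d0 hd] := h _ (divr_gt0 e0 c0).
  exists (d / (`|k| + 1)) => [|t]; rewrite ?divr_gt0 // ltr_pdivlMr // => td.
  have kt : `|k * t| < d.
    by rewrite normrM (le_lt_trans _ td) // mulrC ler_wpM2l // lerDl.
  have := hd _ kt; rewrite !mul0r !mulr1 !addr0 => H.
  rewrite mulrDr addrA [X in `|X|](_ : _ = expR (c + k * s + k * t) - expR (c + k * s) - expR (c + k * s) * (k * t)); last ring.
  apply: (le_trans H); rewrite normrM mulrA ler_wpM2r // mulrAC ler_pdivrMr //.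
  by rewrite ler_wpM2l ?(ltW e0) // lerDl.
have := @T2_of_T1 (fun s => expR (c + k * s)) (fun s => k * expR (c + k * s)) (k ^+ 2 * expR c).
rewrite mulr0 addr0; apply.
  exists 1 => // s _; have := dexp 1 s; rewrite mul1r; apply: T1_ext => t; by rewrite mul1r.
have := dexp k 0; rewrite mulr0 addr0 mulrA -expr2; apply: T1_ext => t; by rewrite add0r.
Qed.

End Expansions.

Section Calculus.
Context {R : realType} {N : nat}.
Implicit Types (h : 'rV[R]_N -> R) (x xi : 'rV[R]_N).

(** Together with [|c| <= |t|] the sign condition says that [c] lies between 0 and [t], whatever the
    sign of [t]. *)
Lemma mean_value (g g' : R -> R) : (forall t, T1 (fun s => g (t + s)) (g' t)) ->
  forall t, exists c, [/\ `|c| <= `|t|, 0 <= c * t & g t - g 0 = g' c * t].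
Proof.
move=> hg.
have key a b : a <= b -> exists2 c, a <= c <= b & g b - g a = g' c * (b - a).
  move=> ab; have [||c cab ->] := @MVT_segment R g g' a b ab.
  - by move=> c _; exact: T1_is_derive.
  - apply: continuous_in_subspaceT => c _; exact: T1_continuous (hg c).
  - by exists c => //; move: cab; rewrite in_itv.
move=> t; have [t0|t0] := leP 0 t.
  have [c /andP[c0 ct] ->] := key 0 t t0; exists c; split; last by rewrite subr0.
    by rewrite !ger0_norm.
  by rewrite mulr_ge0.
have [c /andP[c0 ct] e] := key t 0 (ltW t0); exists c; split; last by lra.
  by rewrite !ler0_norm ?lerN2 // ltW.
by rewrite mulr_le0 // ltW.
Qed.

Lemma continuousE h x : {for x, continuous h} -> forall e, 0 < e ->
  exists2 d, 0 < d & forall y, `|y - x| < d -> `|h y - h x| <= e.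
Proof.
move=> /cvgrPdist_le hc e /hc /nbhs_ballP[d /= d0 hd]; exists d => // y yd.
by rewrite distrC; apply: hd; rewrite -ball_normE /= distrC.
Qed.

Lemma T1_sum (I : Type) (l : seq I) (F : I -> R -> R) (p : I -> R) :
  (forall i, T1 (F i) (p i)) -> T1 (fun s => \sum_(i <- l) F i s) (\sum_(i <- l) p i).
Proof.
move=> hF; elim: l => [|i l IH].
  by move=> e e0; exists 1 => // s _; rewrite !big_nil !(subrr, mul0r, subr0) normr0 mulr_ge0 // ltW.
by rewrite big_cons; apply: T1_ext (T1D (hF i) IH) => s; rewrite big_cons.
Qed.

Lemma line_T1 h x xi : has_partials h -> (forall i, continuous (partial i h)) ->
  T1 (fun s => h (x + s *: xi)) (dot (grad h x) xi).
Proof.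
move=> hp hc.
(* [xi] is assembled one coordinate at a time: each step uses the mean value theorem along a single
   basis vector, and continuity of that partial derivative brings it back to [x]. *)
suff H (l : seq 'I_N) : forall e, 0 < e -> exists2 d, 0 < d & forall s, `|s| < d ->
    `|h (x + s *: (\sum_(i <- l) xi 0 i *: basis_vec i)) - h x -
      (\sum_(i <- l) partial i h x * xi 0 i) * s| <= e * `|s|.
  move=> e e0; have [d d0 hd] := H (index_enum _) e e0; exists d => // s sd.
  have := hd s sd; rewrite scale0r addr0.
  have -> : \sum_i xi 0 i *: basis_vec i = xi by rewrite [RHS]row_sum_delta.
  have -> // : dot (grad h x) xi = \sum_i partial i h x * xi 0 i.
  by apply: eq_bigr => i _; rewrite mxE.
elim: l => [|i l IH] e e0.
  by exists 1 => // s _; rewrite !big_nil scaler0 addr0 subrr mul0r subr0 normr0 mulr_ge0 // ltW.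
pose w := \sum_(j <- l) xi 0 j *: basis_vec j : 'rV[R]_N.
have e2 : 0 < e / 2 by rewrite divr_gt0.
have [d d0 hd] := IH _ e2.
have c0 : 0 < `|xi 0 i| + 1 by rewrite ltr_pwDr.
have [d' d'0 hd'] := continuousE (hc i x) (divr_gt0 e2 c0).
have b0 : 0 < `|w| + `|xi 0 i| * `|basis_vec i : 'rV[R]_N| + 1.
  by rewrite ltr_pwDr // addr_ge0 // mulr_ge0.
exists (Num.min d (d' / (`|w| + `|xi 0 i| * `|basis_vec i : 'rV[R]_N| + 1))) => [|s].
  by rewrite lt_min d0 divr_gt0.
rewrite lt_min ltr_pdivlMr // => /andP[sd sd'].
rewrite !big_cons -/w.
have [|c [cle _]] := @mean_value (fun t => h (x + s *: w + t *: basis_vec i))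
  (fun t => partial i h (x + s *: w + t *: basis_vec i)) _ (s * xi 0 i).
  move=> t; have := T1_derivable (hp (x + s *: w + t *: basis_vec i) i).
  by apply: T1_ext => u; rewrite scalerDl addrA.
rewrite scale0r addr0 => e1.
have -> : x + s *: (xi 0 i *: basis_vec i + w) = x + s *: w + (s * xi 0 i) *: basis_vec i.
  by rewrite scalerDr scalerA addrAC addrA.
set y := x + s *: w + c *: basis_vec i in e1.
have yx : `|partial i h y - partial i h x| <= e / 2 / (`|xi 0 i| + 1).
  apply: hd'; rewrite /y -(addrA x) (addrC x) addrK.
  apply: le_lt_trans sd'; rewrite (le_trans (ler_normD _ _)) // !normrZ.
  have : `|c| * `|basis_vec i : 'rV[R]_N| <= `|s| * `|xi 0 i| * `|basis_vec i : 'rV[R]_N|.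
    by rewrite -normrM ler_wpM2r.
  have := normr_ge0 s; set A := `|basis_vec i : 'rV[R]_N|; nra.
have := hd s sd; rewrite -/w => h1.
rewrite [X in `|X|](_ : _ = (h (x + s *: w) - h x - (\sum_(j <- l) partial j h x * xi 0 j) * s)
  + (partial i h y - partial i h x) * (s * xi 0 i)); last first.
  by move: e1; rewrite mulrBl; lra.
apply: (le_trans (ler_normD _ _)).
have : `|(partial i h y - partial i h x) * (s * xi 0 i)| <= e / 2 * `|s|.
  rewrite !normrM (mulrC `|s|) mulrA ler_wpM2r //.
  apply: (le_trans (ler_wpM2r (normr_ge0 _) yx)).
  rewrite mulrAC ler_pdivrMr // ler_wpM2l ?(ltW e2) // lerDl //.
lra.
Qed.

Definition hess h x : 'M[R]_N := \matrix_(i, j) partial i (partial j h) x.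

Lemma line_T2 h x xi : has_partials h -> (forall i, continuous (partial i h)) ->
  (forall i, has_partials (partial i h)) ->
  (forall i j, continuous (partial j (partial i h))) ->
  T2 (fun s => h (x + s *: xi)) (dot (grad h x) xi) (qf (hess h x) xi).
Proof.
move=> hp hc hp2 hc2.
have := @T2_of_T1 _ (fun s => h (x + s *: xi)) (fun s => dot (grad h (x + s *: xi)) xi)
  (qf (hess h x) xi); rewrite scale0r addr0; apply.
  exists 1 => // s _; have := line_T1 (x + s *: xi) xi hp hc.
  by apply: T1_ext => t; rewrite scalerDl addrA.
have -> : qf (hess h x) xi = \sum_i dot (grad (partial i h) x) xi * xi 0 i.
  rewrite qfE exchange_big /=; apply: eq_bigr => i _; rewrite mulr_suml.
  by apply: eq_bigr => j _; rewrite !mxE.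
have := @T1_sum _ (index_enum 'I_N) (fun i s => partial i h (x + s *: xi) * xi 0 i)
  (fun i => dot (grad (partial i h) x) xi * xi 0 i).
move=> H; apply: T1_ext (H _) => [s|i].
  by rewrite /dot; apply: eq_bigr => i _; rewrite mxE.
have := T1Z (xi 0 i) (line_T1 x xi (hp2 i) (hc2 i)); rewrite mulrC.
by apply: T1_ext => s; rewrite mulrC.
Qed.

End Calculus.

Lemma continuous_pair (T U V : topologicalType) (f : T -> U) (g : T -> V) x :
  {for x, continuous f} -> {for x, continuous g} ->
  {for x, continuous (fun y => (f y, g y))}.
Proof.
by move=> cf cg; apply: (@cvg_pair _ _ _ _ _ _ _ _ _ f g).
Qed.

(** * Nondivergence form *)

Section Nondivergence.
Context {R : realType} {N : nat}.
Implicit Types (a A : 'rV[R]_N -> 'M[R]_N) (b q : 'rV[R]_N -> 'rV[R]_N).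
Implicit Types (f : 'rV[R]_N -> R -> R) (u : R -> 'rV[R]_N -> R).

(** Space derivatives enter only as the coefficients [p] and [H] of expansions at one point, so no
    regularity of them is carried along. [ut] is kept as a function because its continuity and its
    positivity are used. *)
Definition solves a b f u (ut : R -> 'rV[R]_N -> R) : Prop :=
  [/\ continuous (fun p : R * 'rV[R]_N => u p.1 p.2),
      continuous (fun p : R * 'rV[R]_N => ut p.1 p.2),
      forall t x, T1 (fun s => u (t + s) x) (ut t x)
    & forall t x, exists p H,
        (forall xi, T2 (fun s => u t (x + s *: xi)) (dot p xi) (qf H xi)) /\
        ut t x = mtr (a x) H + dot (b x) p + f x (u t x)].

Definition drift A q (x : 'rV[R]_N) : 'rV[R]_N :=
  \row_j (\sum_i partial i (fun y => A y i j) x + q x 0 j).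

Lemma divergence_expand A h x :
  (forall i j, has_partials (fun y => A y i j)) ->
  (forall i, has_partials (partial i h)) ->
  divergence (fun y => grad h y *m (A y)^T) x =
  mtr (A x) (hess h x) + \sum_j (\sum_i partial i (fun y => A y i j) x) * partial j h x.
Proof.
move=> hA hh.
have E i : partial i (fun y => (grad h y *m (A y)^T) 0 i) x =
    \sum_j (partial j h x * partial i (fun y => A y i j) x + A x i j * partial i (partial j h) x).
  rewrite /partial.
  have -> : (fun y => (grad h y *m (A y)^T) 0 i) =
      \sum_j (('D_(basis_vec j) h : 'rV[R]_N -> R) * (fun y => A y i j)).
    by apply/funext => y; rewrite fct_sumE mxE; apply: eq_bigr => j _; rewrite !mxE.
  rewrite derive_sum => [|j]; last by apply: derivableM; [exact: hh|exact: hA].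
  by apply: eq_bigr => j _; rewrite deriveM; [|exact: hh|exact: hA].
rewrite /divergence /mtr (eq_bigr _ (fun i _ => E i)).
under eq_bigr do rewrite big_split.
rewrite big_split /= addrC; congr (_ + _).
  by apply: eq_bigr => i _; apply: eq_bigr => j _; rewrite mxE.
rewrite exchange_big; apply: eq_bigr => j _; rewrite mulr_suml.
by apply: eq_bigr => i _; rewrite mulrC.
Qed.

Lemma entire_solution_solves A q f u :
  (forall i j, has_partials (fun y => A y i j)) ->
  entire_solution A q f u ->
  solves A (drift A q) f u (fun t x => derive1 (u ^~ x) t).
Proof.
move=> hA [[uc [du dtc] [up upc] [up2 up2c]] eq]; split=> // t x.
  have := T1_derivable (du t x); rewrite derive1E.
  by apply: T1_ext => s; rewrite /GRing.scale /= mulr1.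
have slice (g : R -> 'rV[R]_N -> R) :
    continuous (fun p : R * 'rV[R]_N => g p.1 p.2) -> continuous (g t).
  move=> gc y; apply: (@continuous_comp _ _ _ (fun y => (t, y)) (fun p => g p.1 p.2)); last exact: gc.
  by apply: continuous_pair; [exact: cst_continuous|move=> U].
exists (grad (u t) x), (hess (u t) x); split=> [xi|].
  apply: line_T2 => [|i||i j]; first exact: up.
  - exact: (slice (fun t => partial i (u t))).
  - exact: up2.
  - exact: (slice (fun t => partial j (partial i (u t)))).
rewrite eq divergence_expand //; congr (_ + _); rewrite -addrA; congr (_ + _).
rewrite /dot -big_split; apply: eq_bigr => i _; rewrite !mxE mulrDl; congr (_ + _).
Qed.

End Nondivergence.

(** * Compactness and waves *)

(* The equation in nondivergence form [u_t = tr (a D^2 u) + b . grad u + f x u],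
   where [b] absorbs the divergence of the diffusion matrix. *)
Record setting (R : realType) (N : nat) := Setting {
  L : 'I_N -> R;
  a : 'rV[R]_N -> 'M[R]_N;
  b : 'rV[R]_N -> 'rV[R]_N;
  f : 'rV[R]_N -> R -> R;
  lam : R; Ct : R; Ka : R; Cb : R; Kf : R; theta : R; rho : R;
  L_gt0 : forall i, 0 < L i;
  a_sym : forall x i j, a x i j = a x j i;
  lam_gt0 : 0 < lam;
  a_ell : forall x xi, lam * dot xi xi <= qf (a x) xi;
  a_tr : forall x, \tr (a x) <= Ct;
  Ka_ge0 : 0 <= Ka;
  a_lip : forall x y xi, `|qf (a x) xi - qf (a y) xi| <= Ka * nrm (x - y) * dot xi xi;
  Cb_ge0 : 0 <= Cb;
  b_bnd : forall x, nrm (b x) <= Cb;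
  Kf_ge0 : 0 <= Kf;
  f_lip : forall x u v, 0 <= u <= 1 -> 0 <= v <= 1 -> `|f x u - f x v| <= Kf * `|u - v|;
  f_cont : forall u, 0 <= u <= 1 -> continuous (f ^~ u);
  theta_itv : 0 < theta < 1;
  f_0 : forall x u, 0 <= u <= theta -> f x u = 0;
  f_1 : forall x, f x 1 = 0;
  f_pos : forall u, theta < u < 1 -> exists x, 0 < f x u;
  rho_gt0 : 0 < rho;
  f_mono : forall x u v, 0 <= u -> 1 - rho < u -> u <= v -> v <= 1 -> f x v <= f x u
}.

Section Compactness.
Context {R : realType} {N : nat}.

Lemma max_on (T : topologicalType) (g : T -> R) (K : set T) :
  K !=set0 -> compact K -> continuous g -> exists2 c, K c & forall t, K t -> g t <= g c.
Proof.
move=> K0 cK cg; have [|c] := compact_EVT_max K0 cK (f := g).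
  exact: continuous_subspaceT.
by rewrite inE => Kc h; exists c => // t Kt; apply: h; rewrite inE.
Qed.

Lemma min_on (T : topologicalType) (g : T -> R) (K : set T) :
  K !=set0 -> compact K -> continuous g -> exists2 c, K c & forall t, K t -> g c <= g t.
Proof.
move=> K0 cK cg; have [|c Kc h] := max_on K0 cK (g := fun x => - g x).
  by move=> x; apply: continuousN; exact: cg.
by exists c => // t /h; rewrite lerN2.
Qed.

Section Combinators.
Context {T : topologicalType}.
Implicit Types (g h : T -> R).

Lemma continuous_addf g h : continuous g -> continuous h -> continuous (fun x => g x + h x).
Proof. by move=> cg ch x; apply: continuousD; [exact: cg|exact: ch]. Qed.

Lemma continuous_subf g h : continuous g -> continuous h -> continuous (fun x => g x - h x).
Proof. by move=> cg ch x; apply: continuousB; [exact: cg|exact: ch]. Qed.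

Lemma continuous_oppf g : continuous g -> continuous (fun x => - g x).
Proof. by move=> cg x; apply: continuousN; exact: cg. Qed.

Lemma continuous_mulf g h : continuous g -> continuous h -> continuous (fun x => g x * h x).
Proof. by move=> cg ch x; apply: continuousM; [exact: cg|exact: ch]. Qed.

Lemma continuous_cstf (c : R) : continuous (fun _ : T => c).
Proof. by move=> x; exact: cst_continuous. Qed.

Lemma continuous_compf (U : topologicalType) (k : U -> R) (g : T -> U) :
  continuous k -> continuous g -> continuous (fun x => k (g x)).
Proof. by move=> ck cg x; apply: (@continuous_comp _ _ _ g k); [exact: cg|exact: ck]. Qed.

Lemma continuous_curry (u : R -> 'rV[R]_N -> R) g (h : T -> 'rV[R]_N) :
  continuous (fun p : R * 'rV[R]_N => u p.1 p.2) ->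
  continuous g -> continuous h -> continuous (fun x => u (g x) (h x)).
Proof.
move=> cu cg ch x.
apply: (@continuous_comp _ _ _ (fun x => (g x, h x)) (fun p => u p.1 p.2)); last exact: cu.
by apply: continuous_pair; [exact: cg|exact: ch].
Qed.

Lemma continuous_subv (g h : T -> 'rV[R]_N) :
  continuous g -> continuous h -> continuous (fun x => g x - h x).
Proof. by move=> cg ch x; apply: continuousB; [exact: cg|exact: ch]. Qed.

Lemma continuous_addv (g h : T -> 'rV[R]_N) :
  continuous g -> continuous h -> continuous (fun x => g x + h x).
Proof. by move=> cg ch x; apply: continuousD; [exact: cg|exact: ch]. Qed.

Lemma continuous_scalev (k : T -> R) (g : T -> 'rV[R]_N) :
  continuous k -> continuous g -> continuous (fun x => k x *: g x).
Proof. by move=> ck cg x; apply: continuousZ; [exact: ck|exact: cg]. Qed.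

End Combinators.

Lemma continuous_prod3 (T1 T2 T3 : topologicalType) :
  [/\ continuous (fun p : T1 * T2 * T3 => p.1.1), continuous (fun p : T1 * T2 * T3 => p.1.2)
    & continuous (fun p : T1 * T2 * T3 => p.2)].
Proof.
split=> p; last exact: cvg_snd.
  by apply: (@continuous_comp _ _ _ fst fst); exact: cvg_fst.
by apply: (@continuous_comp _ _ _ fst snd); [exact: cvg_fst|exact: cvg_snd].
Qed.

Lemma dist_continuous (T : topologicalType) (g h : T -> R) :
  continuous g -> continuous h -> continuous (fun x => `|g x - h x|).
Proof.
move=> cg ch x; apply: (@continuous_comp _ _ _ (fun x => g x - h x) Num.norm).
  by apply: continuousB; [exact: cg|exact: ch].
exact: norm_continuous.
Qed.

Definition ball_nrm (B : R) : set 'rV[R]_N := [set x | nrm x <= B].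

Lemma dot_continuous (T : topologicalType) (g h : T -> 'rV[R]_N) :
  continuous g -> continuous h -> continuous (fun x => dot (g x) (h x)).
Proof.
move=> cg ch; rewrite /dot; elim: (index_enum _) => [|i l IH].
  by under eq_fun do rewrite big_nil; exact: cst_continuous.
under eq_fun do rewrite big_cons.
have C (k : T -> 'rV[R]_N) : continuous k -> continuous (fun x => k x 0 i).
  move=> ck x; apply: (@continuous_comp _ _ _ k (fun v : 'rV[R]_N => v 0 i)).
    exact: ck.
  exact: coord_continuous.
by apply: continuous_addf IH; apply: continuous_mulf; exact: C.
Qed.

Lemma nrm_continuous : continuous (@nrm R N).
Proof.
move=> x; apply: (@continuous_comp _ _ _ (fun x : 'rV[R]_N => dot x x) Num.sqrt).
  by apply: dot_continuous => y U.
exact: sqrt_continuous.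
Qed.

Lemma closed_le (T : topologicalType) (g h : T -> R) : continuous g -> continuous h ->
  closed [set x | g x <= h x].
Proof.
move=> cg ch; rewrite (_ : mkset _ = (fun x => h x - g x) @^-1` [set y | 0 <= y]).
  apply: preimage_closed => [x _|]; last exact: closed_ge.
  by apply: continuousB; [exact: ch|exact: cg].
by apply/seteqP; split=> x /=; rewrite subr_ge0.
Qed.

Lemma ball_nrm_compact B : compact (ball_nrm B).
Proof.
apply: bounded_closed_compact.
  exists B; split; first exact: num_real.
  move=> M BM x /= xB; apply: (le_trans (norm_le_nrm x)); exact: le_trans xB (ltW BM).
by apply: closed_le; [exact: nrm_continuous|exact: cst_continuous].
Qed.

Lemma itv_compact (c d : R) : compact [set x : R | c <= x <= d].
Proof.
rewrite (_ : mkset _ = `[c, d]%classic); first exact: segment_compact.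
by apply/seteqP; split=> x /=; rewrite in_itv.
Qed.

Lemma lattice_cover (L : 'I_N -> R) : (forall i, 0 < L i) -> exists2 B, 0 <= B &
  forall x, exists2 k, lattice L k & nrm (x + k) <= B.
Proof.
move=> L_gt0.
exists (\sum_i L i); first by apply: sumr_ge0 => i _; rewrite ltW.
move=> x; exists (\row_i (L i * (- Num.floor (x 0 i / L i))%:~R)).
  by exists (fun i => - Num.floor (x 0 i / L i)) => i; rewrite mxE.
apply: (le_trans (nrm_le_sum _)); apply: ler_sum => i _; rewrite !mxE.
have Li := L_gt0 i.
have e : x 0 i = L i * (x 0 i / L i) by field; rewrite gt_eqF.
set y := x 0 i / L i in e *; rewrite e -mulrDr normrM gtr0_norm // -[leRHS]mulr1.
rewrite ler_wpM2l ?(ltW Li) // mulrNz ger0_norm ?subr_ge0; last exact: floor_le.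
have := floorD1_gt y; rewrite intrD1; lra.
Qed.

End Compactness.

Section Waves.
Context {R : realType} {N : nat} (S : setting R N).
Implicit Types (n x k : 'rV[R]_N) (c t z e : R) (u ut : R -> 'rV[R]_N -> R).

Record wave n c u ut := Wave {
  w_n1 : dot n n = 1;
  w_c0 : 0 < c;
  w_sol : solves (a S) (b S) (f S) u ut;
  w_pul : forall k t x, lattice (L S) k -> u t x = u (t + dot k n / c) (x + k);
  w_01 : forall t x, 0 < u t x < 1;
  w_lim : forall B e, 0 < e -> exists T, forall t x, nrm x <= B ->
    (t <= - T -> u t x <= e) /\ (T <= t -> 1 - e <= u t x) }.

(* [u t x = U (x . n - c t) x] with [U = prof n c u]. *)
Definition prof n c (u : R -> 'rV[R]_N -> R) z x := u ((dot x n - z) / c) x.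

Lemma lattice_reduce : exists2 B, 0 <= B &
  forall x, exists2 k, lattice (L S) k & nrm (x + k) <= B.
Proof. exact: lattice_cover (L_gt0 S). Qed.

Lemma T1_unique (F : R -> R) p q : T1 F p -> T1 F q -> p = q.
Proof.
move=> hp hq; apply/eqP; rewrite -subr_eq0; apply/eqP.
have h := T1B hp hq; apply: (@T1_touch R _ _ 0 0 1 h) => // s _.
rewrite mul0r mul0r addr0; lra.
Qed.

Section OneWave.
Variables (n : 'rV[R]_N) (c : R) (u ut : R -> 'rV[R]_N -> R).
Hypothesis W : wave n c u ut.
Local Notation U := (prof n c u).
Local Notation Ut := (prof n c ut).

Let c0 := w_c0 W.
Let cn0 : c != 0. Proof. by rewrite gt_eqF. Qed.

Lemma u_prof t x : u t x = U (dot x n - c * t) x.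
Proof. by rewrite /prof opprB addrC subrK mulrC mulKf. Qed.

Lemma ut_pul k t x : lattice (L S) k -> ut t x = ut (t + dot k n / c) (x + k).
Proof.
move=> hk; have [_ _ hT _] := w_sol W.
apply: T1_unique (hT t x) _; apply: T1_ext (hT _ _) => s /=.
by rewrite (w_pul W (t + s) x hk) addrAC.
Qed.

Lemma prof_per k z x : lattice (L S) k -> U z (x + k) = U z x.
Proof.
by move=> hk; rewrite /prof [RHS](w_pul W _ _ hk) dotDl addrAC [in LHS]mulrDl.
Qed.

Lemma proft_per k z x : lattice (L S) k -> Ut z (x + k) = Ut z x.
Proof.
by move=> hk; rewrite /prof [RHS](ut_pul _ _ hk) dotDl addrAC [in LHS]mulrDl.
Qed.

Lemma prof_01 z x : 0 < U z x < 1. Proof. exact: w_01 W _ _. Qed.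

Lemma reparam_continuous (g : R -> 'rV[R]_N -> R) :
  continuous (fun p : R * 'rV[R]_N => g p.1 p.2) ->
  continuous (fun p : R * 'rV[R]_N => prof n c g p.1 p.2).
Proof.
move=> cg p; apply: (@continuous_comp _ _ _
  (fun p : R * 'rV[R]_N => ((dot p.2 n - p.1) / c, p.2)) (fun p => g p.1 p.2)); last exact: cg.
apply: continuous_pair; last exact: cvg_snd.
apply: continuousM; last exact: cst_continuous.
apply: continuousB; last exact: cvg_fst.
apply: dot_continuous; last exact: cst_continuous.
by move=> y; exact: cvg_snd.
Qed.

Lemma prof_continuous : continuous (fun p : R * 'rV[R]_N => U p.1 p.2).
Proof. by apply: reparam_continuous; case: (w_sol W). Qed.

Lemma proft_continuous : continuous (fun p : R * 'rV[R]_N => Ut p.1 p.2).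
Proof. by apply: reparam_continuous; case: (w_sol W). Qed.

(** [w_lim] is only local in [x], but pulsation moves [x] into a fixed ball; there [x . n] is
    bounded, and large [z] means very negative time. *)
Lemma prof_lim e : 0 < e -> exists2 Z, 0 < Z & forall z x,
  (Z <= z -> U z x <= e) /\ (z <= - Z -> 1 - e <= U z x).
Proof.
move=> e0; have [B B0 hB] := lattice_reduce.
have [T hT] := w_lim W B e0.
exists (B + c * `|T| + 1) => [|z x].
  by rewrite ltr_pwDr // addr_ge0 // mulr_ge0 // ltW.
have [k hk xk] := hB x; rewrite -(prof_per _ _ hk).
set y := x + k in xk *; have := cauchy_schwarz y n.
have -> : nrm n = 1 by rewrite /nrm (w_n1 W) sqrtr1.
rewrite mulr1 => /le_trans/(_ xk); rewrite ler_norml => /andP[y1 y2].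
have [h1 h2] := hT ((dot y n - z) / c) y xk.
have Ta := ler_norm T.
have cT : c * T <= c * `|T| by rewrite ler_wpM2l // ltW.
split=> hz; [apply: h1; rewrite ler_pdivrMr //|apply: h2; rewrite ler_pdivlMr //]; lra.
Qed.

(** Compactness handles a box in [z] times one period in [x]. If one of two points at distance at
    most 1 leaves the box, both lie beyond [Z] on the same side, where the profile is within [e] of
    its limit. *)
Lemma prof_unif e : 0 < e -> exists2 d, 0 < d & forall z z' x, `|z - z'| <= d ->
  `|U z x - U z' x| <= e.
Proof.
move=> e0; have [Z Z0 hZ] := prof_lim e0; have [B B0 hB] := lattice_reduce.
pose K : set (R * R * 'rV[R]_N) :=
  ([set z | - (Z + 1) <= z <= Z + 1] `*` [set z | - (Z + 1) <= z <= Z + 1]) `*` ball_nrm B.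
have cK : compact K.
  by apply: compact_setX; [apply: compact_setX; exact: itv_compact|exact: ball_nrm_compact].
have [f1 f2 f3] := @continuous_prod3 R R 'rV[R]_N.
have cU (g : R * R * 'rV[R]_N -> R) : continuous g -> continuous (fun p => U (g p) p.2).
  by move=> cg; apply: continuous_curry; first exact: prof_continuous.
pose K' := K `&` [set p | e <= `|U p.1.1 p.2 - U p.1.2 p.2|].
have cK' : compact K'.
  apply: compact_closedI => //; apply: closed_le; first exact: cst_continuous.
  by apply: dist_continuous; exact: cU.
have box z z' x : K (z, z', x) = [/\ - (Z + 1) <= z <= Z + 1, - (Z + 1) <= z' <= Z + 1 & nrm x <= B] :> Prop.
  by apply/propext; split=> [[[]]|[]].
have fin d : 0 < d -> d <= 1 -> (forall p, K' p -> d < `|p.1.1 - p.1.2|) ->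
    forall z z' x, `|z - z'| <= d -> `|U z x - U z' x| <= e.
  move=> d0 d1 hd z z' x zz'; rewrite leNgt; apply/negP => H.
  have [k hk xk] := hB x.
  have : K' (z, z', x + k) -> False by move=> /hd /=; lra.
  apply; split; last by rewrite /= !prof_per // ltW.
  rewrite box; have [a1 a2] := hZ z x; have [a3 a4] := hZ z' x.
  have /andP[p1 p2] := prof_01 z x; have /andP[p3 p4] := prof_01 z' x.
  move: zz' H; rewrite ler_norml ltr_normr => /andP[q1 q2] /orP H.
  have {}H : e < U z x - U z' x \/ e < U z' x - U z x by case: H => H; [left|right]; lra.
  have [zl|zl] := leP (Z + 1) z; first by have := a1 ltac:(lra); have := a3 ltac:(lra); lra.
  have [zr|zr] := leP z (- (Z + 1)); first by have := a2 ltac:(lra); have := a4 ltac:(lra); lra.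
  have [zl'|zl'] := leP (Z + 1) z'; first by have := a1 ltac:(lra); have := a3 ltac:(lra); lra.
  have [zr'|zr'] := leP z' (- (Z + 1)); first by have := a2 ltac:(lra); have := a4 ltac:(lra); lra.
  by split=> //; lra.
have [K'0|/nonemptyPn K'0] := pselect (K' !=set0); last first.
  by exists 1 => //; apply: fin => // p; rewrite K'0.
(* [K'] collects the violations; their least separation in [z] is positive, and half of it is an
   admissible [d]. *)
have [[[z1 z2] x] K'p hp] := min_on K'0 cK' (dist_continuous f1 f2).
pose m := `|z1 - z2|.
have m0 : 0 < m.
  rewrite normr_gt0; apply/eqP => /eqP; rewrite subr_eq0 => /eqP z12.
  by case: K'p => _ /=; rewrite z12 subrr normr0; lra.
have mm : Num.min 1 (m / 2) <= m / 2 by rewrite ge_min lexx orbT.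
exists (Num.min 1 (m / 2)); first by rewrite lt_min ltr01 divr_gt0.
apply: fin => [||p /hp /=]; first by rewrite lt_min ltr01 divr_gt0.
  by rewrite ge_min lexx.
by rewrite -/m; lra.
Qed.

End OneWave.

Lemma wave_shift n c u ut s : wave n c u ut ->
  wave n c (fun t x => u (t + s) x) (fun t x => ut (t + s) x).
Proof.
move=> [n1 c0 [uc utc h1 h2] pul u01 lim]; split=> //.
- have C (g : R -> 'rV[R]_N -> R) : continuous (fun p : R * 'rV[R]_N => g p.1 p.2) ->
      continuous (fun p : R * 'rV[R]_N => g (p.1 + s) p.2).
    move=> cg p; apply: (@continuous_comp _ _ _
      (fun p : R * 'rV[R]_N => (p.1 + s, p.2)) (fun p => g p.1 p.2)); last exact: cg.
    apply: continuous_pair; last exact: cvg_snd.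
    by apply: continuousD; [exact: cvg_fst|exact: cst_continuous].
  split; [exact: C|exact: C|move=> t x|by []].
  by apply: T1_ext (h1 (t + s) x) => r; rewrite addrAC.
- by move=> k t x hk; rewrite (pul k (t + s)) // addrAC.
- move=> B e e0; have [T hT] := lim B e e0; exists (T + `|s|) => t x xB.
  have := hT (t + s) x xB; have := ler_norm s; have := ler_norm (- s); rewrite normrN => s1 s2 [h3 h4].
  by split=> h; [apply: h3|apply: h4]; lra.
Qed.

Lemma prof_shift n c u s z x : 0 < c ->
  prof n c (fun t x => u (t + s) x) z x = prof n c u (z - c * s) x.
Proof. by move=> c0; rewrite /prof; congr u; field; rewrite gt_eqF. Qed.

End Waves.

(** * Uniform Lipschitz bound in space *)

Section Lipschitz.
Context {R : realType} {N : nat}.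
Implicit Types (x y e xi : 'rV[R]_N).

(* The coupling matrix is [s (a' (+) a') + s lam (ee^T, ee^T) + ...] with
   [a' = ax - lam ee^T]: it moves both points together except along [e]. *)
Lemma coupling_trace (ax ay X Y : 'M[R]_N) e (lam Ka Ct r psi' B : R) :
  psd ax -> psd ay -> 0 < lam -> 0 <= Ka -> 0 <= r -> Ka * r <= lam / 2 ->
  (forall xi, lam * dot xi xi <= qf ax xi) -> \tr ax <= Ct ->
  (forall xi, `|qf ay xi - qf ax xi| <= Ka * r * dot xi xi) ->
  dot e e = 1 -> 0 <= psi' -> 0 <= B ->
  (forall xi, qf X xi <= qf Y xi) ->
  (forall xi, r * qf X xi <= psi' * dot xi xi) ->
  (forall xi, - (psi' * dot xi xi) <= r * qf Y xi) ->
  qf X e <= - (2 * B) -> 2 * B <= qf Y e -> 0 < r ->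
  mtr ax X - mtr ay Y <= - (2 * lam * B) + psi' * (2 * (Ka / lam) * Ct + N%:R * Ka).
Proof.
move=> pax pay l0 Ka0 r0 Kr ell trx lip e1 psi0 B0 XY hX hY Xe Ye rp.
(* By ellipticity [Ka r 1 <= K r ax] as forms, so [ay - s ax] is positive semidefinite: the fraction
   [s] of [ax] is shared by both points, and only the remainder [P], whose trace is of order [r], is
   left uncoupled. *)
pose K := Ka / lam; pose s := 1 - K * r.
have K0 : 0 <= K by rewrite divr_ge0 // ltW.
have Ks : K * r <= 1 / 2 by rewrite /K mulrAC ler_pdivrMr //; lra.
have s2 : 1 / 2 <= s by rewrite /s; lra.
pose a' := ax - lam *: (e^T *m e).
have pa' : psd a'.
  split=> [i j|xi]; first by rewrite !mxE (proj1 pax i j) !big_ord1 !mxE (mulrC (e 0 i)).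
  rewrite qfDm qfNm qfZm qf_outer subr_ge0; apply: le_trans (ell xi).
  by rewrite ler_wpM2l ?(ltW l0) //; have := dot_sqr_le e xi; rewrite e1 mul1r.
pose P := ay - s *: ax.
have qP xi : qf P xi = (qf ay xi - qf ax xi) + K * r * qf ax xi.
  by rewrite qfDm qfNm qfZm /s; ring.
have Klam : K * lam = Ka by rewrite /K divfK // gt_eqF.
have pP : psd P.
  split=> [i j|xi]; first by rewrite !mxE (proj1 pax i j) (proj1 pay i j).
  rewrite qP; have := lip xi; rewrite ler_norml => /andP[h _].
  have : K * r * (lam * dot xi xi) <= K * r * qf ax xi.
    by rewrite ler_wpM2l // mulr_ge0.
  by rewrite (_ : K * r * (lam * dot xi xi) = Ka * r * dot xi xi); [lra|rewrite -Klam; ring].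
(* The large negative contribution is [s lam (qf X e - qf Y e)], fed by the concavity [B]. In the
   other terms a factor [r] cancels the [1 / r] in the bounds on [X] and [Y]. *)
have split_tr : mtr ax X - mtr ay Y =
    s * (mtr a' (X - Y) + lam * (qf X e - qf Y e)) + K * r * mtr ax X - mtr P Y.
  rewrite /P /a' !(mtrDl, mtrNl, mtrZl, mtrDr, mtrNr) !(mtrC (e^T *m e)) !mtr_outer /s; ring.
have h1 : mtr a' (X - Y) <= 0.
  by apply: psd_mtr_le0 => // xi; rewrite qfDm qfNm subr_le0.
have tr0 (M : 'M[R]_N) : psd M -> 0 <= \tr M.
  move=> pM; rewrite -mtr1; apply: psd_mtr_ge0 => // xi; rewrite qf1; exact: dot_ge0.
have h2 : r * mtr ax X <= psi' * \tr ax.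
  rewrite -mtrZr -mtr1 -mtrZr; apply: psd_mtr_mono => // xi.
  by rewrite !qfZm qf1.
have h3 : - (psi' * \tr P) <= r * mtr P Y.
  rewrite -mtrZr -mtr1 -mtrZr -mtrNr; apply: psd_mtr_mono => // xi.
  by rewrite qfNm !qfZm qf1.
have trP : \tr P <= N%:R * (Ka * r) + K * r * \tr ax.
  have trE (M : 'M[R]_N) : \tr M = \sum_i qf M (basis_vec i).
    by apply: eq_bigr => i _; rewrite /qf bf_basis2.
  rewrite (trE P) (trE ax) mulr_sumr.
  have -> : N%:R * (Ka * r) = \sum_(i < N) Ka * r.
    by rewrite sumr_const card_ord mulr_natl.
  rewrite -big_split; apply: ler_sum => i _ /=; rewrite qP lerD2r.
  have := lip (basis_vec i); rewrite dot_basis !mxE !eqxx mulr1.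
  exact/le_trans/ler_norm.
have Ct0 : 0 <= \tr ax by exact: tr0.
have KC : K * \tr ax <= K * Ct by rewrite ler_wpM2l.
have h4 : K * (r * mtr ax X) <= K * (psi' * \tr ax) by rewrite ler_wpM2l.
have h5 : psi' * (K * \tr ax) <= psi' * (K * Ct) by rewrite ler_wpM2l.
have h6 : - mtr P Y <= psi' * (N%:R * Ka + K * \tr ax).
  rewrite -(ler_pM2l rp); have : psi' * \tr P <= psi' * (N%:R * (Ka * r) + K * r * \tr ax) by rewrite ler_wpM2l.
  by move: h3; lra.
have h7 : s * (lam * (qf X e - qf Y e)) <= - (2 * lam * B).
  have q1 : lam * (qf X e - qf Y e) <= lam * (- (4 * B)) by rewrite ler_wpM2l ?(ltW l0) //; lra.
  have q2 : 0 <= lam * (4 * B) by rewrite !mulr_ge0 // ltW.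
  have q3 : s * (lam * (qf X e - qf Y e)) <= s * (lam * (- (4 * B))) by rewrite ler_wpM2l //; lra.
  have q4 : 1 / 2 * (lam * (4 * B)) <= s * (lam * (4 * B)) by rewrite ler_wpM2r.
  by move: q3 q4; rewrite !(mulrN s, mulrN lam); lra.
have h8 : s * mtr a' (X - Y) <= 0 by rewrite pmulr_rle0 //; lra.
rewrite split_tr -/K mulrDr.
move: h4 h5 h6 h7 h8; lra.
Qed.

Lemma sqrt_tangent (r q : R) : 0 < r -> 0 <= r ^+ 2 + q ->
  Num.sqrt (r ^+ 2 + q) <= r + q / (2 * r).
Proof.
move=> r0 q0; have e : (r + q / (2 * r)) ^+ 2 = r ^+ 2 + q + (q / (2 * r)) ^+ 2.
  by field; rewrite gt_eqF.
have pos : 0 <= r + q / (2 * r).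
  have -> : r + q / (2 * r) = (r ^+ 2 + q + r ^+ 2) / (2 * r) by field; rewrite gt_eqF.
  by rewrite divr_ge0 // ?mulr_ge0 ?(ltW r0) // addr_ge0 // sqr_ge0.
rewrite -ler_sqr ?nnegrE ?sqrtr_ge0 // sqr_sqrtr // e lerDl sqr_ge0.
exact: isT.
Qed.

(** Concavity of the square root gives a quadratic that touches the norm from above at [s = 0],
    which is all that a maximum test needs. *)
Lemma nrm_tangent h xi (s : R) : 0 < nrm h ->
  nrm (h + s *: xi) <= nrm h + (dot h xi / nrm h) * s + (dot xi xi / nrm h) / 2 * s ^+ 2.
Proof.
move=> h0; rewrite {1}/nrm.
have -> : dot (h + s *: xi) (h + s *: xi) = nrm h ^+ 2 + (2 * s * dot h xi + s ^+ 2 * dot xi xi).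
  by rewrite nrm_sqr !(dotDl, dotDr, dotZl, dotZr) (dotC xi h); ring.
apply: le_trans (sqrt_tangent h0 _) _.
  have := dot_ge0 (h + s *: xi).
  by rewrite nrm_sqr !(dotDl, dotDr, dotZl, dotZr) (dotC xi h); lra.
by rewrite le_eqVlt; apply/orP; left; apply/eqP; field; rewrite gt_eqF.
Qed.

Variable S : setting R N.

Lemma a_psd x : psd (a S x).
Proof.
split=> [i j|xi]; first exact: a_sym.
by apply: le_trans (a_ell S x xi); rewrite mulr_ge0 ?dot_ge0 // ltW ?lam_gt0.
Qed.

Lemma tr_ge0 x : 0 <= \tr (a S x).
Proof.
rewrite -mtr1; apply: psd_mtr_ge0 => [|xi]; first exact: a_psd.
by rewrite qf1 dot_ge0.
Qed.

Lemma f_bnd x v : 0 <= v <= 1 -> `|f S x v| <= Kf S.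
Proof.
move=> v01; have /andP[th0 th1] := theta_itv S.
have z01 : 0 <= (0 : R) <= 1 by rewrite lexx ler01.
have := f_lip S x v01 z01; rewrite (@f_0 _ _ S x 0) ?lexx ?(ltW th0) // !subr0 => /le_trans; apply.
case/andP: v01 => v0 v1; rewrite ger0_norm // -[leRHS]mulr1 ler_wpM2l //.
exact: Kf_ge0.
Qed.

Section Doubling.
Variables (n : 'rV[R]_N) (c : R) (u ut : R -> 'rV[R]_N -> R).
Hypothesis W : wave S n c u ut.
Variables (M B r0 : R).
Hypotheses (r00 : 0 < r0) (M0 : 0 < M) (B0 : 0 < B) (MB : 2 * B * r0 <= M)
  (psir0 : 1 <= M * r0 - B * r0 ^+ 2).
(** A concave modulus: [- B r^2] supplies the negative second derivative that pays for reaction,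
    drift and variation of [a]. [MB] keeps it nondecreasing on [[0, r0]], and [psir0] makes it
    exceed the oscillation of [u] at [r0], so that a positive maximum of [Phi] is interior. *)
Let psi (r : R) := M * r - B * r ^+ 2.
Let Phi (t : R) x h := u t x - u t (x - h) - psi (nrm h).

Lemma doubling_max t1 x1 h1 : nrm h1 <= r0 -> 0 < Phi t1 x1 h1 ->
  exists t x h, [/\ nrm h <= r0, 0 < Phi t x h &
    forall t' x' h', nrm h' <= r0 -> Phi t' x' h' <= Phi t x h].
Proof.
have hr00 := r00; have hMB := MB; have hM0 := M0; have hB0 := B0.
move=> h1r P1; have [Bc Bc0 hBc] := lattice_reduce S.
(* The given positive value of [Phi] is the tolerance in the limits: times beyond [T] cannot beat
   it, so the maximum is attained. *)
have [T hT] := w_lim W (Bc + r0) P1.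
have red t x h : exists t' x', nrm x' <= Bc /\ Phi t x h = Phi t' x' h.
  have [k hk xk] := hBc x; exists (t + dot k n / c), (x + k); split=> //.
  by rewrite /Phi (w_pul W t x hk) (w_pul W t (x - h) hk) (addrAC x (- h)) -addrA.
pose K : set (R * 'rV[R]_N * 'rV[R]_N) :=
  ([set t | - (`|T| + 1) <= t <= `|T| + 1] `*` ball_nrm Bc) `*` ball_nrm r0.
have cK : compact K.
  by apply: compact_setX; [apply: compact_setX; [exact: itv_compact|]|]; exact: ball_nrm_compact.
have T0 := normr_ge0 T.
have [t1' [x1' [x1B e1]]] := red t1 x1 h1.
have far t x h : nrm x <= Bc -> nrm h <= r0 -> `|T| + 1 < `|t| -> Phi t x h <= Phi t1 x1 h1.
  move=> xB hr tT.
  have psi0 : 0 <= psi (nrm h).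
    have := nrm_ge0 h; rewrite /psi expr2 mulrA -mulrBl => nh0.
    have q1 : B * nrm h <= B * r0 by rewrite ler_wpM2l ?(ltW B0).
    have q2 : 0 < B * r0 by rewrite mulr_gt0.
    rewrite mulr_ge0 // subr_ge0; lra.
  have xh : nrm (x - h) <= Bc + r0 by apply: (le_trans (nrmD _ _)); rewrite nrmN lerD.
  have xB' : nrm x <= Bc + r0 by lra.
  have [a1 a2] := hT t x xB'; have [a3 a4] := hT t (x - h) xh.
  have /andP[p1 p2] := w_01 W t x; have /andP[p3 p4] := w_01 W t (x - h).
  have Ta := ler_norm T.
  rewrite {1}/Phi; have [t0|t0] := leP 0 t.
    by have := a4 ltac:(move: tT; rewrite (ger0_norm t0); lra); lra.
  by have := a1 ltac:(move: tT; rewrite (ltr0_norm t0); lra); lra.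
have t1T : `|t1'| <= `|T| + 1 \/ Phi t1' x1' h1 <= Phi t1 x1 h1 by right; rewrite e1.
have cPhi : continuous (fun p : R * 'rV[R]_N * 'rV[R]_N => Phi p.1.1 p.1.2 p.2).
  have [uc _ _ _] := w_sol W.
  have [c1 c2 c3] := @continuous_prod3 R 'rV[R]_N 'rV[R]_N.
  have cn : continuous (fun p : R * 'rV[R]_N * 'rV[R]_N => nrm p.2).
    by apply: continuous_compf c3; exact: nrm_continuous.
  apply: continuous_subf; last first.
    apply: continuous_subf; apply: continuous_mulf; try exact: continuous_cstf; first exact: cn.
    exact: (continuous_compf (@exprn_continuous _ 2) cn).
  apply: continuous_subf; first exact: continuous_curry.
  by apply: continuous_curry => //; exact: continuous_subv.
have K0 : K (0, 0, 0) by split=> /=; rewrite /ball_nrm /= ?nrm0; [split=> //=; rewrite ?nrm0 //; lra|exact: ltW].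
have [[[t x] h] [[/= tT xB] hr] mx] := max_on (ex_intro _ _ K0) cK cPhi.
have {}mx t' x' h' : nrm h' <= r0 -> Phi t' x' h' <= Num.max (Phi t x h) (Phi t1 x1 h1).
  move=> h'r; have [t2 [x2 [x2B ->]]] := red t' x' h'; rewrite le_max.
  have [tl|tl] := leP `|t2| (`|T| + 1); last by rewrite far ?orbT.
  by apply/orP; left; apply: (mx (t2, x2, h')); split=> //; split=> //=; rewrite -ler_norml.
have [le|lt] := leP (Phi t1 x1 h1) (Phi t x h).
  exists t, x, h; split=> // [|t' x' h' /mx]; first exact: lt_le_trans P1 le.
  by rewrite max_l.
by exists t1, x1, h1; split=> // t' x' h' /mx; rewrite max_r // ltW.
Qed.

Lemma doubling_bound : M * (2 * (Ka S / lam S) * Ct S + N%:R * Ka S + 2 * Cb S) + 2 * Kf S < 2 * lam S * B ->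
  Ka S * r0 <= lam S / 2 ->
  forall t x h, nrm h <= r0 -> Phi t x h <= 0.
Proof.
have hr00 := r00; have hMB := MB; have hM0 := M0; have hB0 := B0; have hp := psir0.
move=> hB hK t1 x1 h1 h1r; rewrite leNgt; apply/negP => P1.
have [t [x [h [hr P0 mx]]]] := doubling_max h1r P1.
have [_ _ hT hS] := w_sol W.
set r := nrm h in hr; have r_ge0 : 0 <= r by exact: nrm_ge0.
have r0' : 0 < r.
  rewrite nrm_gt0 //; apply/eqP => h0; move: P0.
  by rewrite /Phi h0 subr0 nrm0 /psi mulr0 expr0n mulr0 !subrr ltxx.
have /andP[u1 u2] := w_01 W t x; have /andP[u3 u4] := w_01 W t (x - h).
have rr0 : r < r0.
  rewrite lt_neqAle hr andbT; apply/eqP => rE; move: P0; rewrite /Phi -/r rE /psi; lra.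
pose y := x - h; pose psi' := M - 2 * B * r.
have psi'0 : 0 <= psi' by rewrite subr_ge0; apply: le_trans MB; rewrite ler_wpM2l ?mulr_ge0 // ltW.
have psi'M : psi' <= M by rewrite gerBl !mulr_ge0 // ltW.
pose e := r^-1 *: h.
have e1 : dot e e = 1 by rewrite dotZl dotZr -nrm_sqr -/r; field; rewrite gt_eqF.
have psile r' q : r' <= r + q -> 0 <= r' -> psi r' - psi r <= psi' * q.
  move=> rq r'0; rewrite /psi /psi'.
  have : (M - 2 * B * r) * (r' - r) <= (M - 2 * B * r) * q by rewrite ler_wpM2l //; lra.
  have : 0 <= B * (r' - r) ^+ 2 by rewrite mulr_ge0 ?sqr_ge0 // ltW.
  by lra.
have [p [X [TX eX]]] := hS t x; have [p' [Y [TY eY]]] := hS t y.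
have small xi : exists2 d, 0 < d & forall s, `|s| < d -> nrm (h + s *: xi) <= r0.
  have np : 0 < nrm xi + 1 by rewrite ltr_wpDl ?nrm_ge0.
  exists ((r0 - r) / (nrm xi + 1)) => [|s]; first by rewrite divr_gt0 ?subr_gt0.
  rewrite ltr_pdivlMr // => sd.
  apply: (le_trans (nrmD _ _)); rewrite nrmZ -/r; have := normr_ge0 s; lra.
have yh v : x + v - (h + v) = y by rewrite opprD addrACA subrr addr0.
have yh' v : x - (h - v) = y + v by rewrite opprB addrCA addrC.
(* With [y = x - h], changing [x] alone moves both points, changing [x] and [h] by the same amount
   moves only [x], and changing [h] alone moves only [y]. *)
have joint w : dot p w = dot p' w /\ qf X w <= qf Y w.
  apply: (T2_touch (TX w) (TY w) ltr01) => s _; rewrite !scale0r !addr0.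
  have := mx t (x + s *: w) h hr; rewrite /Phi (addrAC x (s *: w)) -/y; lra.
have hx xi : dot p xi = psi' * (dot h xi / r) /\ qf X xi <= psi' * (dot xi xi / r).
  have [d d0 hd] := small xi.
  apply: (T2_touch (TX xi) (T2_quad 0 (psi' * (dot h xi / r)) (psi' * (dot xi xi / r))) d0) => s sd.
  rewrite scale0r addr0; have := mx t (x + s *: xi) (h + s *: xi) (hd s sd).
  have := psile (nrm (h + s *: xi)) (dot h xi / r * s + dot xi xi / r / 2 * s ^+ 2).
  rewrite addrA => /(_ (nrm_tangent xi s r0') (nrm_ge0 _)).
  by rewrite /Phi yh -/r -/y; lra.
have hy xi : - dot p' xi = - (psi' * (dot h xi / r)) /\ - qf Y xi <= psi' * (dot xi xi / r).
  have [d d0 hd] := small (- xi).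
  have TYn := T2N (TY xi).
  have := T2_touch TYn (T2_quad 0 (- (psi' * (dot h xi / r))) (psi' * (dot xi xi / r))) d0.
  apply=> s sd; rewrite scale0r addr0; have := mx t x (h + s *: (- xi)) (hd s sd).
  have := psile (nrm (h + s *: (- xi))) (dot h (- xi) / r * s + dot (- xi) (- xi) / r / 2 * s ^+ 2).
  rewrite addrA => /(_ (nrm_tangent (- xi) s r0') (nrm_ge0 _)).
  rewrite /Phi scalerN yh' -/r -/y !(dotNl, dotNr) !opprK; lra.
(* Along [e] the norm is affine, so the penalty is exactly [psi (r + s)] and each point separately
   feels the second derivative [- 2 B]. *)
have scal s : `|s| < r -> nrm (h + s *: e) = r + s.
  rewrite ltr_norml => /andP[s1 s2].
  have -> : h + s *: e = ((r + s) / r) *: h.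
    by rewrite scalerA -{1}(scale1r h) -scalerDl; congr (_ *: _); field; rewrite gt_eqF.
  rewrite nrmZ -/r ger0_norm; first by field; rewrite gt_eqF.
  by rewrite divr_ge0 //; lra.
have d0 : 0 < Num.min r (r0 - r) by rewrite lt_min r0' subr_gt0.
have Xe : qf X e <= - (2 * B).
  apply: (proj2 (T2_touch (TX e) (T2_quad 0 psi' (- (2 * B))) d0 _)) => s; rewrite lt_min => /andP[sr sr0]; rewrite scale0r addr0.
  have := mx t (x + s *: e) (h + s *: e); rewrite scal // => /(_ _).
  have -> : r + s <= r0 by move: sr0; rewrite ltr_norml; lra.
  move=> /(_ isT); rewrite /Phi yh scal // -/r -/y /psi /psi'; lra.
have Ye : - qf Y e <= - (2 * B).
  apply: (proj2 (T2_touch (T2N (TY e)) (T2_quad 0 (- psi') (- (2 * B))) d0 _)) => s; rewrite lt_min => /andP[sr sr0]; rewrite scale0r addr0.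
  have sr' : `|- s| < r by rewrite normrN.
  have := mx t x (h + (- s) *: e); rewrite scal // => /(_ _).
  have -> : r - s <= r0 by move: sr0; rewrite ltr_norml; lra.
  move=> /(_ isT); rewrite /Phi scal // scaleNr yh' -/r -/y /psi /psi'; lra.
have eqt : ut t x = ut t y.
  apply/eqP; rewrite -subr_eq0; apply/eqP.
  apply: (T1_touch (q := 0) (C := 0) (T1B (hT t x) (hT t y)) ltr01) => s _.
  by have := mx (t + s) x h hr; rewrite /Phi -/y addr0; lra.
have pp : p = p'.
  by apply/rowP => i; have [+ _] := joint (basis_vec i); rewrite !(dotC _ (basis_vec i)) !dot_basis.
have := @coupling_trace (a S x) (a S y) X Y e (lam S) (Ka S) (Ct S) r psi' B.
have Kr : Ka S * r <= lam S / 2.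
  by apply: le_trans hK; rewrite ler_wpM2l ?Ka_ge0.
have lip xi : `|qf (a S y) xi - qf (a S x) xi| <= Ka S * r * dot xi xi.
  by have := a_lip S y x xi; rewrite (_ : y - x = - h) ?nrmN // /y addrC addKr.
move=> /(_ (a_psd _) (a_psd _) (lam_gt0 S) (Ka_ge0 S) r_ge0 Kr (a_ell S x) (a_tr S x) lip e1 psi'0 (ltW B0)).
move=> /(_ (fun xi => (joint xi).2)).
have cX xi : r * qf X xi <= psi' * dot xi xi.
  by have [_] := hx xi; rewrite mulrA ler_pdivlMr // mulrC.
have cY xi : - (psi' * dot xi xi) <= r * qf Y xi.
  by have [_] := hy xi; rewrite mulrA ler_pdivlMr // mulrC; lra.
move=> /(_ cX cY Xe); rewrite -lerN2 Ye => /(_ isT r0').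
have pe : nrm p <= M.
  have -> : p = (psi' / r) *: h.
    apply/rowP => i; have [+ _] := hx (basis_vec i).
    by rewrite !(dotC _ (basis_vec i)) !dot_basis mxE => ->; field; rewrite gt_eqF.
  rewrite nrmZ -/r ger0_norm ?divr_ge0 // divfK // gt_eqF //.
have bxy : dot (b S x) p - dot (b S y) p <= 2 * Cb S * M.
  rewrite -dotNl -dotDl; apply: (le_trans (dot_le_nrm _ _)).
  apply: ler_pM => //; try exact: nrm_ge0.
  by apply: (le_trans (nrmD _ _)); rewrite nrmN; have := b_bnd S x; have := b_bnd S y; lra.
have := f_bnd x (v := u t x); rewrite (ltW u1) (ltW u2) => /(_ isT); rewrite ler_norml => /andP[_ f1].
have := f_bnd y (v := u t y); rewrite (ltW u3) (ltW u4) => /(_ isT); rewrite ler_norml => /andP[f2 _].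
have psiQ : psi' * (2 * (Ka S / lam S) * Ct S + N%:R * Ka S) <= M * (2 * (Ka S / lam S) * Ct S + N%:R * Ka S).
  rewrite ler_wpM2r // addr_ge0 // ?mulr_ge0 ?Ka_ge0 // ?invr_ge0 ?(ltW (lam_gt0 S)) //.
  exact: le_trans (tr_ge0 x) (a_tr S x).
move: eX eY; rewrite -pp eqt => -> eX; move: hB f1 f2 bxy psiQ eX; lra.
Qed.
End Doubling.

Lemma wave_lipschitz : exists2 Lam, 0 < Lam & forall n c u ut, wave S n c u ut ->
  forall t x y, `|u t x - u t y| <= Lam * nrm (x - y).
Proof.
have l0 := lam_gt0 S; have Ka0 := Ka_ge0 S; have Kf0 := Kf_ge0 S; have Cb0 := Cb_ge0 S.
pose Q := 2 * (Ka S / lam S) * Ct S + N%:R * Ka S + 2 * Cb S.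
have Ct0 : 0 <= Ct S by exact: le_trans (tr_ge0 0) (a_tr S 0).
have Q0 : 0 <= Q.
  by rewrite !addr_ge0 // ?mulr_ge0 ?Ka_ge0 // ?invr_ge0 ?(ltW l0).
pose D := lam S + 2 * Ka S + 2 * Q.
have D0 : 0 < D by rewrite /D; lra.
(* [r0] makes [Ka r0] and [Q r0] at most [lam / 2]; [B] solves the inequality of [doubling_bound]
   with margin 1; the two terms of [M] give [M r0 >= 2] and [2 B r0 <= M], hence [psi r0 >= 1]. *)
pose r0 := lam S / D.
have r00 : 0 < r0 by rewrite divr_gt0.
pose M := 2 / r0 + 2 * (2 * Kf S + 1) / lam S.
have M1 : 0 < 2 / r0 by rewrite divr_gt0.
have M2 : 0 < (2 * Kf S + 1) / lam S by rewrite divr_gt0 //; lra.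
have M0 : 0 < M by rewrite /M -mulrA; lra.
pose B := (M * Q + 2 * Kf S + 1) / (2 * lam S).
have MQ : 0 <= M * Q by rewrite mulr_ge0 // ltW.
have B0 : 0 < B by rewrite divr_gt0 ?mulr_gt0 //; lra.
have lB : 2 * lam S * B = M * Q + 2 * Kf S + 1 by rewrite /B mulrC divfK // mulf_neq0 // gt_eqF.
have rD : r0 * D = lam S by rewrite /r0 divfK // gt_eqF.
have r01 : r0 <= 1 by rewrite ler_pdivrMr // mul1r /D; lra.
have hK : Ka S * r0 <= lam S / 2.
  have : 0 <= r0 * Q by rewrite mulr_ge0 // ltW.
  have : 0 <= r0 * lam S by rewrite mulr_ge0 // ltW.
  by move: rD; rewrite /D; lra.
have rQ : r0 * Q <= lam S / 2.
  have : 0 <= r0 * Ka S by rewrite mulr_ge0 // ltW.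
  have : 0 <= r0 * lam S by rewrite mulr_ge0 // ltW.
  by move: rD; rewrite /D; lra.
have MB : 2 * B * r0 <= M.
  rewrite -(ler_pM2l l0).
  have -> : lam S * (2 * B * r0) = (2 * lam S * B) * r0 by ring.
  rewrite lB.
  have h1 : M * (r0 * Q) <= M * (lam S / 2) by rewrite ler_wpM2l // ltW.
  have h2 : (2 * Kf S + 1) * r0 <= 2 * Kf S + 1 by rewrite -[leRHS]mulr1 ler_wpM2l //; lra.
  have h3 : 2 * (2 * Kf S + 1) <= lam S * M.
    have -> : lam S * M = lam S * (2 / r0) + 2 * (2 * Kf S + 1).
      by rewrite /M; field; rewrite !gt_eqF.
    by rewrite lerDr mulr_ge0 // ltW.
  by move: h1 h2 h3; lra.
have Mr0 : 2 <= M * r0.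
  rewrite -ler_pdivrMr // /M lerDl -mulrA; lra.
have psir0 : 1 <= M * r0 - B * r0 ^+ 2.
  have : 2 * B * r0 * r0 <= M * r0 by rewrite ler_wpM2r // ltW.
  by rewrite expr2; lra.
exists M => // n c u ut W t.
suff H x y : u t x - u t y <= M * nrm (x - y).
  by move=> x y; rewrite ler_norml H andbT lerNl opprB -nrmN opprB H.
have nn := nrm_ge0 (x - y).
have [far|near] := leP (nrm (x - y)) r0; last first.
  have /andP[u1 u2] := w_01 W t x; have /andP[u3 u4] := w_01 W t y.
  have : M * r0 <= M * nrm (x - y) by rewrite ler_wpM2l // ltW.
  by lra.
have := @doubling_bound n c u ut W M B r0 r00 M0 B0 MB psir0 _ hK t x (x - y) far.
have exy : x - (x - y) = y by rewrite opprB addrC subrK.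
rewrite exy; have h : M * Q + 2 * Kf S < 2 * lam S * B by lra.
move=> /(_ h); have : 0 <= B * nrm (x - y) ^+ 2 by rewrite mulr_ge0 ?sqr_ge0 // ltW.
by lra.
Qed.

End Lipschitz.

(** * Propagation of positivity *)

Section Barrier.
Context {R : realType} {N : nat} (S : setting R N).
Implicit Types (x y w : 'rV[R]_N).

Lemma T2_quartic (c0 c1 c2 c3 c4 : R) :
  T2 (fun s => c0 + c1 * s + c2 * s ^+ 2 + c3 * s ^+ 3 + c4 * s ^+ 4) c1 (2 * c2).
Proof.
move=> e e0; have p0 : 0 < `|c3| + `|c4| + 1 by rewrite ltr_wpDl // addr_ge0.
exists (Num.min 1 (e / (`|c3| + `|c4| + 1))) => [|s]; rewrite lt_min ?ltr01.
  by rewrite divr_gt0.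
move=> /andP[s1]; rewrite ltr_pdivlMr // => se.
rewrite [X in `|X|](_ : _ = (c3 + c4 * s) * s * s ^+ 2); last by field.
rewrite normrM (normrM _ s) [`|s ^+ 2|]ger0_norm ?sqr_ge0 //.
rewrite ler_wpM2r ?sqr_ge0 //; apply: le_trans (ltW se).
rewrite mulrC ler_wpM2l //; apply: (le_trans (ler_normD _ _)); rewrite normrM.
have : `|c4| * `|s| <= `|c4| by rewrite -[leRHS]mulr1 ler_wpM2l // ltW.
lra.
Qed.

Lemma T2_bump (k S0 al be : R) :
  T2 (fun s => k * (S0 - al * s - be * s ^+ 2) ^+ 2) (- (2 * k * S0 * al))
     (k * (2 * al ^+ 2 - 4 * S0 * be)).
Proof.
have := T2_quartic (k * S0 ^+ 2) (- (2 * k * S0 * al)) (k * (al ^+ 2 - 2 * S0 * be))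
  (k * (2 * al * be)) (k * be ^+ 2).
rewrite (_ : 2 * (k * (al ^+ 2 - 2 * S0 * be)) = k * (2 * al ^+ 2 - 4 * S0 * be)); last ring.
by apply: T2_ext => s; ring.
Qed.

(** For this [q] the right-hand side has minimum [A / 2] in [s]. In the barrier, [s] is
    [1 - |y|^2/rho^2]: near the rim of the ball the diffusion term [A] dominates, inside the decay
    rate [q] does. *)
Lemma quadratic_gap (A C q s : R) : 0 < A -> q = (A + C) ^+ 2 / (2 * A) ->
  A / 2 <= A - (A + C) * s + q * s ^+ 2.
Proof.
move=> A0 ->; rewrite -subr_ge0.
have -> : A - (A + C) * s + (A + C) ^+ 2 / (2 * A) * s ^+ 2 - A / 2 =
   (A - (A + C) * s) ^+ 2 / (2 * A) by field; rewrite gt_eqF.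
by rewrite divr_ge0 ?sqr_ge0 // mulr_ge0 // ltW.
Qed.

(* The barrier is [exp(-Lm (t - t0)) (1 - |x - xi t|^2/rho^2)^2] on a ball whose
   center [xi t] moves from [x0] to [xs]. *)
Lemma positivity_spread (T V rho K : R) : 0 < T -> 0 <= V -> 0 < rho -> 0 <= K ->
  exists2 kap, 0 < kap & forall (D : R -> 'rV[R]_N -> R) t0 ts x0 xs eps,
  continuous (fun p : R * 'rV[R]_N => D p.1 p.2) -> 0 < eps ->
  t0 < ts <= t0 + T -> nrm (xs - x0) <= V * (ts - t0) ->
  (forall t x, t0 <= t <= ts -> nrm (x - x0) <= V * T + rho -> 0 <= D t x) ->
  (forall x, nrm (x - x0) <= rho -> eps <= D t0 x) ->
  (forall t x, t0 < t <= ts -> nrm (x - x0) <= V * T + rho -> D t x < eps ->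
    exists dt p H, [/\ T1 (fun s => D (t + s) x) dt,
      forall xi, T2 (fun s => D t (x + s *: xi)) (dot p xi) (qf H xi) &
      mtr (a S x) H + dot (b S x) p - K * D t x - kap * eps <= dt]) ->
  kap * eps <= D ts xs.
Proof.
move=> T0 V0 rho0 K0; have l0 := lam_gt0 S; have Cb0 := Cb_ge0 S.
have Ct0 : 0 <= Ct S by exact: le_trans (tr_ge0 S 0) (a_tr S 0).
(* [A] is the gain from diffusion at the rim; [C] bounds the loss inside, together with the drift
   and the motion of the center; [Lm] exceeds the absorption rate [K] by the [q] of
   [quadratic_gap]. *)
pose A := 8 * lam S / rho ^+ 2.
have A0 : 0 < A by rewrite divr_gt0 ?mulr_gt0 // exprn_gt0.
pose C := 4 * Ct S / rho ^+ 2 + 4 * Cb S / rho + 4 * V / rho.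
pose q := (A + C) ^+ 2 / (2 * A).
have q0 : 0 <= q by rewrite divr_ge0 ?sqr_ge0 // mulr_ge0 // ltW.
pose Lm := K + q; have Lm0 : 0 <= Lm by rewrite addr_ge0.
(* The exponential is what is left of the barrier at the final time; the factor [A / 4] lets the
   tolerated defect [kap * eps] be absorbed by half of the reserve [A / 2]. *)
pose kap := Num.min 1 (A / 4) * expR (- (Lm * T)).
have kap1 : kap <= expR (- (Lm * T)) by rewrite /kap ger_pMl ?expR_gt0 // ge_min lexx.
have kapA : kap * expR (Lm * T) <= A / 4.
  by rewrite /kap -mulrA -expRD addNr expR0 mulr1 ge_min lexx orbT.
have kap0 : 0 < kap by rewrite mulr_gt0 ?expR_gt0 // lt_min ltr01 divr_gt0.
exists kap => // D t0 ts x0 xs eps cD eps0 /andP[t0s tsT] xsV Dge Dt0 Dsup.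
pose w := (ts - t0)^-1 *: (xs - x0).
have dts : 0 < ts - t0 by lra.
have wV : nrm w <= V by rewrite nrmZ gtr0_norm ?invr_gt0 // mulrC ler_pdivrMr.
pose xi t := x0 + (t - t0) *: w.
have xits : xi ts = xs by rewrite /xi /w scalerA divff ?gt_eqF // scale1r addrC subrK.
have xib t y : t0 <= t <= ts -> nrm y <= rho -> nrm (xi t + y - x0) <= V * T + rho.
  move=> /andP[h1 h2] yr; have -> : xi t + y - x0 = (t - t0) *: w + y.
    by rewrite /xi; apply/rowP => i; rewrite !mxE; ring.
  apply: (le_trans (nrmD _ _)); rewrite lerD // nrmZ ger0_norm ?subr_ge0 //.
  by rewrite mulrC ler_pM ?nrm_ge0 // ?subr_ge0 //; lra.
pose Sf y := 1 - dot y y / rho ^+ 2.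
have rr0 : 0 < rho ^+ 2 by rewrite exprn_gt0.
have yr y : (nrm y <= rho) = (0 <= Sf y).
  rewrite /Sf subr_ge0 ler_pdivrMr // mul1r -nrm_sqr ler_sqr ?nnegrE ?nrm_ge0 //.
  exact: ltW.
have Sf1 y : Sf y <= 1 by rewrite gerBl divr_ge0 ?dot_ge0 // ltW.
pose E t := expR (- (Lm * (t - t0))).
pose G (p : R * 'rV[R]_N) := D p.1 (xi p.1 + p.2) - eps * (E p.1 * Sf p.2 ^+ 2).
have cG : continuous G.
  have c1 : continuous (fun p : R * 'rV[R]_N => p.1) by move=> p; exact: cvg_fst.
  have c2 : continuous (fun p : R * 'rV[R]_N => p.2) by move=> p; exact: cvg_snd.
  have c3 : continuous (fun p : R * 'rV[R]_N => p.1 - t0).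
    by apply: continuous_subf => //; exact: continuous_cstf.
  apply: continuous_subf.
    apply: continuous_curry => //; apply: continuous_addv => //.
    apply: continuous_addv; first by move=> p; exact: cst_continuous.
    by apply: continuous_scalev => // p; exact: cst_continuous.
  apply: continuous_mulf; first exact: continuous_cstf.
  apply: continuous_mulf.
    apply: (continuous_compf (k := expR)); first exact: continuous_expR.
    by apply: continuous_oppf; apply: continuous_mulf => //; exact: continuous_cstf.
  apply: (@continuous_compf R _ _ (fun s : R => s ^+ 2) (fun p : R * 'rV[R]_N => Sf p.2)); first exact: exprn_continuous.
  apply: continuous_subf; first exact: continuous_cstf.
  apply: continuous_mulf; last exact: continuous_cstf.
  exact: dot_continuous.
have K1 : ([set t | t0 <= t <= ts] `*` ball_nrm rho) (ts, 0 : 'rV[R]_N).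
  by split=> /=; rewrite /ball_nrm /= ?nrm0 ?lexx ?andbT ?ltW.
have cK : compact ([set t : R | t0 <= t <= ts] `*` @ball_nrm R N rho).
  by apply: compact_setX; [exact: itv_compact|exact: ball_nrm_compact].
have [[t y] [/= tt yrho] mn] := min_on (ex_intro _ _ K1) cK cG.
have {}mn t' y' : t0 <= t' <= ts -> 0 <= Sf y' -> G (t, y) <= G (t', y').
  by move=> h1 h2; apply: mn; split => //=; rewrite /ball_nrm /= yr.
rewrite /ball_nrm /= yr in yrho.
suff G0 : 0 <= G (t, y).
  have := le_trans G0 (mn ts 0 _ _); rewrite /G /= addr0 xits /Sf dot0l mul0r subr0 expr1n mulr1.
  rewrite lexx ler01 (ltW t0s) => /(_ isT isT); rewrite subr_ge0 => /(le_trans _); apply.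
  rewrite mulrC ler_wpM2l ?(ltW eps0) //; apply: (le_trans kap1).
  by rewrite ler_expR lerN2 ler_wpM2l //; lra.
rewrite leNgt; apply/negP => Gneg.
set s0 := Sf y in yrho; have s01 : s0 <= 1 by exact: Sf1.
have Et0 : 0 < E t by exact: expR_gt0.
have /andP[t0t tts] := tt.
have Et1 : E t <= 1 by rewrite -expR0 ler_expR oppr_le0 mulr_ge0 // subr_ge0.
have D0 : 0 <= D t (xi t + y) by apply: Dge => //; apply: xib => //; rewrite yr.
move: Gneg; rewrite /G /= -/s0 subr_lt0 => Dh.
have s02 : s0 ^+ 2 <= 1 by rewrite expr_le1.
have h1 : E t * s0 ^+ 2 <= 1 by rewrite -[leRHS]mulr1 ler_pM ?sqr_ge0 // ltW.
have De : D t (xi t + y) < eps.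
  by apply: (lt_le_trans Dh); rewrite -[leRHS]mulr1 ler_wpM2l // ltW.
have t0t' : t0 < t.
  rewrite lt_neqAle t0t andbT; apply/eqP => tE; move: De; rewrite -tE /xi subrr scale0r addr0 ltNge.
  by rewrite Dt0 // addrC addKr yr.
have s0p : 0 < s0.
  rewrite lt_neqAle yrho andbT; apply/eqP => sE; move: Dh; rewrite -sE expr0n !mulr0.
  by rewrite ltNge D0.
pose x := xi t + y.
have xb : nrm (x - x0) <= V * T + rho by apply: xib; rewrite ?tt // yr.
have t0tts : t0 < t <= ts by rewrite t0t' tts.
have [dt [p [H [TD TX ineq]]]] := Dsup t x t0tts xb De.
have Sfs v s : Sf (y + s *: v) = s0 - 2 * dot y v / rho ^+ 2 * s - dot v v / rho ^+ 2 * s ^+ 2.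
  rewrite /s0 /Sf !(dotDl, dotDr, dotZl, dotZr) (dotC v y); field.
  by rewrite gt_eqF.
have small v : exists2 d, 0 < d & forall s, `|s| < d -> 0 <= Sf (y + s *: v).
  pose m := `|2 * dot y v / rho ^+ 2| + `|dot v v / rho ^+ 2|.
  have m0 : 0 <= m by rewrite addr_ge0.
  have m1 : 0 < m + 1 by rewrite ltr_wpDl.
  exists (Num.min 1 (s0 / (m + 1))) => [|s]; rewrite lt_min ?ltr01; first by rewrite divr_gt0.
  move=> /andP[s1]; rewrite ltr_pdivlMr // => sm; rewrite Sfs.
  have := ler_norm (2 * dot y v / rho ^+ 2 * s); rewrite normrM => b1.
  have := ler_norm (dot v v / rho ^+ 2 * s ^+ 2); rewrite normrM normrX => b2.
  have b3 : `|dot v v / rho ^+ 2| * `|s| ^+ 2 <= `|dot v v / rho ^+ 2| * `|s|.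
    by rewrite ler_wpM2l // expr2 -[leRHS]mulr1 ler_wpM2l // ltW.
  by move: b1 b2 b3 sm (normr_ge0 s); rewrite /m; lra.
have TH v : - dot p v = 2 * (eps * E t) * s0 * (2 * dot y v / rho ^+ 2) /\
    - qf H v <= - (eps * E t * (2 * (2 * dot y v / rho ^+ 2) ^+ 2 - 4 * s0 * (dot v v / rho ^+ 2))).
  have [d d0 hd] := small v.
  have := T2N (T2_bump (eps * E t) s0 (2 * dot y v / rho ^+ 2) (dot v v / rho ^+ 2)).
  rewrite opprK => TB; apply: (T2_touch (T2N (TX v)) TB d0) => s sd.
  rewrite scale0r addr0 mulr0 expr0n /= mulr0 !subr0.
  have := mn t (y + s *: v) tt (hd s sd); rewrite /G /= addrA -/x Sfs -/s0; lra.
pose al := 2 * dot y w / rho ^+ 2; pose be := dot w w / rho ^+ 2.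
have be0 : 0 <= be by rewrite divr_ge0 ?dot_ge0 // ltW.
(* Going back in time by [s] while moving [y] by [s w] cancels the motion of the center, so [x]
   stays fixed and [D] varies in time alone. *)
have TT : dt <= - (eps * E t * (Lm * s0 ^+ 2 - 2 * s0 * al)).
  have [d d0 hd] := small w.
  have d'0 : 0 < Num.min (Num.min 1 d) (t - t0) by rewrite !lt_min ltr01 d0 subr_gt0.
  apply: (T1_left (C := eps * E t * (2 * s0 * be + Lm * (2 * s0 * `|al|) + Lm * (2 * s0 * be))) TD d'0) => s.
  rewrite !lt_min => /andP[sp /andP[/andP[s1 sd] st]].
  have sn : `|s| < d by rewrite gtr0_norm.
  have tt' : t0 <= t - s <= ts by lra.
  have := mn (t - s) (y + s *: w) tt' (hd s sn); rewrite /G /= Sfs -/al -/be -/s0.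
  have -> : xi (t - s) + (y + s *: w) = x.
    rewrite /x /xi addrAC [t - s - t0]addrAC scalerBl; apply/rowP => i; rewrite !mxE; ring.
  rewrite addr0 -/x => hm.
  have Es : E t * (1 + Lm * s) <= E (t - s).
    rewrite /E; have -> : - (Lm * (t - s - t0)) = - (Lm * (t - t0)) + Lm * s by ring.
    by rewrite expRD ler_wpM2l ?expR_ge0 // expR_ge1Dx.
  set Q := (s0 - al * s - be * s ^+ 2) ^+ 2 in hm.
  have Q0 : 0 <= Q by exact: sqr_ge0.
  have QS : s0 ^+ 2 - 2 * s0 * al * s - 2 * s0 * be * s ^+ 2 <= Q.
    rewrite -subr_ge0 /Q (_ : _ - _ = (al * s + be * s ^+ 2) ^+ 2) ?sqr_ge0 //; ring.
  have e1 : E t * (1 + Lm * s) * Q <= E (t - s) * Q by rewrite ler_wpM2r.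
  have e2 : (1 + Lm * s) * (s0 ^+ 2 - 2 * s0 * al * s - 2 * s0 * be * s ^+ 2) <= (1 + Lm * s) * Q.
    by rewrite ler_wpM2l // addr_ge0 // mulr_ge0 // ltW.
  have e3 : s0 ^+ 2 + s * (Lm * s0 ^+ 2 - 2 * s0 * al) - s ^+ 2 * (2 * s0 * be + Lm * (2 * s0 * `|al|) + Lm * (2 * s0 * be))
      <= (1 + Lm * s) * (s0 ^+ 2 - 2 * s0 * al * s - 2 * s0 * be * s ^+ 2).
    have g1 : Lm * s0 * s ^+ 2 * al <= Lm * s0 * s ^+ 2 * `|al|.
      by apply: ler_wpM2l; [rewrite !mulr_ge0 // ltW|exact: ler_norm].
    have g2 : Lm * s0 * be * s ^+ 2 * s <= Lm * s0 * be * s ^+ 2 * 1.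
      by have sl1 := ltW s1; apply: ler_wpM2l => //; rewrite mulr_ge0 ?sqr_ge0 // mulr_ge0 ?be0 // mulr_ge0.
    by move: g1 g2; lra.
  have e4 : E t * (s0 ^+ 2 + s * (Lm * s0 ^+ 2 - 2 * s0 * al) - s ^+ 2 * (2 * s0 * be + Lm * (2 * s0 * `|al|) + Lm * (2 * s0 * be)))
     <= E (t - s) * Q.
    by apply: le_trans e1; rewrite -[leRHS]mulrA ler_pM2l //; exact: le_trans e2.
  have e5 := ler_wpM2l (ltW eps0) e4.
  by move: hm e5; lra.
have k0 : 0 < eps * E t by rewrite mulr_gt0.
have trH : eps * E t * (8 / rho ^+ 4 * (lam S * dot y y) - 4 * s0 / rho ^+ 2 * Ct S) <= mtr (a S x) H.
  pose P := (eps * E t) *: ((8 / rho ^+ 4) *: (y^T *m y) - (4 * s0 / rho ^+ 2) *: 1%:M).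
  apply: (@le_trans _ _ (mtr (a S x) P)); last first.
    apply: psd_mtr_mono => [|v]; first exact: a_psd.
    have [_] := TH v; rewrite lerN2 => /(le_trans _); apply.
    rewrite qfZm qfDm qfNm !qfZm qf_outer qf1 le_eqVlt; apply/orP; left; apply/eqP; field.
    by rewrite gt_eqF.
  rewrite /P mtrZr mtrDr mtrNr !mtrZr mtr_outer mtr1 ler_wpM2l ?(ltW k0) // lerB //.
    by rewrite ler_wpM2l ?a_ell // divr_ge0 // exprn_ge0 // ltW.
  by rewrite ler_wpM2l ?a_tr // divr_ge0 ?mulr_ge0 // ltW.
have bp : - (eps * E t * (4 * s0 / rho * Cb S)) <= dot (b S x) p.
  have pE : p = - (eps * E t * (4 * s0 / rho ^+ 2)) *: y.
    apply/rowP => i; have [+ _] := TH (basis_vec i).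
    by rewrite !(dotC _ (basis_vec i)) !dot_basis mxE => /eqP; rewrite eqr_oppLR => /eqP ->; field; rewrite gt_eqF.
  rewrite pE dotZr mulNr lerN2 -[leLHS]mulrA ler_pM2l //.
  have : dot (b S x) y <= Cb S * rho.
    apply: (le_trans (dot_le_nrm _ _)); rewrite ler_pM ?nrm_ge0 ?b_bnd //.
    by rewrite yr.
  have z0 : 0 <= 4 * s0 / rho ^+ 2 by rewrite divr_ge0 ?mulr_ge0 // ltW.
  move=> /(ler_wpM2l z0); congr (_ <= _); field; by rewrite gt_eqF.
have wy : 2 * s0 * al <= s0 * (4 * V / rho).
  have : dot y w <= rho * V.
    by apply: (le_trans (dot_le_nrm _ _)); rewrite ler_pM ?nrm_ge0 // yr.
  have z0 : 0 <= 4 * s0 / rho ^+ 2 by rewrite divr_ge0 ?mulr_ge0 // ltW.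
  move=> /(ler_wpM2l z0); rewrite /al.
  have -> : 4 * s0 / rho ^+ 2 * dot y w = 2 * s0 * (2 * dot y w / rho ^+ 2) by field; rewrite gt_eqF.
  have -> // : 4 * s0 / rho ^+ 2 * (rho * V) = s0 * (4 * V / rho) by field; rewrite gt_eqF.
have KD : K * D t x <= K * (eps * (E t * s0 ^+ 2)) by rewrite ler_wpM2l // ltW.
have kE : kap * eps <= eps * E t * (A / 4).
  rewrite mulrC -mulrA ler_wpM2l ?(ltW eps0) //.
  have : kap * expR (Lm * T) * E t <= A / 4 * E t by rewrite ler_wpM2r // ltW.
  rewrite (mulrC (A / 4)); apply: le_trans.
  rewrite -mulrA ler_peMr ?(ltW kap0) // -expRD -expR0 ler_expR.
  have : Lm * (t - t0) <= Lm * T by rewrite ler_wpM2l //; lra.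
  by lra.
have gap := quadratic_gap (C := C) s0 A0 (erefl q).
have yy : dot y y / rho ^+ 2 = 1 - s0 by rewrite /s0 /Sf; ring.
have key : eps * E t * (8 / rho ^+ 4 * (lam S * dot y y) - 4 * s0 / rho ^+ 2 * Ct S
   - 4 * s0 / rho * Cb S - K * s0 ^+ 2 - A / 4 + (Lm * s0 ^+ 2 - s0 * (4 * V / rho))) <= 0.
  have := ler_wpM2l (ltW k0) wy; move: ineq TT trH bp KD kE; lra.
move: key; rewrite pmulr_rle0 //.
have -> : 8 / rho ^+ 4 * (lam S * dot y y) = A * (1 - s0).
  by rewrite -yy /A; field; rewrite gt_eqF.
have CE : C * s0 = 4 * s0 / rho ^+ 2 * Ct S + 4 * s0 / rho * Cb S + s0 * (4 * V / rho).
  by rewrite /C; field; rewrite gt_eqF.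
move: gap CE A0; rewrite /Lm; lra.
Qed.

End Barrier.

(** * Contact of two profiles *)

Section Touching.
Context {R : realType} {N : nat} (S : setting R N).
Implicit Types (x y w : 'rV[R]_N).
Variables (n1 n2 : 'rV[R]_N) (c1 c2 : R) (u1 ut1 u2 ut2 : R -> 'rV[R]_N -> R).
Hypotheses (W1 : wave S n1 c1 u1 ut1) (W2 : wave S n2 c2 u2 ut2).
Local Notation U1 := (prof n1 c1 u1).
Local Notation U2 := (prof n2 c2 u2).
Local Notation Ut1 := (prof n1 c1 ut1).
Local Notation Ut2 := (prof n2 c2 ut2).

(* Doubling the front variable [z] lets us compare profiles of different
   directions without differentiating them twice in [z]. *)
Lemma touching beta e d z z' x (Gam : R -> R) g1 g2 : 0 <= beta -> 0 < e -> 0 < d ->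
  T2 (fun s => Gam (z' + s)) g1 g2 ->
  (forall zt zt' y, `|zt - z| < d -> `|zt' - z'| < d ->
    U1 zt y - beta * U2 zt' y - Gam zt' - (zt - zt') ^+ 2 / e <=
    U1 z x - beta * U2 z' x - Gam z' - (z - z') ^+ 2 / e) ->
  [/\ beta * Ut2 z' x = c2 * (g1 - 2 * (z - z') / e),
      Ut1 z x = - (c1 * (2 * (z - z') / e)) &
      c1 / c2 * (beta * Ut2 z' x) - c1 * g1 - f S x (U1 z x) <=
      beta * (Ut2 z' x - f S x (U2 z' x)) + g2 * qf (a S x) n2 + g1 * dot (b S x) n2
      + 2 / e * qf (a S x) (n1 - n2) + 2 * (z - z') / e * dot (b S x) (n1 - n2)].
Proof.
move=> beta0 e0 d0 TG mx.
have c10 := w_c0 W1; have c20 := w_c0 W2.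
have [_ _ T1u1 S1] := w_sol W1; have [_ _ T1u2 S2] := w_sol W2.
set t1 := (dot x n1 - z) / c1; set t2 := (dot x n2 - z') / c2.
(* Changing the time of the first wave alone by [s] moves [z] by [- c1 s] at fixed [x]; likewise
   [z'] moves by [- c2 s] for the second wave. *)
have Et1 : Ut1 z x = - (c1 * (2 * (z - z') / e)).
  have dc : 0 < d / c1 by rewrite divr_gt0.
  have := @T1_touch _ _ _ (- (c1 * (2 * (z - z') / e))) (c1 ^+ 2 / e) _ (T1u1 t1 x) dc.
  apply=> s; rewrite ltr_pdivlMr // => sd; rewrite addr0.
  have := mx (z - c1 * s) z' x; rewrite [z - _]addrC addrK normrN normrM (gtr0_norm c10) (mulrC c1 `|s|).
  rewrite sd subrr normr0 d0 => /(_ isT isT).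
  have -> : U1 (- (c1 * s) + z) x = u1 (t1 + s) x.
    by rewrite /prof; congr u1; rewrite /t1; field; rewrite gt_eqF.
  rewrite -[U1 z x]/(u1 t1 x).
  have -> : (- (c1 * s) + z - z') ^+ 2 / e = (z - z') ^+ 2 / e + (- (c1 * (2 * (z - z') / e)) * s + c1 ^+ 2 / e * s ^+ 2).
    by field; rewrite gt_eqF.
  lra.
have Et2 : beta * Ut2 z' x = c2 * (g1 - 2 * (z - z') / e).
  have dc : 0 < d / c2 by rewrite divr_gt0.
  have TF := T1N (T1D (T1Z beta (T1u2 t2 x)) (T2_T1 (T2_scale (- c2) TG))).
  have := @T1_touch _ _ _ (2 * c2 * (z - z') / e) (c2 ^+ 2 / e) _ TF dc.
  suff h : forall s, `|s| < d / c2 ->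
     - (beta * u2 (t2 + s) x + Gam (z' + - c2 * s)) - - (beta * u2 (t2 + 0) x + Gam (z' + - c2 * 0)) <=
      2 * c2 * (z - z') / e * s + c2 ^+ 2 / e * s ^+ 2.
    by move=> /(_ h) E; rewrite -[Ut2 z' x]/(ut2 t2 x); lra.
  move=> s; rewrite ltr_pdivlMr // => sd; rewrite !addr0 mulr0 addr0.
  have := mx z (z' - c2 * s) x; rewrite [z' - _]addrC addrK normrN normrM (gtr0_norm c20) (mulrC c2 `|s|).
  rewrite sd subrr normr0 d0 => /(_ isT isT).
  have -> : U2 (- (c2 * s) + z') x = u2 (t2 + s) x.
    by rewrite /prof; congr u2; rewrite /t2; field; rewrite gt_eqF.
  rewrite -[U2 z' x]/(u2 t2 x).
  have -> : (z - (- (c2 * s) + z')) ^+ 2 / e = (z - z') ^+ 2 / e + (2 * c2 * (z - z') / e * s + c2 ^+ 2 / e * s ^+ 2).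
    by field; rewrite gt_eqF.
  rewrite (_ : - (c2 * s) + z' = z' + - c2 * s); last by ring.
  lra.
have [p1 [H1 [TX1 eX1]]] := S1 t1 x; have [p2 [H2 [TX2 eX2]]] := S2 t2 x.
pose m := n1 - n2; pose pe := 2 * (z - z') / e.
(* At fixed times, a displacement [s xi] of the common [x] moves [z] by [s n1 . xi] and [z'] by
   [s n2 . xi], so the penalty sees only [m . xi]. *)
have TX xi : dot p1 xi = beta * dot p2 xi + g1 * dot n2 xi + pe * dot m xi /\
    qf H1 xi <= beta * qf H2 xi + g2 * dot n2 xi ^+ 2 + 2 / e * dot m xi ^+ 2.
  have T3 : T2 (fun s => (z - z') ^+ 2 / e + pe * dot m xi * s + (2 / e * dot m xi ^+ 2) / 2 * s ^+ 2)
      (pe * dot m xi) (2 / e * dot m xi ^+ 2) by exact: T2_quad.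
  have := T2D (T2D (T2Z beta (TX2 xi)) (T2_scale (dot n2 xi) TG)) T3.
  rewrite (mulrC (dot n2 xi)) (mulrC (dot n2 xi ^+ 2)) => TT.
  have np : 0 < `|dot n1 xi| + `|dot n2 xi| + 1 by rewrite ltr_wpDl // addr_ge0.
  have d'0 := divr_gt0 d0 np.
  apply: (T2_touch (TX1 xi) TT d'0) => s; rewrite ltr_pdivlMr // => sd.
  rewrite !scale0r !addr0 !mulr0 !addr0 expr0n /= mulr0 addr0.
  have ss := normr_ge0 s; have q1 := normr_ge0 (dot n1 xi); have q2 := normr_ge0 (dot n2 xi).
  have b1 : `|s * dot n1 xi| < d.
    by rewrite normrM; apply: le_lt_trans sd; rewrite ler_wpM2l //; lra.
  have b2 : `|s * dot n2 xi| < d.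
    by rewrite normrM; apply: le_lt_trans sd; rewrite ler_wpM2l //; lra.
  have := mx (s * dot n1 xi + z) (s * dot n2 xi + z') (x + s *: xi).
  rewrite !addrK b1 b2 => /(_ isT isT).
  have -> : U1 (s * dot n1 xi + z) (x + s *: xi) = u1 t1 (x + s *: xi).
    by rewrite /prof; congr u1; rewrite /t1 dotDl dotZl (dotC n1 xi); congr (_ / _); ring.
  have -> : U2 (s * dot n2 xi + z') (x + s *: xi) = u2 t2 (x + s *: xi).
    by rewrite /prof; congr u2; rewrite /t2 dotDl dotZl (dotC n2 xi); congr (_ / _); ring.
  rewrite -[U1 z x]/(u1 t1 x) -[U2 z' x]/(u2 t2 x).
  have -> : (s * dot n1 xi + z - (s * dot n2 xi + z')) ^+ 2 / e =
     (z - z') ^+ 2 / e + pe * dot m xi * s + (2 / e * dot m xi ^+ 2) / 2 * s ^+ 2.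
    by rewrite /pe /m dotDl dotNl; field; rewrite gt_eqF.
  rewrite (_ : s * dot n2 xi + z' = z' + dot n2 xi * s); last ring.
  lra.
split=> //.
have pE : p1 = beta *: p2 + g1 *: n2 + pe *: m.
  apply/rowP => i; have [+ _] := TX (basis_vec i).
  by rewrite !(dotC _ (basis_vec i)) !dot_basis !mxE.
have HE : mtr (a S x) H1 <= beta * mtr (a S x) H2 + g2 * qf (a S x) n2 + 2 / e * qf (a S x) m.
  have := psd_mtr_mono (P := H1) (Q := beta *: H2 + g2 *: (n2^T *m n2) + (2 / e) *: (m^T *m m)) (a_psd S x).
  rewrite !mtrDr !mtrZr !mtr_outer; apply=> xi.
  by have [_] := TX xi; rewrite !qfDm !qfZm !qf_outer.
have bE : dot (b S x) p1 = beta * dot (b S x) p2 + g1 * dot (b S x) n2 + pe * dot (b S x) m.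
  by rewrite pE; move: (m) => mm; rewrite !dotDr !dotZr.
(* The two first-order conditions in time eliminate [Ut1] in favor of [Ut2] times the ratio of the
   speeds. *)
have V1 : c1 / c2 * (beta * Ut2 z' x) - c1 * g1 = Ut1 z x.
  by rewrite Et1 Et2; field; rewrite !gt_eqF.
rewrite V1 -[Ut1 z x]/(ut1 t1 x) -[Ut2 z' x]/(ut2 t2 x) eX1 eX2.
rewrite -[U1 z x]/(u1 t1 x) -[U2 z' x]/(u2 t2 x) bE -/pe -/m; move: HE; lra.
Qed.

(** Both profiles have the same limits at either end. It is [del * G] with [G >= 1] that makes the
    gap negative there, so that a positive maximum is attained at finite [z]. [G] will be either
    constant or [weight]. *)
Definition gap (G : R -> R) (e del s z z' : R) x : R :=
  U1 (z + s) x - U2 z' x - del * G z' - (z - z') ^+ 2 / e.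

(** [s] is taken within [d'] of the supremum of the shifts that allow a positive gap. From [s + d']
    on the gap is nonpositive, and uniform continuity of the first profile bounds it by [sg] at [s].
    Staying just short of the supremum keeps the gap positive, which confines the maximum to a
    compact set. *)
Lemma contact (G : R -> R) e del sg : continuous G -> (forall z, 1 <= G z <= 2) ->
  0 < e <= 1 -> 0 < del <= 1 / 16 -> 0 < sg ->
  exists s z z' x, [/\ forall (y1 y2 : R) y, gap G e del s y1 y2 y <= gap G e del s z z' x,
    0 < gap G e del s z z' x <= sg &
    forall s' (y1 y2 : R) y, s + sg <= s' -> gap G e del s' y1 y2 y <= 0].
Proof.
move=> cG G12 /andP[e0 e1] /andP[del0 del1] sg0.
have [Z1 Z10 hZ1] := prof_lim W1 del0; have [Z2 Z20 hZ2] := prof_lim W2 del0.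
have pen0 z z' : 0 <= (z - z') ^+ 2 / e by rewrite divr_ge0 ?sqr_ge0 // ltW.
have pos s z z' x : 0 < gap G e del s z z' x ->
    [/\ z + s < Z1, - (Z2 + 1) < z & `|z - z'| < 1].
  rewrite /gap => h; have /andP[p1 p2] := prof_01 W1 (z + s) x.
  have /andP[p3 p4] := prof_01 W2 z' x; have /andP[g1 g2] := G12 z'.
  have dG : del <= del * G z' by rewrite -[leLHS]mulr1 ler_wpM2l // ltW.
  have p0 := pen0 z z'.
  have zz : `|z - z'| < 1.
    have : (z - z') ^+ 2 / e < 1 by lra.
    rewrite ltr_pdivrMr // mul1r => q; rewrite -[ltRHS]normr1 -ltr_sqr ?nnegrE ?normr_ge0 //.
    by rewrite !real_normK ?num_real // expr1n; lra.
  split=> //.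
    by rewrite ltNge; apply/negP => zs; have := (hZ1 (z + s) x).1 zs; lra.
  rewrite ltNge; apply/negP => zs; move: zz; rewrite ltr_norml => /andP[q1 q2].
  by have := (hZ2 z' x).2 ltac:(lra); lra.
pose A : set R := [set s | exists z z' x, 0 < gap G e del s z z' x].
have ubA s : A s -> s <= Z1 + Z2 + 1.
  by move=> [z [z' [x /pos[h1 h2 _]]]]; lra.
have A0 : A !=set0.
  have [Y1 Y10 hY1] := prof_lim W1 (ltac:(lra) : (0 : R) < 1 / 2).
  have [Y2 Y20 hY2] := prof_lim W2 (ltac:(lra) : (0 : R) < 1 / 8).
  exists (- Y2 - Y1), Y2, Y2, 0; rewrite /gap subrr expr0n mul0r subr0.
  have := (hY1 (Y2 + (- Y2 - Y1)) 0).2 ltac:(lra).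
  have := (hY2 Y2 0).1 (lexx _); have /andP[g1 g2] := G12 Y2.
  have : del * G Y2 <= 1 / 16 * 2 by rewrite ler_pM //; lra.
  lra.
have supA : has_sup A by split=> //; exists (Z1 + Z2 + 1).
have [d d0 hd] := prof_unif W1 sg0.
pose d' := Num.min d sg.
have d'0 : 0 < d' by rewrite lt_min d0.
have [d'd d'sg] : d' <= d /\ d' <= sg by rewrite /d' !ge_min !lexx orbT.
have [s As sS] := sup_adherent d'0 supA.
have above s' : s + d' <= s' -> ~ A s'.
  by move=> ss' /(ub_le_sup supA.2); lra.
have neg s' (y1 y2 : R) y : s + d' <= s' -> gap G e del s' y1 y2 y <= 0.
  move=> h; rewrite leNgt; apply/negP => pp; apply: (above _ h); by exists y1, y2, y.
have [Bc Bc0 hBc] := lattice_reduce S.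
have [z0 [z0' [x0 P0]]] := As.
pose B := `|Z1 - s| + Z2 + 2.
have inB z z' x : 0 < gap G e del s z z' x -> - B <= z <= B /\ - B <= z' <= B.
  move=> /pos[h1 h2]; rewrite ltr_norml => /andP[h3 h4].
  have := ler_norm (Z1 - s); have := normr_ge0 (Z1 - s); rewrite /B; split; lra.
pose K : set (R * R * 'rV[R]_N) :=
  ([set z | - B <= z <= B] `*` [set z | - B <= z <= B]) `*` ball_nrm Bc.
have cK : compact K.
  by apply: compact_setX; [apply: compact_setX; exact: itv_compact|exact: ball_nrm_compact].
have cgap : continuous (fun p : R * R * 'rV[R]_N => gap G e del s p.1.1 p.1.2 p.2).
  have [k1 k2 k3] := @continuous_prod3 R R 'rV[R]_N.
  rewrite /gap; apply: continuous_subf; last first.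
    apply: continuous_mulf; last exact: continuous_cstf.
    have kd : continuous (fun p : R * R * 'rV[R]_N => p.1.1 - p.1.2) by exact: continuous_subf.
    exact: (continuous_compf (@exprn_continuous _ 2) kd).
  apply: continuous_subf; last first.
    apply: continuous_mulf; first exact: continuous_cstf.
    exact: (continuous_compf cG k2).
  apply: continuous_subf.
    apply: continuous_curry k3; first exact: (prof_continuous W1).
    by apply: continuous_addf => //; exact: continuous_cstf.
  by apply: continuous_curry k3 => //; exact: (prof_continuous W2).
have gper k z z' x : lattice (L S) k -> gap G e del s z z' (x + k) = gap G e del s z z' x.
  by move=> hk; rewrite /gap (prof_per W1) // (prof_per W2).
have [k0 hk0 xk0] := hBc x0.
have K0 : K (z0, z0', x0 + k0) by have [b1 b2] := inB _ _ _ P0; split; [split|exact: xk0].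
have [[[z z'] x] [[/= _ _] _] mx] := max_on (ex_intro _ _ K0) cK cgap.
have Pmax : 0 < gap G e del s z z' x.
  by apply: lt_le_trans P0 _; rewrite -(gper k0) //; exact: (mx (z0, z0', x0 + k0)).
exists s, z, z', x; split.
- move=> y1 y2 y; have [le0|gt0] := leP (gap G e del s y1 y2 y) 0.
    exact: le_trans le0 (ltW Pmax).
  have [k hk yk] := hBc y; rewrite -(gper k) //; apply: (mx (y1, y2, y + k)).
  by have [b1 b2] := inB _ _ _ gt0; split; [split|exact: yk].
- rewrite Pmax; have := neg (s + d') z z' x (lexx _); rewrite /gap.
  have := hd (z + s) (z + (s + d')) x; rewrite opprD addrACA subrr add0r opprD addrA subrr add0r.
  rewrite normrN gtr0_norm // => /(_ d'd); rewrite ler_norml; lra.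
- by move=> s' y1 y2 y h; apply: neg; lra.
Qed.

End Touching.

(** * Quantitative strong comparison between two waves *)

Section Lattice.
Context {R : realType} {N : nat} (S : setting R N).
Implicit Types (n x y w k : 'rV[R]_N).

Lemma nrm_unit n : dot n n = 1 -> nrm n = 1.
Proof. by rewrite /nrm => ->; rewrite sqrtr1. Qed.

(** At fixed [z], translating by [k] shifts time by [k . n / c]; this reaches arbitrarily early
    times on the same level of the profile. *)
Lemma lattice_far n B : dot n n = 1 -> exists2 k, lattice (L S) k & dot k n <= - B.
Proof.
move=> n1; have [i ni] : exists i, n 0 i != 0.
  apply/existsP; rewrite -negb_forall; apply/negP => /forallP h.
  have n0 : n = 0 by apply/rowP => i; rewrite mxE; exact/eqP.
  by move: n1; rewrite n0 dot0l => /esym/eqP; rewrite oner_eq0.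
have Li := L_gt0 S i; pose al := L S i * n 0 i.
have al0 : al != 0 by rewrite mulf_neq0 // gt_eqF.
have [j hj] : exists j : int, al * j%:~R <= - B.
  have [ap|an] := ltP 0 al.
    exists (Num.floor (- B / al)); rewrite mulrC -ler_pdivlMr //; exact: floor_le.
  have {}an : al < 0 by rewrite lt_neqAle al0.
  exists (- Num.floor (B / al)); rewrite mulrNz mulrN lerN2.
  have h : al * (B / al) <= al * (Num.floor (B / al))%:~R by rewrite ler_nM2l ?floor_le.
  apply: le_trans h.
  by rewrite le_eqVlt; apply/orP; left; apply/eqP; field.
exists ((L S i * j%:~R) *: basis_vec i).
  exists (fun l => if l == i then j else 0) => l; rewrite !mxE /=.
  by case: eqP => [->|_]; rewrite ?mulr1 ?mulr0.
rewrite dotZl dot_basis (_ : _ * _ = al * j%:~R) // /al; ring.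
Qed.

(** Two waves are compared at the same [(t, x)], where their front variables differ; this controls
    the difference on bounded regions. *)
Lemma profile_gap n c n0 c0 t x Rx T (sg : R) : nrm (n - n0) <= sg -> `|c - c0| <= sg ->
  nrm x <= Rx -> `|t| <= T -> 0 <= sg ->
  `|(dot x n - c * t) - (dot x n0 - c0 * t)| <= (Rx + T) * sg.
Proof.
move=> hn hc hx ht sg0.
have -> : (dot x n - c * t) - (dot x n0 - c0 * t) = dot x (n - n0) - (c - c0) * t.
  by rewrite dotDr dotNr; ring.
apply: (le_trans (ler_normB _ _)); rewrite [leRHS]mulrDl lerD //.
  by apply: (le_trans (cauchy_schwarz _ _)); rewrite ler_pM ?nrm_ge0.
by rewrite normrM mulrC ler_pM.
Qed.

End Lattice.

(** By contradiction: if the profile of [n] lies [eta] below that of [n0] at some point, a lattice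
    translate of this point precedes the contact in time, the Lipschitz bound turns it into a ball
    where [u0 - u] is large, and [positivity_spread] carries a fraction of the excess to the
    contact, where the two profiles are too close for that. *)
Lemma identify (R : realType) (N : nat) (S : setting R N) (n0 : 'rV[R]_N) (c0 : R)
    (u0 ut0 : R -> 'rV[R]_N -> R) (W0 : wave S n0 c0 u0 ut0) (Z Z1 eta : R) :
  0 < Z -> 0 < Z1 -> 0 < eta <= 1 ->
  exists2 sg, 0 < sg & forall n c u ut, wave S n c u ut ->
  nrm (n - n0) <= sg -> `|c - c0| <= sg ->
  (forall z x, prof n c u z x <= prof n0 c0 u0 z x + sg) ->
  forall zs xs, `|zs| <= Z -> prof n0 c0 u0 zs xs - sg <= prof n c u zs xs ->
  forall z x, `|z| <= Z1 -> prof n0 c0 u0 z x - eta <= prof n c u z x.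
Proof.
move=> Z0 Z10 /andP[eta0 eta1]; have c00 := w_c0 W0; have n01 := w_n1 W0.
have [Bc Bc0 hBc] := lattice_reduce S.
(* This ensures a delay [ts - t0 >= 1]: [2 c0] dominates [c], and the extra 1 pays for replacing
   [n0] by [n]. *)
have [k hk kn] := lattice_far S (1 + 2 * Bc + Z + Z1 + 2 * c0) n01.
have [Lam Lam0 hLam] := wave_lipschitz S.
have nk := nrm_ge0 k; have Kf0 := Kf_ge0 S.
pose num := nrm k + 2 * Bc + Z + Z1.
have num0 : 0 < num by rewrite /num; move: nk Bc0 Z0 Z10; clear; lra.
pose T := num / (c0 / 2).
have T0 : 0 < T by rewrite divr_gt0 // divr_gt0.
pose V := 2 * Bc + nrm k; have V0 : 0 <= V by rewrite /V; move: nk Bc0; clear; lra.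
pose rho := eta / (8 * Lam).
have rho0 : 0 < rho by rewrite divr_gt0 // mulr_gt0.
have [kap kap0 spread] := positivity_spread S T0 V0 rho0 Kf0.
pose eps := eta / 4; have eps0 : 0 < eps by rewrite divr_gt0.
(* The denominator pays for the Lipschitz defect [2 Kf e'] of the reaction and for the at most
   [4 e'] by which [D] can exceed 0 at the contact. *)
pose e' := Num.min (eta / 8) (kap * eps / (2 * Kf S + 8)).
have Kf8 : 0 < 2 * Kf S + 8 by move: Kf0; clear; lra.
have ke0 : 0 < kap * eps by rewrite mulr_gt0.
have e'0 : 0 < e' by rewrite lt_min !divr_gt0.
have e'eta : e' <= eta / 8 by rewrite ge_min lexx.
have e'k : e' * (2 * Kf S + 8) <= kap * eps by rewrite -ler_pdivlMr // ge_min lexx orbT.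
have e'Kf : 0 <= e' * (2 * Kf S) by rewrite mulr_ge0 ?mulr_ge0 // ltW.
have [d d0 hd] := prof_unif W0 e'0.
pose Ry := Bc + nrm k + V * T + rho.
have VT : 0 <= V * T by rewrite mulr_ge0 // ltW.
have Ry0 : 0 < Ry by rewrite /Ry; move: Bc0 nk VT rho0; clear; lra.
pose sg := Num.min (Num.min (c0 / 2) (1 / (nrm k + 1))) (Num.min e' (d / (Ry + T))).
have nk1 : 0 < nrm k + 1 by move: nk; clear; lra.
have RT : 0 < Ry + T by rewrite addr_gt0.
have sg0 : 0 < sg.
  rewrite lt_min; apply/andP; split; first by rewrite lt_min !divr_gt0.
  by rewrite lt_min; apply/andP; split=> //; rewrite divr_gt0.
have [s1 s2 s3 s4] : [/\ sg <= c0 / 2, sg * (nrm k + 1) <= 1, sg <= e' & sg * (Ry + T) <= d].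
  rewrite -!ler_pdivlMr //; split; rewrite /sg; [| | |];
    by rewrite [Num.min _ _ <= _]ge_min ?[Num.min (c0 / 2) _ <= _]ge_min ?[Num.min e' _ <= _]ge_min lexx ?orbT.
exists sg => // n c u ut W hn hc Ule zs xs zsZ contact z x zZ1.
have c_0 := w_c0 W; have n1 := nrm_unit (w_n1 W).
move: (hc); rewrite ler_norml => /andP[c1 c2].
have cc1 : c0 / 2 <= c by move: c1 s1; clear; lra.
have cc2 : c <= 2 * c0 by move: c2 s1 c00; clear; lra.
wlog [xsB xB] : xs x contact / nrm xs <= Bc /\ nrm x <= Bc => [hw|].
  have [k1 hk1 xk1] := hBc xs; have [k2 hk2 xk2] := hBc x.
  have := hw (xs + k1) (x + k2); rewrite !(prof_per W) // !(prof_per W0) //.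
  by apply=> //; split.
rewrite leNgt; apply/negP => bad.
pose x0 := x + k; pose ts := (dot xs n - zs) / c; pose t0 := (dot x0 n - z) / c.
have x0B : nrm x0 <= Bc + nrm k by apply: (le_trans (nrmD _ _)); rewrite lerD2r.
have dxs : `|dot xs n| <= Bc by apply: (le_trans (cauchy_schwarz _ _)); rewrite n1 mulr1.
have dx : `|dot x n| <= Bc by apply: (le_trans (cauchy_schwarz _ _)); rewrite n1 mulr1.
have dk : `|dot k n| <= nrm k by apply: (le_trans (cauchy_schwarz _ _)); rewrite n1 mulr1.
have dk2 : dot k n <= - (2 * Bc + Z + Z1 + 2 * c0).
  have -> : dot k n = dot k n0 + dot k (n - n0) by rewrite dotDr dotNr; ring.
  have : dot k (n - n0) <= nrm k * sg.
    by apply: (le_trans (dot_le_nrm _ _)); rewrite ler_wpM2l.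
  by move: kn s2 sg0; rewrite (mulrC sg); clear; lra.
have bnds : [/\ - Bc <= dot xs n <= Bc, - Bc <= dot x n <= Bc, - Z <= zs <= Z, - Z1 <= z <= Z1 & - nrm k <= dot k n <= nrm k].
  by rewrite -!ler_norml; split.
have [/andP[q1 q2] /andP[q3 q4] /andP[q5 q6] /andP[q7 q8] /andP[q9 q10]] := bnds.
have x0n : dot x0 n = dot x n + dot k n by rewrite dotDl.
have tse : c * ts = dot xs n - zs by rewrite /ts mulrC divfK // gt_eqF.
have t0e : c * t0 = dot x0 n - z by rewrite /t0 mulrC divfK // gt_eqF.
have t01 : 1 <= ts - t0.
  rewrite -(ler_pM2l c_0) mulrBr tse t0e x0n mulr1.
  by move: cc2 q1 q4 q6 q7 dk2; clear; lra.
have tsT : ts <= t0 + T.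
  rewrite -lerBlDl.
  rewrite /T ler_pdivlMr ?divr_gt0 //.
  have tt : 0 <= ts - t0 by exact: le_trans ler01 t01.
  have : (ts - t0) * (c0 / 2) <= (ts - t0) * c by rewrite ler_wpM2l.
  move/le_trans; apply; rewrite mulrC mulrBr tse t0e x0n /num.
  by move: q2 q3 q9 q5 q8; clear; lra.
have absT t : t0 <= t <= ts -> `|t| <= T.
  move=> /andP[h1 h2]; rewrite ler_norml /T.
  have e2 : T * (c0 / 2) = num by rewrite /T divfK // gt_eqF // divr_gt0.
  have Tc : T * (c0 / 2) <= T * c by rewrite ler_wpM2l // ltW.
  rewrite -/T -(ler_pM2l c_0) -(ler_pM2l c_0 t).
  have g1 : c * t0 <= c * t by rewrite ler_pM2l.
  have g2 : c * t <= c * ts by rewrite ler_pM2l.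
  by move: Tc g1 g2; rewrite e2 tse t0e x0n /num => Tc g1 g2; apply/andP; split; move: Tc g1 g2 q1 q2 q3 q4 q5 q6 q7 q8 q9 q10 Bc0 Z0 Z10 nk; clear; lra.
have yB t y : t0 <= t <= ts -> nrm (y - x0) <= V * T + rho ->
    `|(dot y n - c * t) - (dot y n0 - c0 * t)| <= d.
  move=> ht hy; apply: (le_trans _ s4); rewrite (mulrC sg).
  apply: profile_gap => //; [|exact: absT|exact: ltW].
  have -> : y = x0 + (y - x0) by rewrite addrC subrK.
  by apply: (le_trans (nrmD _ _)); rewrite /Ry; move: hy x0B; clear; lra.
pose D t y := u0 t y - u t y + 2 * e'.
have Dge t y : t0 <= t <= ts -> nrm (y - x0) <= V * T + rho -> 0 <= D t y.
  move=> ht hy; rewrite /D (u_prof W) (u_prof W0).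
  have := hd _ _ y (yB t y ht hy); rewrite ler_norml.
  by move: (Ule (dot y n - c * t) y) s3; clear; lra.
have tt : t0 <= ts by move: t01; clear; lra.
have tt0 : t0 <= t0 <= ts by rewrite lexx.
have tts : t0 <= ts <= ts by rewrite lexx andbT.
have vs : nrm (xs - x0) <= V.
  by apply: (le_trans (nrmD _ _)); rewrite nrmN /V; move: x0B xsB; clear; lra.
have V1 : V * 1 <= V * (ts - t0) by rewrite ler_wpM2l.
have VT1 : V * (ts - t0) <= V * T by rewrite ler_wpM2l // lerBlDl.
have uc : continuous (fun p : R * 'rV[R]_N => D p.1 p.2).
  have [h1 _ _ _] := w_sol W; have [h2 _ _ _] := w_sol W0.
  by apply: continuous_addf; [exact: continuous_subf|exact: continuous_cstf].
have := spread D t0 ts x0 xs eps uc eps0.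
have -> : t0 < ts <= t0 + T by rewrite tsT andbT; move: t01; clear; lra.
have -> : nrm (xs - x0) <= V * (ts - t0) by apply: le_trans vs _; rewrite -[leLHS]mulr1.
move=> /(_ isT isT Dge) concl.
suff : kap * eps <= D ts xs.
  have zE : dot xs n - c * ts = zs by rewrite tse; ring.
  have vs' : nrm (xs - x0) <= V * T + rho by move: vs V1 VT1 rho0; clear; lra.
  have := hd _ _ xs (yB ts xs tts vs'); rewrite zE ler_norml.
  rewrite /D (u_prof W ts) (u_prof W0 ts) zE; move: contact e'k e'Kf e'0 s3; clear; lra.
apply: concl => [y yr|t y].
  have zE : dot x0 n - c * t0 = z by rewrite t0e; ring.
  have r1 : nrm (x0 - x0) <= V * T + rho by rewrite subrr nrm0 addr_ge0 // ltW.
  have := hd _ _ x0 (yB t0 x0 tt0 r1); rewrite zE ler_norml.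
  have p1 : prof n0 c0 u0 z x0 = prof n0 c0 u0 z x by rewrite (prof_per W0).
  have p2 : u t0 x0 = prof n c u z x by rewrite (u_prof W) zE (prof_per W).
  have := hLam _ _ _ _ W t0 y x0; rewrite ler_norml.
  have := hLam _ _ _ _ W0 t0 y x0; rewrite ler_norml.
  have : Lam * nrm (y - x0) <= eta / 8.
    have -> : eta / 8 = Lam * rho by rewrite /rho; move: Lam0; clear=> L0; field; rewrite gt_eqF.
    by rewrite ler_wpM2l // ltW.
  rewrite p1 p2 -(u_prof W0) /D /eps; move: bad e'eta e'0 eta0; clear; lra.
move=> ht hy Deps.
have [_ _ T1u Su] := w_sol W; have [_ _ T1u0 Su0] := w_sol W0.
have [p [H [TX eX]]] := Su t y; have [p0 [H0 [TX0 eX0]]] := Su0 t y.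
exists (ut0 t y - ut t y), (p0 - p), (H0 - H); split.
- have := T1D (T1B (T1u0 t y) (T1u t y)) (T1_lin (2 * e') 0); rewrite addr0.
  by apply: T1_ext => s; rewrite mul0r addr0.
- move=> xi; have := T2D (T2B (TX0 xi) (TX xi)) (T2_quad (2 * e') 0 0).
  rewrite !addr0 qfDm qfNm dotDl dotNl; apply: T2_ext => s.
  by rewrite !mul0r !addr0.
rewrite eX eX0 mtrDr mtrNr dotDr dotNr.
have /andP[u1 u2] := w_01 W t y; have /andP[u3 u4] := w_01 W0 t y.
have := @f_lip _ _ S y (u0 t y) (u t y); rewrite (ltW u1) (ltW u2) (ltW u3) (ltW u4) => /(_ isT isT).
have D0 := Dge t y (introT andP (conj (ltW (andP ht).1) (andP ht).2)) hy.
have : Kf S * `|u0 t y - u t y| <= Kf S * (D t y + 2 * e').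
  by rewrite ler_wpM2l // ler_norml /D; move: D0 e'0; rewrite /D; clear; lra.
rewrite ler_norml; move: e'k e'0; rewrite /D; clear; lra.
Qed.

(** * A weight that makes contacts strict *)

Section Weight.
Context {R : realType}.

(** Bounded and strictly concave on each side of 0; for large [K] it is a strict supersolution away
    from 0, which decides contacts where the reaction gives only a weak inequality. The kink at 0 is
    harmless, since a contact near 0 already lies in the desired range. *)
Definition weight (K z : R) : R := 2 - expR (- (K * `|z|)).

Lemma weight_continuous K : continuous (weight K).
Proof.
apply: continuous_subf; first exact: continuous_cstf.
apply: (continuous_compf (k := expR)); first exact: continuous_expR.
apply: continuous_oppf; apply: continuous_mulf; first exact: continuous_cstf.
exact: norm_continuous.
Qed.

Lemma weight_itv K z : 0 <= K -> 1 <= weight K z <= 2.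
Proof.
move=> K0; rewrite /weight gerBl expR_ge0 andbT lerBrDr -lerBrDl.
rewrite (_ : 2 - 1 = expR 0); last by rewrite expR0; ring.
by rewrite ler_expR oppr_le0 mulr_ge0.
Qed.

Lemma T2_local (F G : R -> R) p r d : 0 < d -> (forall s, `|s| < d -> F s = G s) ->
  T2 F p r -> T2 G p r.
Proof.
move=> d0 FG h e e0; have [d' d'0 hd'] := h e e0.
exists (Num.min d d') => [|s]; rewrite lt_min ?d0 // => /andP[sd /hd'].
by rewrite !FG // normr0.
Qed.

Lemma T2_weight K z : z != 0 ->
  T2 (fun s => weight K (z + s)) (K * Num.sg z * expR (- (K * `|z|)))
     (- (K ^+ 2 * expR (- (K * `|z|)))).
Proof.
move=> z0; have nz : 0 < `|z| by rewrite normr_gt0.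
have e1 : Num.sg z ^+ 2 = 1 by rewrite sqr_sg z0.
have := T2B (T2_quad 2 0 0) (T2_exp (- (K * Num.sg z)) (- (K * `|z|))).
have -> : 0 - - (K * Num.sg z) * expR (- (K * `|z|)) = K * Num.sg z * expR (- (K * `|z|)) by ring.
have -> : 0 - (- (K * Num.sg z)) ^+ 2 * expR (- (K * `|z|)) = - (K ^+ 2 * expR (- (K * `|z|))).
  by rewrite sqrrN exprMn e1; ring.
apply: (T2_local nz) => s sz; rewrite /weight !mul0r !addr0; congr (2 - expR _).
have -> : `|z + s| = Num.sg z * (z + s); last by rewrite mulrDr -normrEsg; ring.
move: sz nz; rewrite ltr_norml; have [zn|zp|->] := ltgtP z 0; last by rewrite normr0 ltxx.
  by rewrite ltr0_sg // (ltr0_norm zn) => /andP[h1 h2] _; rewrite mulN1r ler0_norm //; lra.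
by rewrite gtr0_sg // (gtr0_norm zp) => /andP[h1 h2] _; rewrite mul1r ger0_norm //; lra.
Qed.

(** The second-order term, at least [K^2 lam], outweighs the first-order one, at most [K (Cb + c)],
    whatever the sign of [z]. *)
Lemma weight_strict N (S : setting R N) (n x : 'rV[R]_N) (c K z : R) :
  dot n n = 1 -> 0 <= c -> 0 < K -> Cb S + c + 1 <= K * lam S -> z != 0 ->
  - (K ^+ 2 * expR (- (K * `|z|))) * qf (a S x) n
  + K * Num.sg z * expR (- (K * `|z|)) * (dot (b S x) n + c) <= - (K * expR (- (K * `|z|))).
Proof.
move=> n1 c0 K0 hK z0; set E := expR _.
have KE : 0 < K * E by rewrite mulr_gt0 ?expR_gt0.
have q1 := a_ell S x n; rewrite n1 mulr1 in q1.
have : `|dot (b S x) n| <= Cb S.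
  apply: (le_trans (cauchy_schwarz _ _)); rewrite (nrm_unit n1) mulr1; exact: b_bnd.
rewrite ler_norml => /andP[b1 b2].
have sg1 : Num.sg z * (dot (b S x) n + c) <= Cb S + c.
  have [zn|zp|zE] := ltgtP z 0; last by rewrite zE eqxx in z0.
    by rewrite ltr0_sg // mulN1r; move: b1 c0; clear; lra.
  by rewrite gtr0_sg // mul1r; move: b2; clear; lra.
have Kq : K * lam S <= K * qf (a S x) n by rewrite ler_wpM2l // ltW.
have : K * E * (- (K * qf (a S x) n) + Num.sg z * (dot (b S x) n + c)) <= K * E * (- 1).
  by rewrite ler_wpM2l ?(ltW KE) //; move: sg1 Kq hK; clear; lra.
by clear; lra.
Qed.

End Weight.

(** * Contacts and monotonicity of the profile *)

Section Gap.
Context {R : realType} {N : nat} (S : setting R N).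
Variables (n1 n2 : 'rV[R]_N) (c1 c2 : R) (u1 ut1 u2 ut2 : R -> 'rV[R]_N -> R).
Hypotheses (W1 : wave S n1 c1 u1 ut1) (W2 : wave S n2 c2 u2 ut2).

Definition front_shift (c s : R) (u : R -> 'rV[R]_N -> R) := fun t x => u (t + (- s / c)) x.

Lemma prof_front_shift s z x : prof n1 c1 (front_shift c1 s u1) z x = prof n1 c1 u1 (z + s) x.
Proof.
have c0 := w_c0 W1; rewrite (@prof_shift R N n1 c1 u1 (- s / c1) z x c0); congr prof.
by field; rewrite gt_eqF.
Qed.

Lemma wave_front_shift s : wave S n1 c1 (front_shift c1 s u1) (front_shift c1 s ut1).
Proof. exact: wave_shift W1. Qed.

Lemma sqr_le_norm (y d : R) : 0 <= d -> y ^+ 2 <= d ^+ 2 -> `|y| <= d.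
Proof. by move=> d0 h; rewrite -ler_sqr ?nnegrE ?normr_ge0 // real_normK ?num_real. Qed.

Lemma gap_pos G e del s z z' x : (forall z, 1 <= G z <= 2) -> 0 < e -> 0 < del ->
  0 < gap n1 n2 c1 c2 u1 u2 G e del s z z' x ->
  [/\ (z - z') ^+ 2 < e, prof n2 c2 u2 z' x + del < prof n1 c1 u1 (z + s) x &
      prof n2 c2 u2 z' x < 1 - del].
Proof.
move=> G12 e0 del0; rewrite /gap => h.
have /andP[p1 p2] := prof_01 W1 (z + s) x; have /andP[p3 p4] := prof_01 W2 z' x.
have /andP[g1 g2] := G12 z'.
have dG : del <= del * G z' by rewrite -[leLHS]mulr1 ler_wpM2l // ltW.
have p0 : 0 <= (z - z') ^+ 2 / e by rewrite divr_ge0 ?sqr_ge0 // ltW.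
split; [|by move: h dG p0; clear; lra|by move: h dG p0 p2; clear; lra].
have : (z - z') ^+ 2 / e < 1 by move: h dG p0 p2 p3 del0; clear; lra.
by rewrite ltr_pdivrMr // mul1r.
Qed.

Lemma gap_max G e del s z z' x sg : (forall z, 1 <= G z <= 2) -> 0 < del ->
  (forall (y1 y2 : R) y, gap n1 n2 c1 c2 u1 u2 G e del s y1 y2 y <= gap n1 n2 c1 c2 u1 u2 G e del s z z' x) ->
  gap n1 n2 c1 c2 u1 u2 G e del s z z' x <= sg ->
  forall y1 y, prof n1 c1 u1 (y1 + s) y <= prof n2 c2 u2 y1 y + 2 * del + sg.
Proof.
move=> G12 del0 mx le y1 y; have := mx y1 y1 y; rewrite {1}/gap subrr expr0n mul0r subr0.
have /andP[g1 g2] := G12 y1; have : del * G y1 <= del * 2 by rewrite ler_wpM2l // ltW.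
by move: le; clear; lra.
Qed.

End Gap.

(** Halving [theta] and [rho] leaves room for the perturbation of a contact, and [Z - 1] for the
    distance, at most 1, between the coupled front variables. *)
Lemma far_zone (R : realType) (N : nat) (S : setting R N) (n : 'rV[R]_N) (c : R)
    (u ut : R -> 'rV[R]_N -> R) (W : wave S n c u ut) : exists2 Z, 1 <= Z & forall z x,
  (Z - 1 <= z -> prof n c u z x <= theta S / 2) /\
  (z <= - Z -> 1 - rho S / 2 <= prof n c u z x).
Proof.
have /andP[th0 _] := theta_itv S.
have [Z1 Z10 h1] := prof_lim W (divr_gt0 th0 (ltr0n R 2)).
have [Z2 Z20 h2] := prof_lim W (divr_gt0 (rho_gt0 S) (ltr0n R 2)).
exists (Z1 + Z2 + 1) => [|z x]; first by move: Z10 Z20; clear; lra.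
split=> hz; [apply: (h1 z x).1|apply: (h2 z x).2]; move: hz Z10 Z20; clear; lra.
Qed.

(** With equal directions and speeds, the time derivatives and the mismatch terms cancel in
    [touching]. The weight leaves [f x v < f x w] with [v < w], which fails ahead of the front,
    where both sides are 0, and behind it, where [f] is nonincreasing. *)
Lemma self_contact_middle (R : realType) (N : nat) (S : setting R N) (n : 'rV[R]_N) (c : R)
    (u ut : R -> 'rV[R]_N -> R) (W : wave S n c u ut) (Z K e del s z z' : R) (x : 'rV[R]_N) sg :
  (forall z x, (Z - 1 <= z -> prof n c u z x <= theta S / 2) /\
    (z <= - Z -> 1 - rho S / 2 <= prof n c u z x)) -> 1 <= Z ->
  0 < K -> Cb S + c + 1 <= K * lam S -> 0 < e <= 1 -> 0 < del -> 2 * del + sg <= theta S / 2 ->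
  (forall (y1 y2 : R) y, gap n n c c u u (weight K) e del s y1 y2 y <=
     gap n n c c u u (weight K) e del s z z' x) ->
  0 < gap n n c c u u (weight K) e del s z z' x <= sg -> `|z'| <= Z.
Proof.
move=> hZ Z1 K0 hK /andP[e0 e1] del0 small mx /andP[gp gs].
rewrite leNgt; apply/negP => zZ.
have z'0 : z' != 0 by rewrite -normr_gt0; apply: le_lt_trans zZ; move: Z1; clear; lra.
have wt z0 : 1 <= weight K z0 <= 2 by apply: weight_itv; exact: ltW.
have [pz vw v1] := gap_pos W W wt e0 del0 gp.
have W' := wave_front_shift W s.
have zz : `|z - z'| <= 1.
  by apply: sqr_le_norm => //; rewrite expr1n; move: pz e1; clear; lra.
have TG := T2Z del (T2_weight K z'0).
have [|_ _] := @touching _ _ S n n c c _ _ _ _ W' W 1 e 1 z z' x (fun y => del * weight K y) _ _ ler01 e0 ltr01 TG.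
  by move=> y1 y2 y _ _; have := mx y1 y2 y; rewrite /gap !(prof_front_shift W) !mul1r.
rewrite (prof_front_shift W) !mul1r subrr.
have -> : qf (a S x) 0 = 0 by rewrite -(scale0r (0 : 'rV[R]_N)) qfZ expr0n mul0r.
rewrite dot0r !mulr0 !addr0 divff ?gt_eqF ?(w_c0 W) // mul1r => ineq.
have := weight_strict x (w_n1 W) (ltW (w_c0 W)) K0 hK z'0 => /(ler_wpM2l (ltW del0)) strict.
have KE : 0 < del * (K * expR (- (K * `|z'|))) by rewrite !mulr_gt0 ?expR_gt0.
have {ineq strict KE} ff : f S x (prof n c u z' x) < f S x (prof n c u (z + s) x).
  by move: ineq strict KE; clear; lra.
have /andP[w0 w1] := prof_01 W (z + s) x; have /andP[v0 v1'] := prof_01 W z' x.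
have /andP[th0 th1] := theta_itv S.
have [zpos|zneg] := leP 0 z'.
  have z'Z : Z < z' by move: zZ; rewrite ger0_norm.
  have zl : Z - 1 <= z by move: zz z'Z; rewrite ler_norml; clear; lra.
  have wth := gap_max wt del0 mx gs z x.
  have uz := (hZ z x).1 zl.
  have wle : prof n c u (z + s) x <= theta S by move: wth uz small; clear; lra.
  have vle : prof n c u z' x <= theta S by move: wle vw del0; clear; lra.
  by move: ff; rewrite !f_0 ?ltxx // ?(ltW v0) ?(ltW w0).
have z'Z : z' <= - Z by move: zZ; rewrite ltr0_norm //; clear; lra.
have vr := (hZ z' x).2 z'Z; have rh := rho_gt0 S.
have := @f_mono _ _ S x (prof n c u z' x) (prof n c u (z + s) x) (ltW v0).
have -> : 1 - rho S < prof n c u z' x by move: vr rh; clear; lra.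
have -> : prof n c u z' x <= prof n c u (z + s) x by move: vw del0; clear; lra.
by rewrite (ltW w1) => /(_ isT isT isT); rewrite leNgt ff.
Qed.

(* Iterating [U z - eta <= U (z + s)] from [-Z1] to beyond [Z1] would lose only
   [J eta], less than the drop of [U]. *)
Lemma no_almost_period (R : realType) (N : nat) (S : setting R N) (n : 'rV[R]_N) (c : R)
    (u ut : R -> 'rV[R]_N -> R) (W : wave S n c u ut) (s0 : R) : 0 < s0 ->
  exists Z1 eta : R, [/\ 0 < Z1, 0 < eta <= 1 & forall s, s0 <= s ->
    ~ (forall z x, `|z| <= Z1 -> prof n c u z x - eta <= prof n c u (z + s) x)].
Proof.
move=> s00; have q0 : (0 : R) < 1 / 4 by rewrite divr_gt0.
have [Z1 Z10 hZ1] := prof_lim W q0.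
pose J := Num.bound (2 * Z1 / s0).
have JZ : 2 * Z1 < J%:R * s0.
  have := archi_boundP (ltW (divr_gt0 (mulr_gt0 (ltr0n R 2) Z10) s00)).
  by rewrite -/J ltr_pdivrMr.
have J1 : 0 < 4 * (J%:R + 1) :> R by rewrite mulr_gt0 // ltr_wpDl.
exists Z1, (1 / (4 * (J%:R + 1))); split=> //.
  rewrite divr_gt0 //= ler_pdivrMr //.
  by have := ler0n R J; clear; lra.
move=> s ss0 H; set eta := 1 / _ in H.
have Jeta : J%:R * eta <= 1 / 4.
  rewrite /eta mulrA ler_pdivrMr //; have := ler0n R J; clear; lra.
have eta0 : 0 < eta by rewrite divr_gt0.
suff chain j : (j <= J)%N -> - Z1 + j%:R * s <= Z1 /\ 3 / 4 - j%:R * eta <= prof n c u (- Z1 + j%:R * s) 0.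
  have [h _] := chain J (leqnn _).
  have : J%:R * s0 <= J%:R * s by rewrite ler_wpM2l.
  by move: h JZ; clear; lra.
elim: j => [_|j IH jJ].
  rewrite mul0r addr0 mul0r subr0; split; first by move: Z10; clear; lra.
  by have := (hZ1 (- Z1) 0).2 (lexx _); clear; lra.
have [h1 h2] := IH (ltnW jJ); rewrite -natr1.
have js : 0 <= j%:R * s by rewrite mulr_ge0 // (le_trans (ltW s00)).
have zj : `|- Z1 + j%:R * s| <= Z1 by rewrite ler_norml h1 andbT; move: js; clear; lra.
have := H _ 0 zj; rewrite (_ : - Z1 + j%:R * s + s = - Z1 + (j%:R + 1) * s) => [h3|]; last by ring.
have eJ : (j%:R + 1) * eta <= 1 / 4.
  by apply: le_trans Jeta; rewrite ler_wpM2r ?(ltW eta0) // natr1 ler_nat.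
have lower : 3 / 4 - (j%:R + 1) * eta <= prof n c u (- Z1 + (j%:R + 1) * s) 0.
  by move: h2 h3; clear; lra.
split=> //; rewrite leNgt; apply/negP => big.
have := (hZ1 _ 0).1 (ltW big); move: lower eJ; clear; lra.
Qed.

(** Let [s'] be the nearly maximal shift from [contact]. If [s' + r <= s], the ordering is read off
    at [s] up to [2 del]. Otherwise the contact makes [U] and its shift by [s'] nearly equal on a
    long range, a near period that [no_almost_period] forbids. *)
Lemma prof_decreasing (R : realType) (N : nat) (S : setting R N) (n : 'rV[R]_N) (c : R)
    (u ut : R -> 'rV[R]_N -> R) (W : wave S n c u ut) (z s : R) (x : 'rV[R]_N) : 0 <= s ->
  prof n c u (z + s) x <= prof n c u z x.
Proof.
rewrite le_eqVlt => /orP[/eqP <-|s00]; first by rewrite addr0.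
have [Z Z1 hZ] := far_zone W.
have s20 : 0 < s / 2 by rewrite divr_gt0.
have [Y [eta [Y0 /andP[eta0 eta1] noper]]] := no_almost_period W s20.
have Z0 : 0 < Z + 1 by move: Z1; clear; lra.
have [sg sg0 ident] := identify W Z0 Y0 (introT andP (conj eta0 eta1)).
have l0 := lam_gt0 S; have Cb0 := Cb_ge0 S; have c0 := w_c0 W.
pose K := (Cb S + c + 1) / lam S.
have K0 : 0 < K by rewrite divr_gt0 //; move: Cb0 c0; clear; lra.
have hK : Cb S + c + 1 <= K * lam S by rewrite divfK // gt_eqF.
have [d d0 hd] := prof_unif W (divr_gt0 sg0 (ltr0n R 2)).
have /andP[th0 th1] := theta_itv S.
apply/ler_addgt0Pr => e' e'0.
pose del := Num.min (Num.min (e' / 2) (sg / 4)) (Num.min (theta S / 8) (1 / 16)).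
have del0 : 0 < del.
  by rewrite lt_min; apply/andP; split; rewrite lt_min !divr_gt0.
have [d1 d2 d3 d4] : [/\ del <= e' / 2, del <= sg / 4, del <= theta S / 8 & del <= 1 / 16].
  by rewrite /del; split; rewrite !ge_min lexx ?orbT.
pose r := Num.min (Num.min (s / 2) (sg / 4)) (theta S / 8).
have r0 : 0 < r by rewrite /r !lt_min !divr_gt0.
have [r1 r2 r3] : [/\ r <= s / 2, r <= sg / 4 & r <= theta S / 8].
  by rewrite /r; split; rewrite !ge_min lexx ?orbT.
pose e := Num.min 1 (d ^+ 2).
have e0 : 0 < e by rewrite lt_min ltr01 exprn_gt0.
have [e1 ed] : e <= 1 /\ e <= d ^+ 2 by rewrite /e; split; rewrite !ge_min lexx ?orbT.
have wt z0 : 1 <= weight K z0 <= 2 by apply: weight_itv; exact: ltW.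
have [] := contact W W (@weight_continuous _ K) wt (e := e) (del := del) _ _ r0.
- by rewrite e0.
- by rewrite del0.
move=> s' [y [y' [x' [mx gp fin]]]].
have [le|lt] := leP (s' + r) s.
  have := fin s z z x le; rewrite /gap subrr expr0n mul0r subr0.
  have /andP[_ g2] := wt z; have : del * weight K z <= del * 2 by rewrite ler_wpM2l // ltW.
  by move: d1; clear; lra.
exfalso; apply: (noper s'); first by move: lt r1; clear; lra.
move=> z1 x1 z1Y; rewrite -(prof_front_shift W).
have small : 2 * del + r <= theta S / 2 by move: d3 r3 th0; clear; lra.
have y'Z := self_contact_middle W hZ Z1 K0 hK (introT andP (conj e0 e1)) del0 small mx gp.
have /andP[gp0 gpr] := gp.
have [pz vw v1] := gap_pos W W wt e0 del0 gp0.
have zz : `|y - y'| <= d.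
  by apply: sqr_le_norm; [exact: ltW|exact: le_trans (ltW pz) ed].
have zz1 : `|y - y'| <= 1.
  by apply: sqr_le_norm => //; rewrite expr1n; exact: le_trans (ltW pz) e1.
apply: (ident _ _ _ _ (wave_front_shift W s') _ _ _ y x') z1Y.
- by rewrite subrr nrm0 ltW.
- by rewrite subrr normr0 ltW.
- move=> z2 x2; rewrite (prof_front_shift W).
  by have := gap_max wt del0 mx gpr z2 x2; move: d2 r2 sg0; clear; lra.
- move: y'Z zz1; rewrite !ler_norml; clear; lra.
- rewrite (prof_front_shift W); have := hd y y' x' zz; rewrite ler_norml.
  by move: vw del0 sg0; clear; lra.
Qed.

Lemma T1_reflect (R : realType) (F : R -> R) (p : R) : T1 F p -> T1 (fun s => F (- s)) (- p).
Proof.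
move=> h e e0; have [d d0 hd] := h e e0; exists d => // s sd.
have := hd (- s); rewrite normrN => /(_ sd); rewrite oppr0.
by rewrite (_ : p * - s = - p * s) //; ring.
Qed.

Lemma periodic_min (R : realType) (N : nat) (S : setting R N) (g : R -> 'rV[R]_N -> R) (B : R) :
  continuous (fun p : R * 'rV[R]_N => g p.1 p.2) ->
  (forall k z x, lattice (L S) k -> g z (x + k) = g z x) -> (forall z x, 0 < g z x) ->
  exists2 m : R, 0 < m & forall z x, `|z| <= B -> m <= g z x.
Proof.
move=> cg gper g0.
have [B0|B0] := ltP B 0.
  by exists 1 => // z x zB; have := le_lt_trans zB B0; rewrite normr_lt0.
have [Bc Bc0 hBc] := lattice_reduce S.
have cK : compact ([set z : R | - B <= z <= B] `*` @ball_nrm R N Bc).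
  by apply: compact_setX; [exact: itv_compact|exact: ball_nrm_compact].
have K0 : ([set z : R | - B <= z <= B] `*` @ball_nrm R N Bc) (0, 0 : 'rV[R]_N).
  by split=> /=; rewrite /ball_nrm /= ?nrm0 // oppr_le0 B0.
have [[z0 x0] _ mn] := min_on (ex_intro _ _ K0) cK cg.
exists (g z0 x0) => [|z x zB]; first exact: g0.
have [k hk xk] := hBc x; rewrite -(gper k z x hk).
by apply: (mn (z, x + k)); split => //=; rewrite -ler_norml.
Qed.

(** * Positivity of the time derivative *)

Section Increasing.
Context {R : realType} {N : nat} (S : setting R N).
Variables (n : 'rV[R]_N) (c : R) (u ut : R -> 'rV[R]_N -> R).
Hypothesis W : wave S n c u ut.

Lemma wave_increasing t s x : 0 <= s -> u t x <= u (t + s) x.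
Proof.
move=> s0; rewrite !(u_prof W).
have cs : 0 <= c * s by rewrite mulr_ge0 // ltW // (w_c0 W).
have := prof_decreasing W (dot x n - c * (t + s)) x cs.
by rewrite (_ : dot x n - c * (t + s) + c * s = dot x n - c * t) //; ring.
Qed.

Lemma quotient_spread h : 0 < h -> forall t x, exists dt p H,
  [/\ T1 (fun s => (u (t + s + h) x - u (t + s) x) / h) dt,
      forall xi, T2 (fun s => (u (t + h) (x + s *: xi) - u t (x + s *: xi)) / h) (dot p xi) (qf H xi) &
      mtr (a S x) H + dot (b S x) p - Kf S * ((u (t + h) x - u t x) / h) <= dt].
Proof.
move=> h0 t x; have [_ _ hT hS] := w_sol W.
have [p [H [TX eX]]] := hS t x; have [p' [H' [TX' eX']]] := hS (t + h) x.
exists (h^-1 * (ut (t + h) x - ut t x)), (h^-1 *: (p' - p)), (h^-1 *: (H' - H)); split.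
- have := T1Z h^-1 (T1B (hT (t + h) x) (hT t x)).
  by apply: T1_ext => s; rewrite mulrC (addrAC t h s).
- move=> xi; rewrite dotZl dotDl dotNl qfZm qfDm qfNm.
  by apply: T2_ext (T2Z h^-1 (T2B (TX' xi) (TX xi))) => s; rewrite mulrC.
rewrite mtrZr mtrDr mtrNr dotZr dotDr dotNr [_ / h]mulrC mulrCA -!mulrDr -mulrBr ler_pM2l ?invr_gt0 //.
have := wave_increasing t x (ltW h0) => inc.
have /andP[u1 u2] := w_01 W t x; have /andP[u3 u4] := w_01 W (t + h) x.
have := @f_lip _ _ S x (u (t + h) x) (u t x).
rewrite (ltW u1) (ltW u2) (ltW u3) (ltW u4) => /(_ isT isT).
rewrite (ger0_norm (_ : 0 <= u (t + h) x - u t x)) ?subr_ge0 // ler_norml eX eX'.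
lra.
Qed.

(** The wave rises from near 0 at [xs], so [ut] is positive at some earlier time; the barrier
    carries to [(ts, xs)] a lower bound on the quotients that does not depend on the step [h]. *)
Lemma ut_gt0 ts xs : 0 < ut ts xs.
Proof.
have [uc utc hT _] := w_sol W.
have [t0 t0s ut0] : exists2 t0, t0 < ts & 0 < ut t0 xs.
  have /andP[p0 _] := w_01 W (ts - 1) xs.
  have p2 : 0 < u (ts - 1) xs / 2 by rewrite divr_gt0.
  have [T hTT] := w_lim W (nrm xs) p2.
  pose t' := Num.min (- T) (ts - 2).
  have [t'1 t'2] : t' <= - T /\ t' <= ts - 2 by rewrite /t'; split; rewrite ge_min lexx ?orbT.
  have lo := (hTT t' xs (lexx _)).1 t'1.
  have mvh t : T1 (fun s => u (ts - 1 + (t + s)) xs) (ut (ts - 1 + t) xs).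
    by apply: T1_ext (hT (ts - 1 + t) xs) => s; rewrite addrA.
  have [c' [c1 c2 e]] := mean_value (g := fun t => u (ts - 1 + t) xs) mvh (t' - (ts - 1)).
  have tneg : t' - (ts - 1) < 0 by lra.
  have c'0 : c' <= 0.
    by rewrite leNgt; apply/negP => c'p; move: c2; rewrite leNgt nmulr_llt0 ?c'p.
  exists (ts - 1 + c'); first by lra.
  move: e; rewrite addr0 (addrC (ts - 1)) subrK => e.
  rewrite -(nmulr_llt0 _ tneg) -e; lra.
pose eta := ut t0 xs / 2; have eta0 : 0 < eta by rewrite divr_gt0.
have [d d0 hd] : exists2 d, 0 < d & forall t x, `|t - t0| < d -> `|x - xs| < d -> eta <= ut t x.
  have /cvgrPdist_le /(_ _ eta0) := utc (t0, xs).
  move=> /nbhs_ballP[d /= d0 hd]; exists d => // t x td xd.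
  have : ball (t0, xs) d (t, x).
    split; rewrite -ball_normE /ball_ /=; first by rewrite distrC.
    by rewrite distrC.
  move=> /hd /=; rewrite /eta ler_norml; lra.
pose T := ts - t0; have T0 : 0 < T by rewrite subr_gt0.
pose rho := d / 2; have rho0 : 0 < rho by rewrite divr_gt0.
have [kap kap0 spread] := positivity_spread S T0 (lexx 0) rho0 (Kf_ge0 S).
have ke : 0 < kap * eta by rewrite mulr_gt0.
apply: (lt_le_trans ke); rewrite -lerN2.
(* The quotients look forward in time; [T1_reflect] turns the backward test into a forward one. *)
apply: (@T1_left _ _ _ _ 0 d (T1_reflect (hT ts xs)) d0) => h /andP[h0 hd'].
rewrite mul0r oppr0 mulNr !opprK !addr0.
pose D t x := (u (t + h) x - u t x) / h.
have cD : continuous (fun p : R * 'rV[R]_N => D p.1 p.2).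
  apply: continuous_mulf; last exact: continuous_cstf.
  have f1 : continuous (fun p : R * 'rV[R]_N => p.1) by move=> p; exact: cvg_fst.
  have f2 : continuous (fun p : R * 'rV[R]_N => p.2) by move=> p; exact: cvg_snd.
  apply: continuous_subf => //; apply: continuous_curry => //.
  by apply: continuous_addf => //; exact: continuous_cstf.
have D0 t x : 0 <= D t x by rewrite divr_ge0 ?(ltW h0) // subr_ge0 wave_increasing // ltW.
have := spread D t0 ts xs xs eta cD eta0.
rewrite t0s /= [t0 + T]addrC subrK lexx subrr nrm0 mul0r lexx => /(_ isT isT).
move=> /(_ (fun t x _ _ => D0 t x)) concl.
suff : kap * eta <= D ts xs by rewrite /D ler_pdivlMr.
apply: concl => [x xr|t x _ _ _].
  have mvh t : T1 (fun s => u (t0 + (t + s)) x) (ut (t0 + t) x).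
    by apply: T1_ext (hT (t0 + t) x) => s; rewrite addrA.
  have [c' [c1 _]] := mean_value (g := fun t => u (t0 + t) x) mvh h.
  rewrite addr0 /D => ->; rewrite mulfK ?gt_eqF //; apply: hd.
    rewrite addrAC subrr add0r; apply: le_lt_trans hd'; by rewrite (gtr0_norm h0) in c1.
  apply: le_lt_trans (norm_le_nrm _) _; apply: le_lt_trans xr _; rewrite /rho; lra.
have [dt [p [H [h1 h2 h3]]]] := quotient_spread h0 t x.
exists dt, p, H; split=> //; move: h3 ke; rewrite /D; lra.
Qed.

Lemma ut_min (B : R) : exists2 m : R, 0 < m & forall z x, `|z| <= B -> m <= prof n c ut z x.
Proof.
by apply: (@periodic_min R N S (prof n c ut) B (proft_continuous W) (proft_per W)) => z x; exact: ut_gt0.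
Qed.

Lemma prof_min (B : R) : exists2 m : R, 0 < m & forall z x, `|z| <= B -> m <= prof n c u z x.
Proof.
by apply: (@periodic_min R N S (prof n c u) B (prof_continuous W) (prof_per W)) => z x; have /andP[] := prof_01 W z x.
Qed.

Lemma prof_drop (B : R) : exists2 m : R, 0 < m & forall (z s : R) x, `|z| <= B -> 0 <= s -> `|z + s| <= B ->
  m * s <= prof n c u z x - prof n c u (z + s) x.
Proof.
have [m m0 hm] := ut_min B; have c0 := w_c0 W.
exists (m / c) => [|z s x zB s0 zsB]; first by rewrite divr_gt0.
have [_ _ hT _] := w_sol W.
pose t1 := (dot x n - (z + s)) / c.
have mvh t : T1 (fun r => u (t1 + (t + r)) x) (ut (t1 + t) x).
  by apply: T1_ext (hT (t1 + t) x) => r; rewrite addrA.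
have sc : 0 <= s / c by rewrite divr_ge0 // ltW.
have [c' [c1 c2 e]] := mean_value (g := fun t => u (t1 + t) x) mvh (s / c).
have e1 : t1 + s / c = (dot x n - z) / c by rewrite /t1; field; rewrite gt_eqF.
move: e; rewrite addr0 e1 -/(prof n c u z x) -/(prof n c u (z + s) x) => ->.
rewrite (_ : m / c * s = m * (s / c)); last by ring.
rewrite ler_wpM2r //.
have := hm (z + s - c * c') x; rewrite /prof.
rewrite (_ : (dot x n - (z + s - c * c')) / c = t1 + c'); last by rewrite /t1; field; rewrite gt_eqF.
apply.
have [s00|sp] := eqVneq s 0.
  move: c1; rewrite s00 mul0r normr0 normr_le0 => /eqP ->.
  by rewrite mulr0 subr0 addr0.
have scp : 0 < s / c by rewrite divr_gt0 // lt_neqAle eq_sym sp.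
have c'0 : 0 <= c' by move: c2; rewrite pmulr_lge0.
have c'1 : c * c' <= s.
  by move: c1; rewrite (ger0_norm c'0) (ger0_norm sc) ler_pdivlMr // mulrC.
have cc' : 0 <= c * c' by rewrite mulr_ge0 // ltW.
move: zB zsB; rewrite !ler_norml; lra.
Qed.

End Increasing.

(** * Decay ahead of the front, uniform in the direction *)

Lemma qf_le_Ct (R : realType) (N : nat) (S : setting R N) (x xi : 'rV[R]_N) :
  qf (a S x) xi <= Ct S * dot xi xi.
Proof.
apply: (le_trans (psd_le_tr xi (a_psd S x))).
by rewrite ler_wpM2r ?dot_ge0 // a_tr.
Qed.

Lemma Ct_ge0 (R : realType) (N : nat) (S : setting R N) : 0 <= Ct S.
Proof. exact: le_trans (tr_ge0 S 0) (a_tr S 0). Qed.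

(** The left-hand side is what [touching] produces from the difference of directions, with
    [k = 1 / e] and [zz = z - z']. *)
Lemma mismatch_bound (R : realType) (N : nat) (S : setting R N) (x m : 'rV[R]_N) (k zz sg : R) :
  nrm m <= sg -> sg <= 1 -> 0 <= k -> `|zz| <= 1 ->
  2 * k * qf (a S x) m + 2 * k * zz * dot (b S x) m <= 2 * k * (Ct S + Cb S) * sg.
Proof.
move=> ms s1 k0 z1; have m0 := nrm_ge0 m; have Ct0 := Ct_ge0 S; have Cb0 := Cb_ge0 S.
have q1 : qf (a S x) m <= Ct S * sg.
  apply: (le_trans (qf_le_Ct _ _ _)); rewrite ler_wpM2l // -nrm_sqr expr2.
  apply: (@le_trans _ _ (sg * 1)); last by rewrite mulr1.
  by rewrite ler_pM //; exact: le_trans s1.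
have q2 : zz * dot (b S x) m <= Cb S * sg.
  apply: (le_trans (ler_norm _)); rewrite normrM -[leRHS]mul1r ler_pM //.
  by apply: (le_trans (cauchy_schwarz _ _)); rewrite ler_pM ?nrm_ge0 ?b_bnd.
have : 2 * k * (qf (a S x) m + zz * dot (b S x) m) <= 2 * k * (Ct S * sg + Cb S * sg).
  by rewrite ler_wpM2l ?mulr_ge0 // lerD.
by clear; lra.
Qed.

Lemma box_max (R : realType) (N : nat) (S : setting R N) (g : R -> R -> 'rV[R]_N -> R) (a1 b1 a2 b2 : R) :
  a1 <= b1 -> a2 <= b2 ->
  continuous (fun p : R * R * 'rV[R]_N => g p.1.1 p.1.2 p.2) ->
  (forall k z z' x, lattice (L S) k -> g z z' (x + k) = g z z' x) ->
  exists z z' x, [/\ a1 <= z <= b1, a2 <= z' <= b2 & forall y y' w, a1 <= y <= b1 ->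
    a2 <= y' <= b2 -> g y y' w <= g z z' x].
Proof.
move=> ab1 ab2 cg gper; have [Bc Bc0 hBc] := lattice_reduce S.
pose K : set (R * R * 'rV[R]_N) :=
  ([set z | a1 <= z <= b1] `*` [set z | a2 <= z <= b2]) `*` ball_nrm Bc.
have cK : compact K.
  by apply: compact_setX; [apply: compact_setX; exact: itv_compact|exact: ball_nrm_compact].
have K0 : K (a1, a2, 0 : 'rV[R]_N).
  by split; [split|] => /=; rewrite ?lexx ?ab1 ?ab2 // /ball_nrm /= nrm0.
have [[[z z'] x] [[/= h1 h2] _] mx] := max_on (ex_intro _ _ K0) cK cg.
exists z, z', x; split=> // y y' w hy hy'; have [k hk wk] := hBc w.
by rewrite -(gper k) //; apply: (mx (y, y', w + k)).
Qed.

(** Where [f] vanishes the equation is linear, so [b0 C] times a shifted wave of [n0], plus the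
    constant [A2] and a small weight, serves as barrier on [[0, 2 M]]. It dominates at both ends and
    exceeds [A2] at [M] by at most a fifth of [b0 = A0 - A2]. Only a lower bound on [c] is assumed,
    because the decay is later used to derive the upper one. *)
Lemma decay_step (R : realType) (N : nat) (S : setting R N) (n0 : 'rV[R]_N) (c0 : R)
    (u0 ut0 : R -> 'rV[R]_N -> R) (W0 : wave S n0 c0 u0 ut0) :
  exists M sg : R, [/\ 0 < M, 0 < sg & forall n c u ut, wave S n c u ut ->
    nrm (n - n0) <= sg -> c0 - sg <= c ->
    forall A0 A2 : R, (forall x, prof n c u 0 x <= A0) -> A0 <= theta S -> A2 < A0 -> 0 <= A2 ->
    (forall x, prof n c u (2 * M) x <= A2) ->
    forall x, prof n c u M x <= A2 + (A0 - A2) / 5].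
Proof.
have c00 := w_c0 W0; have l0 := lam_gt0 S; have Cb0 := Cb_ge0 S; have Ct0 := Ct_ge0 S.
have [Z Z1 hZ] := far_zone W0; have /andP[th0 th1] := theta_itv S.
have W := wave_front_shift W0 Z; set v := front_shift c0 Z u0 in W; set vt := front_shift c0 Z ut0 in W.
have vE z x : prof n0 c0 v z x = prof n0 c0 u0 (z + Z) x by exact: prof_front_shift W0 _ _ _.
have vth z x : - 1 <= z -> prof n0 c0 v z x <= theta S.
  move=> z1; rewrite vE; have zz : Z - 1 <= z + Z by move: z1; clear; lra.
  by have := (hZ (z + Z) x).1 zz; move: th0; clear; lra.
have [m1 m10 hm1] := prof_min W 1.
(* [C] times the shifted wave is at least 1 for [|z'| <= 1], which excludes a contact at [z = 0];
   [M] is chosen where this product has dropped to [1 / 10]. *)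
have [C C0 CE] : exists2 C : R, 0 < C & C = m1^-1 by exists m1^-1 => //; rewrite invr_gt0.
have C10 : 0 < 1 / (10 * C) by rewrite divr_gt0 // mulr_gt0.
have [Z' Z'0 hZ'] := prof_lim W C10.
have [M MZ] : exists M, M = Z' + 1 by exists (Z' + 1).
have M1 : 1 <= M by rewrite MZ; move: Z'0; clear; lra.
have M0 : 0 < M by move: M1; clear; lra.
have [mt mt0 hmt] := ut_min W (2 * M + 1).
have [K K0 hK] : exists2 K, 0 < K & Cb S + 2 * c0 + 1 = K * lam S.
  exists ((Cb S + 2 * c0 + 1) / lam S); last by rewrite divfK // gt_eqF.
  by rewrite divr_gt0 //; move: Cb0 c00; clear; lra.
(* [1 / 20] limits the weight to a tenth of [b0]; the last bound lets the term [eta K c] be absorbed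
   by the wave of [n0] when [c > 2 c0]. *)
have [eta [eta0 et1 et2]] : exists eta, [/\ 0 < eta, eta <= 1 / 20 & eta * (4 * c0 * K) <= C * mt].
  exists (Num.min (1 / 20) (C * mt / (4 * c0 * K))).
  rewrite -ler_pdivlMr ?mulr_gt0 //; split; last 2 first.
  - by rewrite ge_min lexx.
  - by rewrite ge_min lexx orbT.
  - by rewrite lt_min; apply/andP; split; [rewrite divr_gt0|rewrite divr_gt0 ?mulr_gt0].
have [Em Em0 EmE] : exists2 Em, 0 < Em & Em = expR (- (K * (2 * M + 2))).
  by exists (expR (- (K * (2 * M + 2)))) => //; exact: expR_gt0.
have [Q QE] : exists Q, Q = eta * K + 2 + 2 * (Ct S + Cb S) by eexists.
have eK : 0 < eta * K by rewrite mulr_gt0.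
have Q0 : 0 < Q by rewrite QE; move: eK Ct0 Cb0; clear; lra.
have [sg [sg0 [sg1 sg2 sg3 sg4]]] : exists sg, 0 < sg /\
   [/\ sg <= 1, sg <= c0 / 2, sg * (2 * Q) <= eta * (K * Em) & sg * (4 * Q) <= C * mt].
  exists (Num.min (Num.min 1 (c0 / 2)) (Num.min (eta * (K * Em) / (2 * Q)) (C * mt / (4 * Q)))).
  split.
    rewrite lt_min; apply/andP; split; rewrite lt_min ?ltr01; first by rewrite divr_gt0.
    by apply/andP; split; rewrite divr_gt0 ?mulr_gt0 // mulr_gt0.
  by rewrite -!ler_pdivlMr ?mulr_gt0 //; split; rewrite !ge_min lexx ?orbT.
exists M, sg; split=> // n c u ut Wn hn hc A0 A2 hA0 A0th A20 A2p hA2.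
pose b0 := A0 - A2; have b00 : 0 < b0 by rewrite subr_gt0.
pose Gam z' := A2 + b0 * eta * weight K (z' + 1).
have be0 : 0 < b0 * eta by rewrite mulr_gt0.
(* With this [e] all terms of the comparison scale with [b0], so [M] and [sg] do not depend on the
   levels [A0] and [A2]. *)
pose e := b0^-1; have e0 : 0 < e by rewrite invr_gt0.
have eE : e^-1 = b0 by rewrite invrK.
pose Phi z z' x := prof n c u z x - b0 * C * prof n0 c0 v z' x - Gam z' - (z - z') ^+ 2 / e.
have bC0 : 0 < b0 * C by rewrite mulr_gt0.
have wt z0 : 1 <= weight K z0 <= 2 by apply: weight_itv; exact: ltW.
have Gam_bd z' : A2 < Gam z' <= A2 + b0 * eta * 2.
  have /andP[w1 w2] := wt (z' + 1); apply/andP; split; last by rewrite lerD2l ler_pM2l.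
  rewrite ltrDl mulr_gt0 //; exact: lt_le_trans ltr01 w1.
have pen0 z z' : 0 <= (z - z') ^+ 2 / e by rewrite divr_ge0 ?sqr_ge0 // ltW.
have cPhi : continuous (fun p : R * R * 'rV[R]_N => Phi p.1.1 p.1.2 p.2).
  have [k1 k2 k3] := @continuous_prod3 R R 'rV[R]_N.
  have kd : continuous (fun p : R * R * 'rV[R]_N => p.1.1 - p.1.2) by exact: continuous_subf.
  apply: continuous_subf; last first.
    apply: continuous_mulf; last exact: continuous_cstf.
    exact: (continuous_compf (@exprn_continuous _ 2) kd).
  apply: continuous_subf.
    apply: continuous_subf.
      by apply: continuous_curry k3 => //; exact: (prof_continuous Wn).
    apply: continuous_mulf; first exact: continuous_cstf.
    by apply: continuous_curry k3 => //; exact: (prof_continuous W).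
  apply: continuous_addf; first exact: continuous_cstf.
  apply: continuous_mulf; first exact: continuous_cstf.
  have kp : continuous (fun p : R * R * 'rV[R]_N => p.1.2 + 1).
    by apply: continuous_addf => //; exact: continuous_cstf.
  exact: (continuous_compf (@weight_continuous _ K) kp).
have gper k z z' x : lattice (L S) k -> Phi z z' (x + k) = Phi z z' x.
  by move=> hk; rewrite /Phi (prof_per Wn) // (prof_per W).
have M2 : 0 <= 2 * M by rewrite mulr_ge0 // ltW.
have M3 : - 1 <= 2 * M + 1 by move: M2; clear; lra.
have [z [z' [x [hz hz' mx]]]] := @box_max _ _ S Phi _ _ _ _ M2 M3 cPhi gper.
suff Pneg : Phi z z' x <= 0.
  move=> y; have MM : 0 <= M <= 2 * M by move: M0; clear; lra.
  have MM' : - 1 <= M <= 2 * M + 1 by move: M0; clear; lra.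
  have := le_trans (mx M M y MM MM') Pneg; rewrite /Phi subrr expr0n mul0r subr0.
  have /andP[_ g2] := Gam_bd M.
  have Mz : Z' <= M by rewrite MZ; clear; lra.
  have := (hZ' M y).1 Mz; rewrite -(ler_pM2l bC0).
  rewrite (_ : b0 * C * (1 / (10 * C)) = b0 / 10); last by field; rewrite gt_eqF.
  have : b0 * eta <= b0 * (1 / 20) by rewrite ler_pM2l.
  by move: g2; rewrite -/b0; clear; lra.
rewrite leNgt; apply/negP => Ppos.
have /andP[z_ge z_le] := hz; have /andP[z'_ge z'_le] := hz'.
have /andP[v0 v1] := prof_01 W z' x; have /andP[w0 w1] := prof_01 Wn z x.
have uA0 : prof n c u z x <= A0.
  by apply: le_trans (hA0 x); have := prof_decreasing Wn 0 x z_ge; rewrite add0r.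
have /andP[G1 G2] := Gam_bd z'.
have bCv : 0 < b0 * C * prof n0 c0 v z' x by rewrite mulr_gt0.
have zz : `|z - z'| < 1.
  have : (z - z') ^+ 2 / e < b0 by move: Ppos; rewrite /Phi; move: uA0 G1 bCv; rewrite /b0; clear; lra.
  rewrite eE mulrC -[ltRHS]mulr1 ltr_pM2l // => h.
  by rewrite -ltr_sqr ?nnegrE ?normr_ge0 // real_normK ?num_real // expr1n.
move: (zz); rewrite ltr_norml => /andP[zz1 zz2].
have zpos : 0 < z.
  rewrite lt_neqAle z_ge andbT; apply/eqP => zE.
  have z'1 : z' <= 1 by move: zz1; rewrite -zE; clear; lra.
  have bC1 : b0 <= b0 * C * prof n0 c0 v z' x.
    rewrite -mulrA ler_peMr ?(ltW b00) // CE mulrC ler_pdivlMr // mul1r.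
    by apply: hm1; rewrite ler_norml z'1 z'_ge.
  by move: Ppos (pen0 z z') uA0 G1 bC1; rewrite /Phi /b0; clear; lra.
have zlt : z < 2 * M.
  rewrite lt_neqAle z_le andbT; apply/eqP => zE.
  by have := hA2 x; rewrite -zE; move: Ppos (pen0 z z') G1 bCv; rewrite /Phi; clear; lra.
have z'1 : - 1 < z' by move: zz2 zpos; clear; lra.
have z'2 : z' < 2 * M + 1 by move: zz1 zlt; clear; lra.
pose d := Num.min (Num.min z (2 * M - z)) (Num.min (z' + 1) (2 * M + 1 - z')).
have d0 : 0 < d.
  rewrite lt_min; apply/andP; split; rewrite lt_min; apply/andP; split=> //.
  - by rewrite subr_gt0.
  - by move: z'1; clear; lra.
  - by rewrite subr_gt0.
have [d1 d2 d3 d4] : [/\ d <= z, d <= 2 * M - z, d <= z' + 1 & d <= 2 * M + 1 - z'].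
  by rewrite /d; split; rewrite !ge_min lexx ?orbT.
have z'p : z' + 1 != 0 by rewrite gt_eqF //; move: z'1; clear; lra.
have z'p0 : 0 < z' + 1 by move: z'1; clear; lra.
have TG : T2 (fun s => Gam (z' + s)) (b0 * eta * (K * Num.sg (z' + 1) * expR (- (K * `|z' + 1|))))
    (b0 * eta * - (K ^+ 2 * expR (- (K * `|z' + 1|)))).
  have := T2D (T2_quad A2 0 0) (T2Z (b0 * eta) (T2_weight K z'p)).
  rewrite !add0r; apply: T2_ext => s; by rewrite /Gam !mul0r !addr0 (addrAC z' 1 s).
have [|I1 I2 I3] := touching Wn W (ltW bC0) e0 d0 TG (x := x) (z := z).
  move=> y1 y2 y; rewrite !ltr_norml => /andP[a1 a2] /andP[a3 a4]; apply: mx.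
    by apply/andP; split; [move: a1 d1|move: a2 d2]; clear; lra.
  by apply/andP; split; [move: a3 d3|move: a4 d4]; clear; lra.
have f1 : f S x (prof n c u z x) = 0 by rewrite f_0 // (ltW w0); exact: le_trans A0th.
have f2 : f S x (prof n0 c0 v z' x) = 0 by rewrite f_0 // (ltW v0) vth.
move: I1 I3; rewrite f1 f2 eE gtr0_sg // (gtr0_norm z'p0) mulr1 !subr0 => {I2} I1 I3.
have := @weight_strict _ _ S n0 x (2 * c0) K (z' + 1) (w_n1 W).
rewrite gtr0_sg // (gtr0_norm z'p0) mulr1 mulr_ge0 ?(ltW c00) // hK => /(_ isT K0 (lexx _) z'p) strict.
set V := prof n0 c0 vt z' x in I1 I3.
have Vmt : mt <= V by apply: hmt; rewrite ler_norml; move: z'_ge z'_le M0; clear; lra.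
set E := expR _ in I1 I3 strict.
have E1 : E <= 1 by rewrite -expR0 ler_expR oppr_le0 mulr_ge0 // ltW.
have EEm : Em <= E.
  rewrite EmE ler_expR lerN2 ler_wpM2l ?(ltW K0) //; move: z'_le; clear; lra.
have zz' : `|z - z'| <= 1 by exact: ltW.
have mm := mismatch_bound S x hn sg1 (ltW b00) zz'.
have strict2 : b0 * eta * (- (K ^+ 2 * E) * qf (a S x) n0 + K * E * (dot (b S x) n0 + 2 * c0)) <=
   b0 * eta * (- (K * E)) by rewrite ler_pM2l.
have main : (c / c0 - 1) * (C * V) <= eta * K * E * (c - 2 * c0 - 1) + 2 * (Ct S + Cb S) * sg.
  rewrite -(ler_pM2l b00); move: I3 mm strict2.
  by set q1 := qf _ _; set q2 := qf _ _; clear; lra.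
have CV : C * V = c0 * (eta * K * E - 2 * (z - z')).
  apply: (mulfI (lt0r_neq0 b00)); rewrite mulrA I1; clear; ring.
have c_0 := w_c0 Wn.
have eKE : eta * K * E <= eta * K by rewrite -[leRHS]mulr1 ler_pM2l.
have eKEm : eta * K * Em <= eta * K * E by rewrite ler_pM2l.
(* If [c <= 2 c0], the weight is strict and [c / c0 - 1 >= - sg / c0] costs little. If [c > 2 c0],
   the faster speed makes the wave of [n0] itself a strict barrier, with a margin proportional to
   [c]. *)
have [c2|c2] := leP c (2 * c0).
  have low : - (sg * (eta * K + 2)) <= (c / c0 - 1) * (C * V).
    have CVle : C * V <= c0 * (eta * K + 2).
      rewrite CV ler_pM2l //; move: zz1 eKE; clear; lra.
    have CV0 : 0 <= C * V by rewrite mulr_ge0 ?(ltW C0) //; move: Vmt mt0; clear; lra.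
    have cc : - (sg / c0) <= c / c0 - 1.
      rewrite -(ler_pM2l c00) mulrN mulrBr !(mulrCA c0) divff ?gt_eqF // !mulr1.
      by move: hc; clear; lra.
    have h1 : - (sg / c0) * (C * V) <= (c / c0 - 1) * (C * V) by rewrite ler_wpM2r.
    have h2 : sg / c0 * (C * V) <= sg / c0 * (c0 * (eta * K + 2)).
      by rewrite ler_pM2l // divr_gt0.
    have h3 : sg / c0 * (c0 * (eta * K + 2)) = sg * (eta * K + 2) by rewrite mulrA divfK ?gt_eqF.
    by move: h1 h2; rewrite h3 mulNr; clear; lra.
  have neg : eta * K * E * (c - 2 * c0 - 1) <= eta * K * E * (- 1).
    by rewrite ler_wpM2l ?mulr_ge0 ?expR_ge0 // ?(ltW eta0) ?(ltW K0) //; move: c2; clear; lra.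
  have pos : 0 < eta * K * Em by rewrite !mulr_gt0.
  by move: low neg main sg3 eKEm pos; rewrite QE; clear; lra.
have CVm : C * mt <= C * V by rewrite ler_pM2l.
have cc : c / (2 * c0) <= c / c0 - 1.
  have -> : c / c0 - 1 = c / (2 * c0) + (c - 2 * c0) / (2 * c0) by field; rewrite gt_eqF.
  by rewrite lerDl divr_ge0 ?subr_ge0 ?mulr_ge0 // ltW.
have c20 : 1 <= c / (2 * c0) by rewrite ler_pdivlMr ?mulr_gt0 // mul1r ltW.
have Cmt : 0 < C * mt by rewrite mulr_gt0.
have h1 : c / (2 * c0) * (C * mt) <= (c / c0 - 1) * (C * V).
  by rewrite ler_pM // ?(ltW Cmt) //; exact: le_trans ler01 c20.
have h2 : eta * K * E * (c - 2 * c0 - 1) <= eta * K * c.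
  apply: (@le_trans _ _ (eta * K * E * c)).
    rewrite ler_wpM2l ?mulr_ge0 ?expR_ge0 // ?(ltW eta0) ?(ltW K0) //; move: c00; clear; lra.
  by rewrite ler_pM2r.
have h3 : eta * K * c <= c / (2 * c0) * (C * mt) / 2.
  have -> : eta * K * c = c / (2 * c0) * (eta * (4 * c0 * K)) / 2 by field; rewrite gt_eqF.
  by rewrite ler_pM2r ?invr_gt0 // ler_pM2l // divr_gt0 // mulr_gt0.
have h4 : C * mt <= c / (2 * c0) * (C * mt) by rewrite ler_peMl // ltW.
have h5 : 2 * (Ct S + Cb S) * sg <= sg * Q.
  rewrite mulrC ler_pM2l // QE; move: eK; clear; lra.
by move: main h1 h2 h3 h4 h5 sg4 Cmt; clear; lra.
Qed.

(** Let [A j] be the maximum of the profile at [z + j M]. [decay_step] says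
    [4 (A j.+1 - A j.+2) <= A j - A j.+1]; the sum telescopes, and [A j -> 0] leaves
    [4 A 1 <= A 0]. *)
Lemma decay (R : realType) (N : nat) (S : setting R N) (n0 : 'rV[R]_N) (c0 : R)
    (u0 ut0 : R -> 'rV[R]_N -> R) (W0 : wave S n0 c0 u0 ut0) :
  exists M sg : R, [/\ 0 < M, 0 < sg & forall n c u ut, wave S n c u ut ->
    nrm (n - n0) <= sg -> c0 - sg <= c ->
    forall z B : R, (forall x, prof n c u z x <= B) -> B <= theta S ->
    forall x, 4 * prof n c u (z + M) x <= B].
Proof.
have [M [sg [M0 sg0 step]]] := decay_step W0.
exists M, sg; split=> // n c u ut W hn hc z B hB Bth x.
have max_at y : exists w, forall x, prof n c u y x <= prof n c u y w.
  have c3 : continuous (fun p : R * R * 'rV[R]_N => prof n c u p.1.1 p.2).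
    have [k1 k2 k3] := @continuous_prod3 R R 'rV[R]_N.
    by apply: continuous_curry k3 => //; exact: (prof_continuous W).
  have [|y1 [y2 [w [/andP[h1 h2] _ h]]]] := @box_max _ _ S (fun y _ => prof n c u y) y y 0 0 (lexx _) (lexx _) c3.
    by move=> k y1 _ x1; exact: (prof_per W).
  exists w => x1; have -> : y = y1 by apply/eqP; rewrite eq_le h1 h2.
  by apply: (h y1 0); rewrite ?lexx // h1 h2.
pose pt j := sval (cid (max_at (z + j%:R * M))).
pose A (j : nat) := prof n c u (z + j%:R * M) (pt j).
have hA j y : prof n c u (z + j%:R * M) y <= A j by exact: (svalP (cid (max_at _))).
have dec j : A j.+1 <= A j.
  rewrite /A -natr1 mulrDl mul1r addrA.
  by apply: le_trans (prof_decreasing W _ _ (ltW M0)) (hA j _).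
have A0 : A 0%N <= B by rewrite /A mul0r addr0.
have Ath j : A j <= theta S.
  by elim: j => [|j IH]; [exact: le_trans A0 Bth|exact: le_trans (dec j) IH].
have st j : 5 * A j.+1 <= 4 * A j.+2 + A j.
  have [lt|ge] := ltP (A j.+2) (A j); last by have := dec j; have := dec j.+1; move: ge; clear; lra.
  have shE y w : prof n c (front_shift c (z + j%:R * M) u) y w = prof n c u (y + (z + j%:R * M)) w.
    exact: (prof_front_shift W).
  have := step _ _ _ _ (wave_front_shift W (z + j%:R * M)) hn hc (A j) (A j.+2) _ (Ath j) lt _ _ (pt j.+1).
  rewrite shE (_ : M + (z + j%:R * M) = z + j.+1%:R * M); last by rewrite -natr1; ring.
  move=> h; suff : A j.+1 <= A j.+2 + (A j - A j.+2) / 5 by clear; lra.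
  apply: h => [w||w]; rewrite ?shE ?add0r //.
    by have /andP[/ltW] := prof_01 W (z + j.+2%:R * M) (pt j.+2).
  rewrite (_ : 2 * M + (z + j%:R * M) = z + j.+2%:R * M) //.
  by rewrite -[j.+2%:R]natr1 -[j.+1%:R]natr1; ring.
have tele j : 4 * A 1%N <= A 0%N - A j + 4 * A j.+1.
  elim: j => [|j IH]; first by clear; lra.
  by have := st j; move: IH; clear; lra.
have : 4 * A 1%N <= A 0%N.
  apply/ler_addgt0Pr => e e0.
  have [Y Y0 hY] := prof_lim W (divr_gt0 e0 (ltr0n R 4)).
  pose j := Num.bound ((`|Y| + `|z|) / M).
  have jM : `|Y| + `|z| < j%:R * M.
    by rewrite -ltr_pdivrMr // archi_boundP // divr_ge0 ?addr_ge0 // ltW.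
  have far : Y <= z + j.+1%:R * M.
    rewrite -natr1; have := ler_norm Y; have := ler_norm (- z); rewrite normrN.
    by move: jM M0; clear; lra.
  have := (hY _ (pt j.+1)).1 far; rewrite -/(A j.+1).
  have := tele j; have /andP[/ltW Aj _] := prof_01 W (z + j%:R * M) (pt j).
  by move: Aj; rewrite -/(A j); clear; lra.
by have := hA 1%N x; rewrite mul1r; move: A0; clear; lra.
Qed.

(* At a level where the reaction is somewhere positive, [u] cannot stay nearly
   constant: compare it with [phi/2 (t - tb) - A |x - xs|^2]. *)
Lemma no_constant_state (R : realType) (N : nat) (S : setting R N) (xs : 'rV[R]_N) (del : R) :
  0 < del < 1 -> 0 < f S xs (1 - del) ->
  exists rad eta : R, [/\ 0 < rad, 0 < eta & forall n c u ut, wave S n c u ut ->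
    forall tb, ~ (forall t x, tb <= t <= tb + 1 -> nrm (x - xs) <= rad ->
      1 - del - eta <= u t x <= 1 - del + eta)].
Proof.
move=> /andP[del0 del1] f0; have Ct0 := Ct_ge0 S; have Cb0 := Cb_ge0 S; have Kf0 := Kf_ge0 S.
have d01 : 0 <= 1 - del <= 1 by move: del0 del1; clear; lra.
(* Of the [3 phi], one is lost to the continuity of [f] in [x] and one to the distance of [u] from
   [1 - del]; the last one drives the growth. *)
have [phi phi0 fE] : exists2 phi, 0 < phi & f S xs (1 - del) = 3 * phi.
  by exists (f S xs (1 - del) / 3); [rewrite divr_gt0|field].
have [r r0 hr] := continuousE (@f_cont R N S (1 - del) d01 xs) phi0.
have [rad [rad0 radr rad1]] : exists rad, [/\ 0 < rad, rad < r & rad <= 1].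
  exists (Num.min 1 (r / 2)); split; first by rewrite lt_min ltr01 divr_gt0.
    by apply: (@le_lt_trans _ _ (r / 2)); [rewrite ge_min lexx orbT|move: r0; clear; lra].
  by rewrite ge_min lexx.
have [A A0 hA] : exists2 A, 0 < A & 2 * A * (Ct S + Cb S) < phi / 2.
  have Q0 : 0 < 8 * (Ct S + Cb S + 1) by rewrite mulr_gt0 //; move: Ct0 Cb0; clear; lra.
  exists (phi / (8 * (Ct S + Cb S + 1))); first by rewrite divr_gt0.
  rewrite mulrA mulrAC ltr_pdivrMr //.
  have : 0 <= phi * (Ct S + Cb S) by rewrite mulr_ge0 ?addr_ge0 // ltW.
  by move: phi0; clear; lra.
have rr0 : 0 < A * rad ^+ 2 by rewrite mulr_gt0 // exprn_gt0.
(* The first two bounds keep the minimum of [g] off the initial time and off the lateral boundary;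
   the third ensures [phi <= f x u]. *)
pose eta := Num.min (Num.min (phi / 8) (A * rad ^+ 2 / 4)) (Num.min (phi / (Kf S + 1)) (Num.min del (1 - del))).
have Kf1 : 0 < Kf S + 1 by move: Kf0; clear; lra.
have eta0 : 0 < eta.
  rewrite lt_min; apply/andP; split; first by rewrite lt_min !divr_gt0.
  by rewrite lt_min divr_gt0 //= lt_min del0 subr_gt0.
have [e1 e2 e3] : [/\ eta <= phi / 8, eta <= A * rad ^+ 2 / 4 & eta * (Kf S + 1) <= phi].
  by rewrite -ler_pdivlMr // /eta; split; rewrite !ge_min lexx ?orbT.
exists rad, eta; split=> // n c u ut W tb H.
have [uc _ hT hS] := w_sol W.
pose g (p : R * 'rV[R]_N) := u p.1 p.2 + A * dot (p.2 - xs) (p.2 - xs) - phi / 2 * (p.1 - tb).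
have cg : continuous g.
  have k1 : continuous (fun p : R * 'rV[R]_N => p.1) by move=> p; exact: cvg_fst.
  have k2 : continuous (fun p : R * 'rV[R]_N => p.2) by move=> p; exact: cvg_snd.
  have k3 : continuous (fun p : R * 'rV[R]_N => p.2 - xs).
    by apply: continuous_subv => // p; exact: cst_continuous.
  apply: continuous_subf.
    apply: continuous_addf => //.
    by apply: continuous_mulf; [exact: continuous_cstf|exact: dot_continuous].
  apply: continuous_mulf; first exact: continuous_cstf.
  by apply: continuous_subf => //; exact: continuous_cstf.
pose K : set (R * 'rV[R]_N) := [set t | tb <= t <= tb + 1] `*` [set x | nrm (x - xs) <= rad].
have cK : compact K.
  apply: compact_setX; first exact: itv_compact.
  have -> : [set x | nrm (x - xs) <= rad] = ball_nrm (nrm xs + rad) `&` [set x | nrm (x - xs) <= rad].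
    apply/seteqP; split=> x /=; last by case.
    move=> xr; split=> //; rewrite /ball_nrm /= -(subrK xs x).
    by apply: (le_trans (nrmD _ _)); rewrite addrC lerD2l.
  apply: compact_closedI; first exact: ball_nrm_compact.
  apply: closed_le; last exact: continuous_cstf.
  apply: (continuous_compf (k := @nrm R N)); first exact: nrm_continuous.
  by apply: continuous_subv => x; [exact: cvg_id|exact: cst_continuous].
have K1 : K (tb + 1, xs).
  by split=> /=; rewrite ?subrr ?nrm0 ?(ltW rad0) // lexx andbT; clear; lra.
have [[t x] [/= ht hx] mn] := min_on (ex_intro _ _ K1) cK cg.
have /andP[t1 t2] := ht.
have end_ := mn _ K1; rewrite /g /= subrr dot0l mulr0 addr0 in end_.
have tb1 : tb <= tb + 1 <= tb + 1 by rewrite lexx andbT; clear; lra.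
have xs0 : nrm (xs - xs) <= rad by rewrite subrr nrm0 ltW.
have /andP[_ ue] := H (tb + 1) xs tb1 xs0.
have /andP[u1 u2] := H t x ht hx.
have dd := dot_ge0 (x - xs).
have Add : 0 <= A * dot (x - xs) (x - xs) by rewrite mulr_ge0 // ltW.
have gle : u t x + A * dot (x - xs) (x - xs) - phi / 2 * (t - tb) <= 1 - del + eta - phi / 2.
  by move: end_ ue; rewrite (_ : tb + 1 - tb = 1); [clear; lra|ring].
have pt : phi / 2 * (t - tb) <= phi / 2 * 1 by rewrite ler_pM2l ?divr_gt0 //; move: t2; clear; lra.
have tlt : tb < t.
  rewrite lt_neqAle t1 andbT; apply/eqP => tE; move: gle; rewrite tE subrr mulr0.
  by move: Add u1 e1 phi0; clear; lra.
have xlt : nrm (x - xs) < rad.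
  rewrite lt_neqAle hx andbT; apply/eqP => xE; move: gle; rewrite -nrm_sqr xE.
  by move: pt u1 e2 rr0; clear; lra.
have [p [H2 [TX eX]]] := hS t x.
have ut_le : ut t x <= phi / 2.
  have d0 : 0 < t - tb by rewrite subr_gt0.
  apply: (@T1_left _ _ _ _ 0 _ (hT t x) d0) => s /andP[s0 s1].
  have Ks : K (t - s, x) by split=> //=; move: s0 s1 t2; clear; lra.
  by have := mn _ Ks; rewrite /g /= addr0; clear; lra.
have TB v : - dot p v = 2 * A * dot (x - xs) v /\ - qf H2 v <= 2 * A * dot v v.
  have nv : 0 < nrm v + 1 by rewrite ltr_wpDl ?nrm_ge0.
  have d0 : 0 < (rad - nrm (x - xs)) / (nrm v + 1) by rewrite divr_gt0 // subr_gt0.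
  apply: (T2_touch (T2N (TX v)) (T2_quad 0 (2 * A * dot (x - xs) v) (2 * A * dot v v)) d0) => s.
  rewrite ltr_pdivlMr // => sd; rewrite scale0r addr0.
  have Ks : K (t, x + s *: v).
    split=> //=; rewrite (_ : x + s *: v - xs = (x - xs) + s *: v); last by rewrite addrAC.
    apply: (le_trans (nrmD _ _)); rewrite nrmZ; move: sd (normr_ge0 s); clear; lra.
  have sq (y : 'rV[R]_N) : dot (y + s *: v) (y + s *: v) = dot y y + 2 * s * dot y v + s ^+ 2 * dot v v.
    by rewrite !(dotDl, dotDr, dotZl, dotZr) (dotC v y); ring.
  have := mn _ Ks; rewrite /g /= (addrAC x (s *: v)) sq.
  by clear; lra.
have LH : - (2 * A * Ct S) <= mtr (a S x) H2.
  have := psd_mtr_mono (P := - (2 * A) *: 1%:M) (Q := H2) (a_psd S x).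
  rewrite mtrZr mtr1 => h; apply: le_trans (h _) => [|v].
    by rewrite mulNr lerN2 ler_wpM2l ?a_tr // mulr_ge0 // ltW.
  by rewrite qfZm qf1; have [_] := TB v; clear; lra.
have LB : - (2 * A * Cb S) <= dot (b S x) p.
  have pE : p = - (2 * A) *: (x - xs).
    apply/rowP => i; have [+ _] := TB (basis_vec i).
    by rewrite !(dotC _ (basis_vec i)) !dot_basis => /eqP; rewrite eqr_oppLR => /eqP ->; rewrite !mxE; ring.
  rewrite pE dotZr mulNr lerN2 ler_wpM2l ?mulr_ge0 ?(ltW A0) //.
  apply: (le_trans (dot_le_nrm _ _)); rewrite -[leRHS]mulr1 ler_pM ?nrm_ge0 ?b_bnd //.
  exact: le_trans rad1.
have fl : phi <= f S x (u t x).
  have xr : `|x - xs| < r by apply: le_lt_trans (norm_le_nrm _) (le_lt_trans hx radr).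
  have := hr x xr; rewrite fE ler_norml => /andP[h1 _].
  have /andP[v1 v2] := w_01 W t x.
  have := @f_lip _ _ S x (u t x) (1 - del); rewrite (ltW v1) (ltW v2) d01 => /(_ isT isT).
  have ud : `|u t x - (1 - del)| <= eta by rewrite ler_norml; move: u1 u2; clear; lra.
  have := ler_wpM2l Kf0 ud; rewrite ler_norml; move: h1 e3 eta0; clear; lra.
by move: eX ut_le LH LB fl hA; clear; lra.
Qed.

(** If [u] exceeded [1 - del + eta] near [xs] at a time in [[t1 - 2, t1 - 1]], the excess over the
    floor [1 - del - sp] would spread to [(t1, x1)], where there is almost none; so [u] is nearly
    constant there for a unit of time, against [no_constant_state]. Above the floor [f] is
    nonnegative, being nonincreasing in [u] and 0 at 1. *)
Lemma plateau (R : realType) (N : nat) (S : setting R N) (del cbar : R) :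
  0 < del -> theta S < 1 - del -> del < rho S -> 0 < cbar ->
  exists sp Y : R, [/\ 0 < sp, 0 < Y & forall n c u ut, wave S n c u ut -> c <= cbar ->
    forall z1 x1, (forall z y, z <= z1 + Y -> 1 - del - sp <= prof n c u z y) ->
    prof n c u z1 x1 <= 1 - del + sp -> False].
Proof.
move=> del0 delth delrho cbar0; have /andP[th0 th1] := theta_itv S.
have d1 : 1 - del < 1 by move: del0; clear; lra.
have [xs fpos] := f_pos (introT andP (conj delth d1)).
have d01 : 0 < del < 1 by rewrite del0; move: delth th0; clear; lra.
have [rad [eta [rad0 eta0 nocst]]] := no_constant_state d01 fpos.
have [Lam Lam0 hLam] := wave_lipschitz S.
have [Bc Bc0 hBc] := lattice_reduce S.
pose V := Bc + nrm xs + rad.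
have V0 : 0 <= V by rewrite /V !addr_ge0 ?nrm_ge0 // ltW.
pose rho1 := eta / (2 * Lam); have rho10 : 0 < rho1 by rewrite divr_gt0 // mulr_gt0.
have [kap kap0 spread] := positivity_spread S (ltr0n R 2) V0 rho10 (lexx 0).
have ke0 : 0 < kap * (eta / 2) by rewrite mulr_gt0 // divr_gt0.
have [sp [sp0 sp1 sp2 sp3]] : exists sp, [/\ 0 < sp, sp <= eta, sp <= (rho S - del) / 2 & sp <= kap * (eta / 2) / 4].
  exists (Num.min eta (Num.min ((rho S - del) / 2) (kap * (eta / 2) / 4))).
  split; [|by rewrite !ge_min lexx ?orbT..].
  by rewrite !lt_min eta0 !divr_gt0 // subr_gt0.
(* [Y] covers the front variables met below: the reach [V * 2 + rho1 + V] in space, and [2 * cbar]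
   for two units of time. *)
pose Y := V * 2 + rho1 + V + 2 * cbar + 1.
have Y0 : 0 < Y by rewrite /Y; move: V0 rho10 cbar0; clear; lra.
exists sp, Y; split=> // n c u ut W cc z1 x1.
wlog x1B : x1 / nrm x1 <= Bc => [hw Uge|].
  have [k hk xk] := hBc x1; rewrite -(prof_per W z1 x1 hk); exact: hw.
move=> Uge Ule; have c0 := w_c0 W.
pose t1 := (dot x1 n - z1) / c.
have z1E : dot x1 n - c * t1 = z1 by rewrite /t1 mulrC divfK ?gt_eqF //; clear; ring.
have ulow t y : t1 - 2 <= t <= t1 -> nrm (y - x1) <= V * 2 + rho1 + V -> 1 - del - sp <= u t y.
  move=> /andP[ht1 ht2] hy; rewrite (u_prof W); apply: Uge.
  have : dot (y - x1) n <= V * 2 + rho1 + V.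
    by apply: (le_trans (dot_le_nrm _ _)); rewrite (nrm_unit (w_n1 W)) mulr1.
  have : c * (t1 - t) <= cbar * 2.
    by rewrite ler_pM ?(ltW c0) //; [move: ht2|move: ht1]; clear; lra.
  by rewrite dotDl dotNl -z1E /Y; clear; lra.
have x1xs y : nrm (y - xs) <= rad -> nrm (y - x1) <= V.
  move=> hy; have -> : y - x1 = (y - xs) + (xs - x1) by rewrite addrA subrK.
  apply: (le_trans (nrmD _ _)); have := nrmD xs (- x1); rewrite nrmN.
  by rewrite /V; move: hy x1B; clear; lra.
have VV : V <= V * 2 + rho1 + V by move: V0 rho10; clear; lra.
apply: (nocst n c u ut W (t1 - 2)) => t0 x0 /andP[ht1 ht2] hx0.
have x01 := x1xs _ hx0.
have t02 : t0 <= t1 - 1 by move: ht2; clear; lra.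
apply/andP; split.
  have := ulow t0 x0; rewrite ht1 (_ : t0 <= t1) ?(le_trans x01 VV); last by move: t02; clear; lra.
  by move=> /(_ isT isT); move: sp1; clear; lra.
rewrite leNgt; apply/negP => big.
pose D t y := u t y - (1 - del) + sp.
have cD : continuous (fun p : R * 'rV[R]_N => D p.1 p.2).
  have [h1 _ _ _] := w_sol W.
  apply: continuous_addf; last exact: continuous_cstf.
  by apply: continuous_subf => //; exact: continuous_cstf.
have near_low t y : t0 <= t <= t1 -> nrm (y - x0) <= V * 2 + rho1 -> 1 - del - sp <= u t y.
  move=> /andP[h1 h2] hy; apply: ulow.
    by rewrite h2 andbT; exact: le_trans h1.
  have -> : y - x1 = (y - x0) + (x0 - x1) by rewrite addrA subrK.
  by apply: (le_trans (nrmD _ _)); rewrite lerD.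
have eta20 : 0 < eta / 2 by rewrite divr_gt0.
have := spread D t0 t1 x0 x1 _ cD eta20.
have -> : t0 < t1 <= t0 + 2 by move: t02 ht1; clear; lra.
have -> : nrm (x1 - x0) <= V * (t1 - t0).
  rewrite -nrmN opprB; apply: le_trans x01 _; rewrite -[leLHS]mulr1 ler_wpM2l //.
  by move: t02; clear; lra.
move=> /(_ isT isT) concl.
suff : kap * (eta / 2) <= D t1 x1.
  by rewrite /D (u_prof W) z1E; move: Ule sp3 ke0; clear; lra.
apply: concl => [t y ht hy|y hy|t y /andP[ht1' ht2'] hy _].
- by rewrite /D; have := near_low t y ht hy; clear; lra.
- have := hLam _ _ _ _ W t0 y x0; rewrite ler_norml.
  have : Lam * nrm (y - x0) <= Lam * rho1 by rewrite ler_pM2l.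
  have -> : Lam * rho1 = eta / 2 by rewrite /rho1; move: Lam0; clear => L0; field; rewrite gt_eqF.
  by rewrite /D; move: big sp0; clear; lra.
have [_ _ hT hS] := w_sol W; have [p [H [TX eX]]] := hS t y.
exists (ut t y), p, H; split.
- have := T1D (hT t y) (T1_lin (sp - (1 - del)) 0); rewrite addr0.
  by apply: T1_ext => s; rewrite /D; clear; ring.
- move=> xi; have := T2D (TX xi) (T2_quad (sp - (1 - del)) 0 0); rewrite !addr0.
  by apply: T2_ext => s; rewrite /D; clear; ring.
have tt : t0 <= t <= t1 by rewrite (ltW ht1').
have lo := near_low t y tt hy; have /andP[u0 u1] := w_01 W t y.
have := @f_mono _ _ S y (u t y) 1 (ltW u0).
rewrite (ltW u1) lexx f_1 => h.
have {}h : 0 <= f S y (u t y).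
  by apply: h => //; move: lo sp2 delrho; clear; lra.
by rewrite eX mul0r; move: h ke0; clear; lra.
Qed.

(** * Two-sided bounds on the speed for nearby directions *)

(** If the wave of [n] were too slow, then at a contact with the wave of [n0] on top the reaction
    alone would have to balance [kap] times [ut0 > 0]. It cannot: its difference is small in the
    middle, zero ahead and nonpositive behind. Very far behind, where [ut0] has no uniform lower
    bound, the profile of [n] would form a plateau. *)
Lemma speed_lower (R : realType) (N : nat) (S : setting R N) (n0 : 'rV[R]_N) (c0 : R)
    (u0 ut0 : R -> 'rV[R]_N -> R) (W0 : wave S n0 c0 u0 ut0) (kap : R) : 0 < kap < 1 ->
  exists2 sg, 0 < sg & forall n c u ut, wave S n c u ut -> nrm (n - n0) <= sg ->
    (1 - kap) * c0 <= c.
Proof.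
move=> /andP[kap0 kap1]; have c00 := w_c0 W0; have Kf0 := Kf_ge0 S.
have /andP[th0 th1] := theta_itv S; have rh0 := rho_gt0 S.
have Ct0 := Ct_ge0 S; have Cb0 := Cb_ge0 S.
have [Z Z1 hZ] := far_zone W0.
have [m1 m10 hm1] := ut_min W0 Z.
have Kf8 : 0 < 16 * (Kf S + 1) by move: Kf0; clear; lra.
have [del [del0 [dl1 dl2 dl3 dl4]]] : exists del, 0 < del /\
    [/\ del <= 1 / 16, del <= rho S / 16, del <= (1 - theta S) / 2 & del * (16 * (Kf S + 1)) <= kap * m1].
  exists (Num.min (Num.min (1 / 16) (rho S / 16)) (Num.min ((1 - theta S) / 2) (kap * m1 / (16 * (Kf S + 1))))).
  rewrite -ler_pdivlMr //; split; last by split; rewrite !ge_min lexx ?orbT.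
  by rewrite !lt_min; apply/andP; split; apply/andP; split; rewrite divr_gt0 ?subr_gt0 // mulr_gt0.
have delth : theta S < 1 - del by move: dl3 th1; clear; lra.
have delrho : del < rho S by move: dl2 rh0; clear; lra.
have [sp [Y [sp0 Y0 plat]]] := plateau del0 delth delrho c00.
have [r [r0 r1 r2]] : exists r, [/\ 0 < r, r <= del & r <= sp / 2].
  exists (Num.min del (sp / 2)); rewrite lt_min del0 divr_gt0 //.
  by split=> //; rewrite ge_min lexx ?orbT.
have sp20 : 0 < sp / 2 by rewrite divr_gt0.
have [Z2 Z20 hZ2] := prof_lim W0 sp20; have [Z3 Z30 hZ3] := prof_lim W0 del0.
pose B := Z2 + Y + 1 + Z3 + Z.
have [m2 m20 hm2] := ut_min W0 B.
have [d d0 hd] := prof_unif W0 r0.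
have [e [e0 e1 ed]] : exists e, [/\ 0 < e, e <= 1 & e <= d ^+ 2].
  exists (Num.min 1 (d ^+ 2)); rewrite lt_min ltr01 exprn_gt0 //.
  by split=> //; rewrite ge_min lexx ?orbT.
have CC : 0 < 8 * (Ct S + Cb S + 1) by move: Ct0 Cb0; clear; lra.
have [sg [sg0 [sg1 sg2 sg3]]] : exists sg, 0 < sg /\
    [/\ sg <= 1, sg * (8 * (Ct S + Cb S + 1)) <= kap * m1 * e & sg * (8 * (Ct S + Cb S + 1)) <= kap * m2 * e].
  exists (Num.min 1 (Num.min (kap * m1 * e / (8 * (Ct S + Cb S + 1))) (kap * m2 * e / (8 * (Ct S + Cb S + 1))))).
  rewrite -!ler_pdivlMr //; split; last by split; rewrite !ge_min lexx ?orbT.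
  by rewrite !lt_min ltr01 /=; apply/andP; split; apply: divr_gt0 => //; rewrite !mulr_gt0.
exists sg => // n c u ut W hn; rewrite leNgt; apply/negP => slow.
have c_0 := w_c0 W.
(* A constant [G] is enough here: strictness comes from the difference of the speeds. *)
have wt z0 : 1 <= (fun _ : R => 1 : R) z0 <= 2 by rewrite lexx /=; clear; lra.
have [] := contact W0 W (@continuous_cstf R R 1) wt (e := e) (del := del) _ _ r0.
- by rewrite e0.
- by rewrite del0.
move=> s [z [z' [x [mx /andP[gp gr] _]]]].
have [pz vw v1] := gap_pos W0 W wt e0 del0 gp.
have zz : `|z - z'| <= d by apply: sqr_le_norm; [exact: ltW|exact: le_trans (ltW pz) ed].
have zz1 : `|z - z'| <= 1 by apply: sqr_le_norm => //; rewrite expr1n; exact: le_trans (ltW pz) e1.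
have zz1' : `|- (z - z')| <= 1 by rewrite normrN.
have Ws := wave_front_shift W0 s.
have TG : T2 (fun t => (fun _ : R => del) (z' + t)) 0 0.
  by apply: T2_ext (T2_quad del 0 0) => t; rewrite !mul0r !addr0.
have [|I1 I2 I3] := @touching _ _ S n0 n c0 c _ _ _ _ Ws W 1 e 1 z z' x (fun _ => del) 0 0 ler01 e0 ltr01 TG.
  move=> y1 y2 y _ _; have := mx y1 y2 y; rewrite /gap !(prof_front_shift W0).
  by rewrite !mul1r !mulr1.
move: I1 I2 I3; rewrite (prof_front_shift W0).
have -> : prof n0 c0 (front_shift c0 s ut0) z x = prof n0 c0 ut0 (z + s) x.
  by rewrite /prof /front_shift; congr ut0; field; rewrite gt_eqF.
set T := prof n0 c0 ut0 (z + s) x; set w := prof n0 c0 u0 (z + s) x in vw *; set v := prof n c u z' x in vw v1 *.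
rewrite !mul1r !mulr0 !mul0r !addr0 !subr0 => I1 I2 I3.
have hn' : nrm (n0 - n) <= sg by rewrite -nrmN opprB.
have ei0 : 0 <= e^-1 by rewrite invr_ge0 ltW.
have mm := mismatch_bound S x hn' sg1 ei0 zz1.
have VT : prof n c ut z' x = c / c0 * T.
  by rewrite I1 I2; field; rewrite !gt_eqF.
have T0 : 0 < T by exact: (ut_gt0 W0).
have main : kap * T <= f S x w - f S x v + 2 * e^-1 * (Ct S + Cb S) * sg.
  have cc : c0 / c * (c / c0 * T) = T by field; rewrite !gt_eqF.
  have ck : c / c0 * T <= (1 - kap) * T by rewrite ler_pM2r // ler_pdivrMr // ltW.
  move: I3 mm; rewrite VT cc; set q1 := qf _ _; set q2 := dot _ _ => I3 mm.
  have e2 : 2 * (z - z') / e * q2 = 2 * e^-1 * (z - z') * q2 by ring.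
  by move: I3 mm ck; rewrite e2; clear; lra.
have err m : sg * (8 * (Ct S + Cb S + 1)) <= kap * m * e -> 2 * e^-1 * (Ct S + Cb S) * sg <= kap * m / 4.
  move=> h; rewrite -(ler_pM2r e0).
  have -> : 2 * e^-1 * (Ct S + Cb S) * sg * e = 2 * (Ct S + Cb S) * sg by field; rewrite gt_eqF.
  by move: h sg0; clear; lra.
have err1 := err _ sg2; have err2 := err _ sg3.
have /andP[w0 w1] := prof_01 W0 (z + s) x; rewrite -/w in w0 w1.
have /andP[v0 v1'] := prof_01 W z' x; rewrite -/v in v0 v1'.
have pen0 : 0 <= (z - z') ^+ 2 / e by rewrite divr_ge0 ?sqr_ge0 // ltW.
have pen : (z - z') ^+ 2 / e <= r.
  have := mx z' z' x; rewrite /gap subrr expr0n mul0r subr0 mulr1.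
  have := hd (z + s) (z' + s) x; rewrite opprD addrACA subrr addr0 => /(_ zz).
  by rewrite ler_norml; clear; lra.
have wv : w - v <= del + r + r.
  by move: gr pen; rewrite /gap -/w -/v mulr1; clear; lra.
have zetaB : z + s < Z3.
  by rewrite ltNge; apply/negP => h; have := (hZ3 (z + s) x).1 h; move: vw v0; rewrite -/w; clear; lra.
have Tm : - B <= z + s -> m2 <= T.
  by move=> h; apply: hm2; rewrite ler_norml h /=; move: zetaB Z20 Y0 Z30 Z1; rewrite /B; clear; lra.
have km1 : 0 < kap * m1 by rewrite mulr_gt0.
have km2 : 0 < kap * m2 by rewrite mulr_gt0.
have [zr|zl] := ltP Z (z + s).
  have h1 := (hZ (z + s) x).1; rewrite -/w in h1.
  have wth : w <= theta S by have := h1 ltac:(move: zr; clear; lra); move: th0; clear; lra.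
  have vth : v <= theta S by move: vw wth del0; clear; lra.
  have fw : f S x w = 0 by rewrite f_0 // (ltW w0).
  have fv : f S x v = 0 by rewrite f_0 // (ltW v0).
  have := Tm ltac:(move: zr Z20 Y0 Z30 Z1; rewrite /B; clear; lra); rewrite -(ler_pM2l kap0).
  by move: main; rewrite fw fv; move: err2 km2; clear; lra.
have [zm|zf] := leP (- Z) (z + s).
  have mT : m1 <= T by apply: hm1; rewrite ler_norml zm.
  have := @f_lip _ _ S x w v; rewrite (ltW w0) (ltW w1) (ltW v0) (ltW v1') => /(_ isT isT).
  rewrite (ger0_norm (_ : 0 <= w - v)); last by move: vw del0; clear; lra.
  have := ler_wpM2l Kf0 wv; rewrite ler_norml.
  have rK : Kf S * r <= Kf S * del by rewrite ler_wpM2l.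
  rewrite -(ler_pM2l kap0) in mT.
  by move: main mT err1 km1 dl4 rK del0; clear; lra.
have wr := (hZ (z + s) x).2 (ltW zf); rewrite -/w in wr.
have vlow : 1 - rho S < v by move: wr wv r1 dl2 rh0; clear; lra.
have fwv : f S x w <= f S x v.
  apply: f_mono => //; [exact: ltW|by move: vw del0; clear; lra|exact: ltW].
have [zB|zB] := leP (- B) (z + s).
  by have := Tm zB; rewrite -(ler_pM2l kap0); move: main fwv err2 km2; clear; lra.
(* The contact is so far behind that the profile of [n0] is near 1 up to [z' + Y]; maximality of the
   gap then keeps the profile of [n] above [1 - del - sp] there, while at [z'] it is below
   [1 - del]. *)
have cc0 : c <= c0.
  apply: le_trans (ltW slow) _; rewrite -[leRHS]mul1r ler_pM2r //; move: kap0; clear; lra.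
apply: (plat n c u ut W cc0 z' x).
  move=> y1 y y1Y; have := mx y1 y1 y; rewrite {1}/gap subrr expr0n mul0r subr0 mulr1.
  have y1s : y1 + s <= - Z2.
    by move: y1Y zB zz1 Z30 Z1; rewrite /B ler_norml; clear; lra.
  by have := (hZ2 (y1 + s) y).2 y1s; move: gr r2; clear; lra.
by rewrite -/v; move: v1 sp0; clear; lra.
Qed.

(* A contact far to the right would sit on a plateau of height about [del],
   which [decay] excludes. *)
Lemma contact_not_right (R : realType) (N : nat) (S : setting R N) (n n0 : 'rV[R]_N) (c c0 : R)
    (u ut u0 ut0 : R -> 'rV[R]_N -> R) (W : wave S n c u ut) (W0 : wave S n0 c0 u0 ut0)
    (G : R -> R) (M Y e del s z z' sg : R) (x : 'rV[R]_N) :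
  (forall z B : R, (forall x, prof n c u z x <= B) -> B <= theta S ->
    forall x, 4 * prof n c u (z + M) x <= B) ->
  (forall y x, Y <= y -> prof n0 c0 u0 y x <= del) ->
  (forall z, 1 <= G z <= 2) -> 0 < e <= 1 -> 0 < del -> sg < del -> 4 * del <= theta S ->
  (forall (y1 y2 : R) y, gap n n0 c c0 u u0 G e del s y1 y2 y <= gap n n0 c c0 u u0 G e del s z z' x) ->
  0 < gap n n0 c c0 u u0 G e del s z z' x <= sg -> z' <= Y + M + 1.
Proof.
move=> dec hY wt /andP[e0 e1] del0 sgd dth mx /andP[gp gr].
rewrite leNgt; apply/negP => far.
have [pz vw v1] := gap_pos W W0 wt e0 del0 gp.
have : `|z - z'| <= 1 by apply: sqr_le_norm => //; rewrite expr1n; exact: le_trans (ltW pz) e1.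
rewrite ler_norml => /andP[zz1 zz2].
have zM : Y <= z - M by move: far zz1; clear; lra.
have h y : prof n c u (z - M + s) y <= 3 * del + sg.
  have := gap_max wt del0 mx gr (z - M) y; have := hY (z - M) y zM; clear; lra.
have := dec (z - M + s) (3 * del + sg) h _ x.
rewrite (_ : z - M + s + M = z + s); last by ring.
have /andP[v0 _] := prof_01 W0 z' x.
have -> : 3 * del + sg <= theta S by move: sgd dth; clear; lra.
by move=> /(_ isT); move: vw v0 sgd; clear; lra.
Qed.

(** The roles are exchanged: the wave of [n] is on top. The limit of the profile of [n0] bounds the
    contact on the left and [contact_not_right] on the right; [speed_lower] supplies the lower bound
    on [c] under which [decay] applies. *)
Lemma speed_upper (R : realType) (N : nat) (S : setting R N) (n0 : 'rV[R]_N) (c0 : R)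
    (u0 ut0 : R -> 'rV[R]_N -> R) (W0 : wave S n0 c0 u0 ut0) (kap : R) : 0 < kap ->
  exists2 sg, 0 < sg & forall n c u ut, wave S n c u ut -> nrm (n - n0) <= sg ->
    c <= (1 + kap) * c0.
Proof.
move=> kap0; have c00 := w_c0 W0; have Kf0 := Kf_ge0 S.
have /andP[th0 th1] := theta_itv S; have rh0 := rho_gt0 S.
have Ct0 := Ct_ge0 S; have Cb0 := Cb_ge0 S.
have [Z Z1 hZ] := far_zone W0.
have [m1 m10 hm1] := ut_min W0 Z.
have Kf8 : 0 < 16 * (Kf S + 1) by move: Kf0; clear; lra.
have [del [del0 [dl1 dl2 dl3]]] : exists del, 0 < del /\
    [/\ del <= 1 / 16, del <= theta S / 8 & del * (16 * (Kf S + 1)) <= kap * m1].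
  exists (Num.min (1 / 16) (Num.min (theta S / 8) (kap * m1 / (16 * (Kf S + 1))))).
  rewrite -ler_pdivlMr //; split; last by split; rewrite !ge_min lexx ?orbT.
  by rewrite !lt_min; apply/andP; split; [|apply/andP; split]; rewrite divr_gt0 // mulr_gt0.
have [M [sgd [M0 sgd0 dec]]] := decay W0.
have [k1 [k10 k11 k1c]] : exists k1, [/\ 0 < k1, k1 < 1 & k1 * c0 <= sgd].
  exists (Num.min (1 / 2) (sgd / c0)); rewrite -ler_pdivlMr //; split.
  - by rewrite lt_min !divr_gt0.
  - by apply: (@le_lt_trans _ _ (1 / 2)); [rewrite ge_min lexx|clear; lra].
  - by rewrite ge_min lexx orbT.
have [sgl sgl0 low] := speed_lower W0 (introT andP (conj k10 k11)).
have r0 : 0 < del / 4 by rewrite divr_gt0.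
have [Y Y0 hY] := prof_lim W0 del0.
pose B := Y + M + 1 + Z.
have [m2 m20 hm2] := ut_min W0 B.
have [d d0 hd] := prof_unif W0 r0.
have [e [e0 e1 ed]] : exists e, [/\ 0 < e, e <= 1 & e <= d ^+ 2].
  exists (Num.min 1 (d ^+ 2)); rewrite lt_min ltr01 exprn_gt0 //.
  by split=> //; rewrite ge_min lexx ?orbT.
have CC : 0 < 8 * (Ct S + Cb S + 1) by move: Ct0 Cb0; clear; lra.
have [sg [sg0 [sg1 sg2 sg3] [sg4 sg5]]] : exists sg, [/\ 0 < sg,
    [/\ sg <= 1, sg * (8 * (Ct S + Cb S + 1)) <= kap * m1 * e & sg * (8 * (Ct S + Cb S + 1)) <= kap * m2 * e]
    & sg <= sgd /\ sg <= sgl].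
  exists (Num.min (Num.min sgd sgl) (Num.min 1 (Num.min (kap * m1 * e / (8 * (Ct S + Cb S + 1))) (kap * m2 * e / (8 * (Ct S + Cb S + 1)))))).
  rewrite -!ler_pdivlMr //; split; [|by split; rewrite !ge_min lexx ?orbT..].
  by rewrite !lt_min ltr01 sgd0 sgl0 /=; apply/andP; split; apply: divr_gt0 => //; rewrite !mulr_gt0.
exists sg => // n c u ut W hn; rewrite leNgt; apply/negP => fast.
have c_0 := w_c0 W.
have cd : c0 - sgd <= c.
  apply: le_trans (low _ _ _ _ W (le_trans hn sg5)); move: k1c; clear; lra.
have wt z0 : 1 <= (fun _ : R => 1 : R) z0 <= 2 by rewrite lexx /=; clear; lra.
have [] := contact W W0 (@continuous_cstf R R 1) wt (e := e) (del := del) _ _ r0.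
- by rewrite e0.
- by rewrite del0.
move=> s [z [z' [x [mx gpr _]]]]; have /andP[gp gr] := gpr.
have [pz vw v1] := gap_pos W W0 wt e0 del0 gp.
have zz : `|z - z'| <= d by apply: sqr_le_norm; [exact: ltW|exact: le_trans (ltW pz) ed].
have zz1 : `|z - z'| <= 1 by apply: sqr_le_norm => //; rewrite expr1n; exact: le_trans (ltW pz) e1.
have Ws := wave_front_shift W s.
have TG : T2 (fun t => (fun _ : R => del) (z' + t)) 0 0.
  by apply: T2_ext (T2_quad del 0 0) => t; rewrite !mul0r !addr0.
have [|_ _ I3] := @touching _ _ S n n0 c c0 _ _ _ _ Ws W0 1 e 1 z z' x (fun _ => del) 0 0 ler01 e0 ltr01 TG.
  move=> y1 y2 y _ _; have := mx y1 y2 y; rewrite /gap !(prof_front_shift W).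
  by rewrite !mul1r !mulr1.
move: I3; rewrite (prof_front_shift W).
set V := prof n0 c0 ut0 z' x; set w := prof n c u (z + s) x in vw *; set v := prof n0 c0 u0 z' x in vw v1 *.
rewrite !mul1r !mulr0 !mul0r !addr0 !subr0 => I3.
have ei0 : 0 <= e^-1 by rewrite invr_ge0 ltW.
have mm := mismatch_bound S x hn sg1 ei0 zz1.
have V0 : 0 < V by exact: (ut_gt0 W0).
have main : kap * V <= f S x w - f S x v + 2 * e^-1 * (Ct S + Cb S) * sg.
  have ck : (1 + kap) * V <= c / c0 * V by rewrite ler_pM2r // ler_pdivlMr // ltW.
  move: I3 mm; set q1 := qf _ _; set q2 := dot _ _ => I3 mm.
  have e2 : 2 * (z - z') / e * q2 = 2 * e^-1 * (z - z') * q2 by ring.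
  by move: I3 mm ck; rewrite e2; clear; lra.
have err m : sg * (8 * (Ct S + Cb S + 1)) <= kap * m * e -> 2 * e^-1 * (Ct S + Cb S) * sg <= kap * m / 4.
  move=> h; rewrite -(ler_pM2r e0).
  have -> : 2 * e^-1 * (Ct S + Cb S) * sg * e = 2 * (Ct S + Cb S) * sg by field; rewrite gt_eqF.
  by move: h sg0; clear; lra.
have err1 := err _ sg2; have err2 := err _ sg3.
have /andP[w0 w1] := prof_01 W (z + s) x; rewrite -/w in w0 w1.
have /andP[v0 v1'] := prof_01 W0 z' x; rewrite -/v in v0 v1'.
have pen0 : 0 <= (z - z') ^+ 2 / e by rewrite divr_ge0 ?sqr_ge0 // ltW.
have pen : (z - z') ^+ 2 / e <= del / 4.
  have := mx z z x; rewrite /gap subrr expr0n mul0r subr0 mulr1.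
  by have := hd z z' x zz; rewrite ler_norml; clear; lra.
have wv : w - v <= 2 * del.
  by move: gr pen del0; rewrite /gap -/w -/v mulr1; clear; lra.
have z'lo : - Y < z'.
  by rewrite ltNge; apply/negP => h; have := (hY z' x).2 h; move: v1; rewrite -/v; clear; lra.
have z'hi : z' <= Y + M + 1.
  apply: (contact_not_right W W0 (dec _ _ _ _ W (le_trans hn sg4) cd) _ wt _ del0 _ _ mx gpr).
  - by move=> y w' yY; exact: (hY y w').1.
  - by rewrite e0.
  - by move: del0; clear; lra.
  - by move: dl2 th0; clear; lra.
have Vm : m2 <= V.
  by apply: hm2; rewrite ler_norml; move: z'lo z'hi Y0 M0 Z1; rewrite /B; clear; lra.
have km1 : 0 < kap * m1 by rewrite mulr_gt0.
have km2 : 0 < kap * m2 by rewrite mulr_gt0.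
have kV := Vm; rewrite -(ler_pM2l kap0) in kV.
have [zr|zl] := ltP Z z'.
  have zZ : Z - 1 <= z by move: zr zz1; rewrite ler_norml; clear; lra.
  have wth : w <= theta S.
    have := gap_max wt del0 mx gr z x; have := (hZ z x).1 zZ; rewrite -/w.
    by move: dl2 th0; clear; lra.
  have vth : v <= theta S by move: vw wth del0; clear; lra.
  have fw : f S x w = 0 by rewrite f_0 // (ltW w0).
  have fv : f S x v = 0 by rewrite f_0 // (ltW v0).
  by move: main; rewrite fw fv; move: err2 km2 kV; clear; lra.
have [zm|zf] := leP (- Z) z'.
  have mT : m1 <= V by apply: hm1; rewrite ler_norml zm.
  have := @f_lip _ _ S x w v; rewrite (ltW w0) (ltW w1) (ltW v0) (ltW v1') => /(_ isT isT).
  rewrite (ger0_norm (_ : 0 <= w - v)); last by move: vw del0; clear; lra.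
  have := ler_wpM2l Kf0 wv; rewrite ler_norml.
  rewrite -(ler_pM2l kap0) in mT.
  by move: main mT err1 km1 dl3 del0; clear; lra.
have vr := (hZ z' x).2 (ltW zf); rewrite -/v in vr.
have fwv : f S x w <= f S x v.
  apply: f_mono; [exact: ltW|by move: vr rh0; clear; lra|by move: vw del0; clear; lra|exact: ltW].
by move: main fwv err2 km2 kV; clear; lra.
Qed.

(** * Closeness of the profiles *)

(** The error in the speed has no sign, so strictness comes from the weight. Its strength decays
    like [exp(- K |z|)]; the contact is therefore confined to [|z'| <= B] by [B] independent of [n],
    and only then are the errors chosen small against [Em]. *)
Lemma shifted_close (R : realType) (N : nat) (S : setting R N) (n0 : 'rV[R]_N) (c0 : R)
    (u0 ut0 : R -> 'rV[R]_N -> R) (W0 : wave S n0 c0 u0 ut0) (Z1 eta : R) :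
  0 < Z1 -> 0 < eta <= 1 ->
  exists2 sg, 0 < sg & forall n c u ut, wave S n c u ut -> nrm (n - n0) <= sg ->
    exists s, (forall z x, prof n c u (z + s) x <= prof n0 c0 u0 z x + eta) /\
      (forall z x, `|z| <= Z1 -> prof n0 c0 u0 z x - eta <= prof n c u (z + s) x).
Proof.
move=> Z10 /andP[eta0 eta1]; have c00 := w_c0 W0.
have /andP[th0 th1] := theta_itv S; have rh0 := rho_gt0 S.
have Ct0 := Ct_ge0 S; have Cb0 := Cb_ge0 S; have l0 := lam_gt0 S.
have [Z Z_1 hZ] := far_zone W0.
have ZZ : 0 < Z + 1 by move: Z_1; clear; lra.
have [sgI sgI0 ident] := identify W0 ZZ Z10 (introT andP (conj eta0 eta1)).
have [K K0 hK] : exists2 K, 0 < K & Cb S + 2 * c0 + 1 = K * lam S.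
  exists ((Cb S + 2 * c0 + 1) / lam S); last by rewrite divfK // gt_eqF.
  by rewrite divr_gt0 //; move: Cb0 c00; clear; lra.
have [del [del0 [dl1 dl2] [dl3 dl4]]] : exists del, [/\ 0 < del,
    del <= 1 / 16 /\ del <= theta S / 8 & del <= eta / 4 /\ del <= sgI / 8].
  exists (Num.min (Num.min (1 / 16) (theta S / 8)) (Num.min (eta / 4) (sgI / 8))).
  split; [|by split; rewrite !ge_min lexx ?orbT..].
  by rewrite !lt_min; apply/andP; split; apply/andP; split; rewrite divr_gt0.
have r0 : 0 < del / 4 by rewrite divr_gt0.
have [M [sgd [M0 sgd0 dec]]] := decay W0.
have [Y Y0 hY] := prof_lim W0 del0.
have [B BE] : exists B, B = Y + M + 1 by eexists.
have [Em Em0 EmE] : exists2 Em, 0 < Em & Em = expR (- (K * B)).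
  by exists (expR (- (K * B))) => //; exact: expR_gt0.
have [d d0 hd] := prof_unif W0 (divr_gt0 sgI0 (ltr0n R 2)).
have [e [e0 e1 ed]] : exists e, [/\ 0 < e, e <= 1 & e <= d ^+ 2].
  exists (Num.min 1 (d ^+ 2)); rewrite lt_min ltr01 exprn_gt0 //.
  by split=> //; rewrite ge_min lexx ?orbT.
(* The first-order condition in time bounds the time derivative [V] at the contact by [Q], so the
   speed error [(c / c0 - 1) * V] is at least [- (k1 * Q)]. *)
have [Q Q0 QE] : exists2 Q, 0 < Q & Q = c0 * (del * K + 2 / e).
  exists (c0 * (del * K + 2 / e)) => //.
  by apply: mulr_gt0 => //; apply: addr_gt0; [rewrite mulr_gt0|rewrite divr_gt0].
have dKE : 0 < del * (K * Em) by rewrite !mulr_gt0.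
have [k1 [k10 k11] [k1c k1I k1Q]] : exists2 k1, 0 < k1 /\ k1 < 1 &
    [/\ k1 * c0 <= sgd, k1 * c0 <= sgI & k1 * (4 * Q) <= del * (K * Em)].
  exists (Num.min (Num.min (1 / 2) (sgd / c0)) (Num.min (sgI / c0) (del * (K * Em) / (4 * Q)))).
    split; first by rewrite !lt_min; apply/andP; split; apply/andP; split; rewrite divr_gt0 // mulr_gt0.
    by apply: (@le_lt_trans _ _ (1 / 2)); [rewrite !ge_min lexx|clear; lra].
  by rewrite -!ler_pdivlMr ?mulr_gt0 //; split; rewrite !ge_min lexx ?orbT.
have [sgl sgl0 low] := speed_lower W0 (introT andP (conj k10 k11)).
have [sgu sgu0 upp] := speed_upper W0 k10.
have CC : 0 < 8 * (Ct S + Cb S + 1) by move: Ct0 Cb0; clear; lra.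
have [sg [sg0 [sg1 sg2 sg3] [sg4 sg5 sg6]]] : exists sg, [/\ 0 < sg,
    [/\ sg <= 1, sg <= sgI & sg * (8 * (Ct S + Cb S + 1)) <= del * (K * Em) * e]
    & [/\ sg <= sgd, sg <= sgl & sg <= sgu]].
  exists (Num.min (Num.min sgd sgl) (Num.min (Num.min sgu 1) (Num.min sgI (del * (K * Em) * e / (8 * (Ct S + Cb S + 1)))))).
  rewrite -!ler_pdivlMr //; split; [|by split; rewrite !ge_min lexx ?orbT..].
  by rewrite !lt_min ltr01 sgd0 sgl0 sgu0 sgI0 /=; apply: divr_gt0 => //; rewrite mulr_gt0.
exists sg => // n c u ut W hn.
have c_0 := w_c0 W.
have clo := low _ _ _ _ W (le_trans hn sg5); have chi := upp _ _ _ _ W (le_trans hn sg6).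
have cd : c0 - sgd <= c by apply: le_trans clo; move: k1c; clear; lra.
have cI : `|c - c0| <= sgI by rewrite ler_norml; move: clo chi k1I; clear; lra.
have c2 : c <= 2 * c0.
  apply: le_trans chi _; rewrite ler_pM2r //; move: k11; clear; lra.
have wt z0 : 1 <= weight K z0 <= 2 by apply: weight_itv; exact: ltW.
have [] := contact W W0 (@weight_continuous _ K) wt (e := e) (del := del) _ _ r0.
- by rewrite e0.
- by rewrite del0.
move=> s [z [z' [x [mx gpr _]]]]; have /andP[gp gr] := gpr.
have [pz vw v1] := gap_pos W W0 wt e0 del0 gp.
have zz : `|z - z'| <= d by apply: sqr_le_norm; [exact: ltW|exact: le_trans (ltW pz) ed].
have zz1 : `|z - z'| <= 1 by apply: sqr_le_norm => //; rewrite expr1n; exact: le_trans (ltW pz) e1.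
have Ws := wave_front_shift W s.
have upper z1 x1 : prof n c u (z1 + s) x1 <= prof n0 c0 u0 z1 x1 + 3 * del.
  by have := gap_max wt del0 mx gr z1 x1; move: del0; clear; lra.
have z'lo : - Y < z'.
  by rewrite ltNge; apply/negP => h; have := (hY z' x).2 h; move: v1; clear; lra.
have z'hi : z' <= B.
  rewrite BE; apply: (contact_not_right W W0 (dec _ _ _ _ W (le_trans hn sg4) cd) _ wt _ del0 _ _ mx gpr).
  - by move=> y w' yY; exact: (hY y w').1.
  - by rewrite e0.
  - by move: del0; clear; lra.
  - by move: dl2 th0; clear; lra.
have z'B : `|z'| <= B.
  by rewrite ler_norml z'hi andbT; move: z'lo Y0 M0; rewrite BE; clear; lra.
suff z'Z : `|z'| <= Z.
  exists s; split=> [z1 x1|z1 x1 z1Z].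
    by have := upper z1 x1; move: dl3 del0; clear; lra.
  rewrite -(prof_front_shift W).
  apply: (ident _ _ _ _ Ws _ cI _ z x) z1Z; first exact: le_trans hn sg2.
  - by move=> z2 x2; rewrite (prof_front_shift W); have := upper z2 x2; move: dl4 del0; clear; lra.
  - by move: z'Z zz1; rewrite !ler_norml; clear; lra.
  - rewrite (prof_front_shift W); have := hd z z' x zz; rewrite ler_norml.
    by move: vw del0 sgI0; clear; lra.
rewrite leNgt; apply/negP => zZ.
have z'0 : z' != 0 by rewrite -normr_gt0; apply: le_lt_trans zZ; move: Z_1; clear; lra.
have TG := T2Z del (T2_weight K z'0).
have [|I1 _ I3] := @touching _ _ S n n0 c c0 _ _ _ _ Ws W0 1 e 1 z z' x (fun y => del * weight K y) _ _ ler01 e0 ltr01 TG.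
  by move=> y1 y2 y _ _; have := mx y1 y2 y; rewrite /gap !(prof_front_shift W) !mul1r.
move: I1 I3; rewrite (prof_front_shift W).
set V := prof n0 c0 ut0 z' x; set w := prof n c u (z + s) x in vw *; set v := prof n0 c0 u0 z' x in vw v1 *.
rewrite !mul1r => I1 I3.
have hKc : Cb S + c + 1 <= K * lam S by move: hK c2; clear; lra.
have strict := @weight_strict _ _ S n0 x c K z' (w_n1 W0) (ltW c_0) K0 hKc z'0.
have V0 : 0 < V by exact: (ut_gt0 W0).
have ei0 : 0 <= e^-1 by rewrite invr_ge0 ltW.
have mm := mismatch_bound S x hn sg1 ei0 zz1.
have EE : Em <= expR (- (K * `|z'|)) by rewrite EmE ler_expR lerN2 ler_pM2l.
move: I1 I3 strict; set E := expR (- (K * `|z'|)) in EE *; set sz := Num.sg z' => I1 I3 strict.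
have E0 : 0 < E by exact: expR_gt0.
have E1 : E <= 1 by rewrite -expR0 ler_expR oppr_le0 mulr_ge0 // ltW.
have szb : `|sz| <= 1 by rewrite /sz normr_sg z'0.
have VQ : V <= Q.
  rewrite I1 QE ler_pM2l //.
  have h1 : del * (K * sz * E) <= del * K.
    rewrite ler_pM2l // -[leRHS]mulr1 -mulrA ler_pM2l //.
    apply: (le_trans (ler_norm _)); rewrite normrM -[leRHS]mul1r (ger0_norm (ltW E0)) ler_pM // ?ltW //.
  have h2 : - (2 * (z - z') / e) <= 2 / e.
    rewrite -mulNr ler_pM2r ?invr_gt0 //; move: zz1; rewrite ler_norml; clear; lra.
  by move: h1 h2; clear; lra.
have lowV : - (k1 * Q) <= (c / c0 - 1) * V.
  have h1 : - k1 <= c / c0 - 1 by rewrite lerBrDr ler_pdivlMr //; move: clo; clear; lra.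
  have : - k1 * V <= (c / c0 - 1) * V by rewrite ler_pM2r.
  have : k1 * V <= k1 * Q by rewrite ler_pM2l.
  by clear; lra.
have ff : f S x w <= f S x v.
  have /andP[w0 w1] := prof_01 W (z + s) x; rewrite -/w in w0 w1.
  have /andP[v0 v1'] := prof_01 W0 z' x; rewrite -/v in v0 v1'.
  have [zpos|zneg] := leP 0 z'.
    have z'Z : Z < z' by move: zZ; rewrite ger0_norm.
    have zl : Z - 1 <= z by move: zz1 z'Z; rewrite ler_norml; clear; lra.
    have wth : w <= theta S.
      by have := upper z x; have := (hZ z x).1 zl; rewrite -/w; move: dl2 th0; clear; lra.
    have vth : v <= theta S by move: wth vw del0; clear; lra.
    have -> : f S x w = 0 by rewrite f_0 // (ltW w0).
    by have -> : f S x v = 0 by rewrite f_0 // (ltW v0).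
  have z'Z : z' <= - Z by move: zZ; rewrite ltr0_norm //; clear; lra.
  have vr := (hZ z' x).2 z'Z; rewrite -/v in vr.
  apply: f_mono; [exact: ltW|by move: vr rh0; clear; lra|by move: vw del0; clear; lra|exact: ltW].
have err : 2 * e^-1 * (Ct S + Cb S) * sg <= del * (K * Em) / 4.
  rewrite -(ler_pM2r e0).
  have -> : 2 * e^-1 * (Ct S + Cb S) * sg * e = 2 * (Ct S + Cb S) * sg by field; rewrite gt_eqF.
  by move: sg3 sg0; clear; lra.
have dEE : del * (K * Em) <= del * (K * E) by rewrite ler_pM2l // ler_pM2l.
have strict' : del * (- (K ^+ 2 * E) * qf (a S x) n0 + K * sz * E * (dot (b S x) n0 + c)) <= del * - (K * E).
  by rewrite ler_pM2l.
move: I3 mm strict' lowV ff err dEE k1Q dKE; set q1 := qf _ _; set q2 := qf _ _; set q3 := dot _ _; set q4 := dot _ _.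
rewrite (_ : 2 * (z - z') / e * q4 = 2 * e^-1 * (z - z') * q4); last by ring.
by clear; lra.
Qed.

(** The profile of [n0] drops at rate at least [m] near 0, so a shift by more than [r] would change
    the normalized minimum by [m r], more than the error [e] allows. A shift within [r <= d] costs
    at most [eta / 4], and monotonicity in [z] extends the lower bound to the left of the compact
    range. *)
Lemma profile_close (R : realType) (N : nat) (S : setting R N) (n0 : 'rV[R]_N) (c0 : R)
    (u0 ut0 : R -> 'rV[R]_N -> R) (W0 : wave S n0 c0 u0 ut0) (mu eta : R) :
  (exists x, prof n0 c0 u0 0 x = mu) -> (forall x, mu <= prof n0 c0 u0 0 x) -> 0 < eta ->
  exists2 sg, 0 < sg & forall n c u ut, wave S n c u ut -> nrm (n - n0) <= sg ->
    (exists x, prof n c u 0 x = mu) -> (forall x, mu <= prof n c u 0 x) ->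
    forall z x, `|prof n c u z x - prof n0 c0 u0 z x| <= eta.
Proof.
move=> [x0 x0mu] mu0 eta0.
have eta40 : 0 < eta / 4 by rewrite divr_gt0.
have [d d0 hd] := prof_unif W0 eta40.
have [m m0 hm] := prof_drop W0 1.
have [Z Z0 hZ] := prof_lim W0 eta40.
have [r [r0 rd r1]] : exists r, [/\ 0 < r, r <= d & r <= 1].
  exists (Num.min d 1); rewrite lt_min d0 ltr01.
  by split=> //; rewrite ge_min lexx ?orbT.
have [e [/andP[e0 e1] e2 e3]] : exists e, [/\ 0 < e <= 1, e <= eta / 4 & e <= m * r / 2].
  exists (Num.min 1 (Num.min (eta / 4) (m * r / 2))).
  rewrite !lt_min ltr01 /= !divr_gt0 ?mulr_gt0 //.
  by split=> //; rewrite !ge_min lexx ?orbT.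
have Z10 : 0 < Z + 1 by rewrite addr_gt0.
have [sg sg0 close] := shifted_close W0 Z10 (introT andP (conj e0 e1)).
exists sg => // n c u ut W hn [x1 x1mu] mu1 z x.
have [s [up lo]] := close _ _ _ _ W hn.
have mr0 : 0 < m * r by rewrite mulr_gt0.
(* If [s > r], test at the minimizer [x1] of the profile of [n]; if [s < - r], at the minimizer [x0]
   of that of [n0]. *)
have s1 : s <= r.
  rewrite leNgt; apply/negP => rs.
  have rZ : `|- r| <= Z + 1 by rewrite normrN (gtr0_norm r0); move: r1 Z0; clear; lra.
  have := lo (- r) x1 rZ.
  have sr : 0 <= s - r by rewrite subr_ge0 ltW.
  have := prof_decreasing W 0 x1 sr.
  rewrite add0r x1mu (_ : - r + s = s - r); last by rewrite addrC.
  have r1' : `|- r| <= 1 by rewrite normrN (gtr0_norm r0).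
  have r1'' : `|- r + r| <= 1 by rewrite addNr normr0.
  have := hm (- r) r x1 r1' (ltW r0) r1''; rewrite addNr.
  by have := mu0 x1; move: e3 mr0; clear; lra.
have s2 : - r <= s.
  rewrite leNgt; apply/negP => rs.
  have sr : 0 <= - (s + r) by move: rs; clear; lra.
  have := prof_decreasing W (r + s) x0 sr.
  rewrite (_ : r + s + - (s + r) = 0); last by ring.
  have r1' : `|r| <= 1 by rewrite gtr0_norm.
  have r0' : `|0 : R| <= 1 by rewrite normr0.
  have := hm 0 r x0 r0' (ltW r0); rewrite add0r => /(_ r1').
  have := up r x0; have := mu1 x0; rewrite x0mu; move: e3 mr0; clear; lra.
have zs : `|z - (z - s)| <= d.
  by rewrite opprB addrC subrK; apply: le_trans rd; rewrite ler_norml s1 s2.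
have := hd z (z - s) x zs; set y := z - s.
have zE : z = y + s by rewrite subrK.
have /andP[p1 p2] := prof_01 W (y + s) x; have /andP[p3 p4] := prof_01 W0 y x.
have upy := up y x.
have loy : prof n0 c0 u0 y x - eta / 2 <= prof n c u (y + s) x.
  have [yZ|yZ] := leP (Z + 1) y.
    have Zy : Z <= y by move: yZ; clear; lra.
    by have := (hZ y x).1 Zy; move: p1 eta0; clear; lra.
  have [yZ'|yZ'] := leP (- (Z + 1)) y.
    have yZ1 : `|y| <= Z + 1 by rewrite ler_norml yZ' ltW.
    by have := lo y x yZ1; move: e2 eta0; clear; lra.
  have bZ : `|- (Z + 1)| <= Z + 1 by rewrite normrN gtr0_norm.
  have yy : 0 <= - (Z + 1) - y by move: yZ'; clear; lra.
  have := prof_decreasing W (y + s) x yy.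
  rewrite (_ : y + s + (- (Z + 1) - y) = - (Z + 1) + s); last by ring.
  have Zn : - (Z + 1) <= - Z by clear; lra.
  have := lo _ x bZ; have := (hZ (- (Z + 1)) x).2 Zn.
  by move: p4 e2; clear; lra.
rewrite zE -/y !ler_norml; move: upy loy e2 eta0; clear; lra.
Qed.

(** * Uniform bounds from periodicity *)

Section Periodicity.
Context {R : realType} {N : nat}.
Variable L : 'I_N -> R.
Hypothesis L_gt0 : forall i, 0 < L i.

Lemma periodic_lattice (T : Type) (h : 'rV[R]_N -> T) : Defs.periodic L h ->
  forall k x, lattice L k -> h (x + k) = h x.
Proof.
move=> hper k x [m hm].
have one (i : 'I_N) (j : int) y : h (y + (L i * j%:~R) *: basis_vec i) = h y.
  have nat_ j' y' : h (y' + (L i * j'%:R) *: basis_vec i) = h y'.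
    elim: j' y' => [|j' IH] y'; first by rewrite mulr0 scale0r addr0.
    by rewrite -natr1 mulrDr mulr1 scalerDl addrA hper IH.
  case: j => j; first by rewrite -pmulrn nat_.
  by rewrite NegzE mulrNz mulrN scaleNr -[in RHS](subrK ((L i * j.+1%:R) *: basis_vec i) y) nat_ pmulrn.
suff H l y : h (y + \sum_(i <- l) (L i * (m i)%:~R) *: basis_vec i) = h y.
  rewrite -[RHS](H (index_enum 'I_N)); congr (h (x + _)); apply/rowP => i.
  rewrite summxE (bigD1 i) //= !mxE !eqxx mulr1 hm big1 ?addr0 // => j ji.
  by rewrite !mxE eqxx /= eq_sym (negbTE ji) mulr0.
elim: l y => [|i l IH] y; first by rewrite big_nil addr0.
by rewrite big_cons addrA IH one.
Qed.

Lemma periodic_bounded (g : 'rV[R]_N -> R) : Defs.periodic L g -> continuous g ->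
  exists B, 0 <= B /\ forall x, `|g x| <= B.
Proof.
move=> gper gc; have [r r0 hr] := lattice_cover L_gt0.
have [||c _ hc] := max_on (g := fun x => `|g x|) _ (@ball_nrm_compact R N r).
- by exists 0; rewrite /ball_nrm /= nrm0.
- by move=> x; apply: (@continuous_comp _ _ _ g Num.norm); [exact: gc|exact: norm_continuous].
exists `|g c|; split=> // x; have [k hk xk] := hr x.
by rewrite -(periodic_lattice gper x hk); exact: hc.
Qed.

Lemma periodic_partial i (g : 'rV[R]_N -> R) : Defs.periodic L g -> Defs.periodic L (partial i g).
Proof.
move=> gper k x; rewrite /partial /derive.
suff E h : g (h *: basis_vec i + (x + L k *: basis_vec k)) = g (h *: basis_vec i + x).
  by under eq_fun do rewrite /= E gper.
by rewrite addrA gper.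
Qed.

Lemma Ck1_lipschitz (g : 'rV[R]_N -> R) : Defs.periodic L g -> Ck 1 g ->
  exists2 K, 0 <= K & forall x y, `|g x - g y| <= K * nrm (x - y).
Proof.
move=> gper [gc gp pc].
have [B hB] := choice (fun i => periodic_bounded (periodic_partial i gper) (pc i)).
have grad_le x : nrm (grad g x) <= \sum_i B i.
  by apply: (le_trans (nrm_le_sum _)); apply: ler_sum => i _; rewrite mxE; have [_] := hB i.
exists (\sum_i B i) => [|x y]; first by apply: sumr_ge0 => i _; case: (hB i).
pose G s := g (y + s *: (x - y)).
have [|c [_ _]] := @mean_value R G (fun s => dot (grad g (y + s *: (x - y))) (x - y)) _ 1.
  move=> t; apply: T1_ext (line_T1 (y + t *: (x - y)) (x - y) gp pc) => s.
  by rewrite /G scalerDl addrA.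
have -> : G 1 = g x by rewrite /G scale1r addrC subrK.
rewrite {1}/G scale0r addr0 mulr1 => ->.
apply: (le_trans (cauchy_schwarz _ _)); rewrite ler_wpM2r ?nrm_ge0 //.
Qed.

End Periodicity.

(** * The reaction on the unit interval *)

Section Nonlinearity.
Context {R : realType} {N : nat}.
Variables (L : 'I_N -> R) (f : 'rV[R]_N -> R -> R).
Hypothesis L_gt0 : forall i, 0 < L i.
Hypothesis f_per : forall u, 0 <= u -> Defs.periodic L (f ^~ u).
Hypothesis f_loc : forall xu0 : 'rV[R]_N * R, 0 <= xu0.2 ->
  exists2 B, nbhs xu0 B & [lipschitz f xu.1 xu.2 | xu in B `&` [set xu | 0 <= xu.2]].

Lemma local_bound x0 u0 : 0 <= u0 -> exists M r, [/\ 0 < M, 0 < r &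
  forall x u y v, `|x0 - x| < r -> `|u0 - u| < r -> `|x0 - y| < r -> `|u0 - v| < r ->
    0 <= u -> 0 <= v -> `|f x u - f y v| <= M * Num.max `|x - y| `|u - v|].
Proof.
move=> u00; have [B /nbhs_ballP[r /= r0 rB] hB] := f_loc (xu0 := (x0, u0)) u00.
have [M0 [M0r hM]] := hB.
exists (Num.max 1 (M0 + 1)), r; split=> [||x u y v xr ur yr vr u1 v1] //.
  by rewrite lt_max ltr01.
have := hM (Num.max 1 (M0 + 1)) _ ((x, u), (y, v)); apply.
  by rewrite lt_max ltrDl ltr01 orbT.
have inB z w : `|x0 - z| < r -> `|u0 - w| < r -> B (z, w).
  by move=> zr wr; apply: rB; split; rewrite -ball_normE.
by split; split=> //; exact: inB.
Qed.

Lemma local_lipschitz_uniform : exists2 K, 0 <= K & forall x u v,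
  0 <= u <= 1 -> 0 <= v <= 1 -> `|f x u - f x v| <= K * `|u - v|.
Proof.
have [r r0 hr] := lattice_cover L_gt0.
pose C : set ('rV[R]_N * R) := ball_nrm r `*` [set u | 0 <= u <= 1].
have : compact C by apply: compact_setX; [exact: ball_nrm_compact|exact: itv_compact].
(* One parameter [k] is both the Lipschitz constant and, through [k * |u - v| <= 1], the range of
   validity; large [k] is admissible near each point, hence on the whole compact set. *)
move=> /compact_near_coveringP/near_covering_withinP/(_ R +oo%R (fun k p => forall v, 0 <= v <= 1 ->
  k * `|p.2 - v| <= 1 -> `|f p.1 p.2 - f p.1 v| <= k * `|p.2 - v|))[].
  move=> [x0 u0] [/= _ u01].
  have [|M [r' [M0 r'0 hM]]] := @local_bound x0 u0; first by lra.
  exists (ball x0 r' `*` ball u0 (r' / 2), [set k | Num.max M (2 / r') < k]).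
    split=> /=; last by exists (Num.max M (2 / r')); split; first exact: num_real.
    exists (ball x0 r', ball u0 (r' / 2)) => //.
    by split; apply: nbhsx_ballx; rewrite // divr_gt0.
  move=> [[x u] k] [[/= xr ur]]; rewrite gt_max => /andP[Mk rk] [_ /= u1] v v1 kuv.
  move: xr ur; rewrite -!ball_normE /= => xr ur.
  have k0 : 0 < k by exact: lt_trans M0 Mk.
  have uv : `|u - v| < r' / 2.
    rewrite -(ltr_pM2l k0); apply: (le_lt_trans kuv).
    by move: rk; rewrite ltr_pdivrMr // => rk; lra.
  apply: le_trans (hM x u x v xr _ xr _ _ _) _; try lra.
    have := ler_distD u u0 v; lra.
  by rewrite subrr normr0 max_r // ler_wpM2r // ltW.
move=> k0 [k0r hk0]; pose k := Num.max 1 (k0 + 1).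
have k0' : 0 < k by rewrite lt_max ltr01.
have hk x u v : 0 <= u <= 1 -> 0 <= v <= 1 -> k * `|u - v| <= 1 ->
    `|f x u - f x v| <= k * `|u - v|.
  move=> u1 v1 uv; have [l hl xl] := hr x.
  have u0 : 0 <= u by lra.
  have v0 : 0 <= v by lra.
  rewrite -(periodic_lattice (f_per u0) x hl) -(periodic_lattice (f_per v0) x hl).
  apply: (hk0 k _ (x + l, u)) => //.
  by rewrite lt_max ltrDl ltr01 orbT.
exists k; first exact: ltW.
move=> x u v u1 v1.
(* Values further apart are joined through intermediate ones: [w] cuts off the last of [m + 1] equal
   parts of the segment from [u] to [v]. *)
suff H m : forall v, 0 <= v <= 1 -> k * `|u - v| <= m%:R -> `|f x u - f x v| <= k * `|u - v|.
  have [m hm] : exists m : nat, k * `|u - v| <= m%:R.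
    by exists (Num.bound (k * `|u - v|)); rewrite ltW // archi_boundP // mulr_ge0 // ltW.
  exact: H hm.
elim: m => [|m IH] {v1}v v1 hv.
  apply: hk => //; exact: le_trans hv ler01.
pose s : R := m%:R / m.+1%:R; pose w := u + s * (v - u).
have s1 : 0 <= s <= 1 by rewrite divr_ge0 ?ler0n //= ler_pdivrMr ?ltr0n // mul1r ler_nat.
have w1 : 0 <= w <= 1.
  rewrite (_ : w = (1 - s) * u + s * v); last by rewrite /w; ring.
  by case/andP: s1 u1 v1 => s1 s2 /andP[u1 u2] /andP[v1 v2]; apply/andP; split; nra.
have uw : `|u - w| = s * `|u - v|.
  have -> : u - w = s * (u - v) by rewrite /w; ring.
  by rewrite normrM ger0_norm //; case/andP: s1.
have wv : `|w - v| = (1 - s) * `|u - v|.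
  have -> : w - v = (1 - s) * (u - v) by rewrite /w; ring.
  by rewrite normrM ger0_norm // subr_ge0; case/andP: s1.
have sS : s * m.+1%:R = m%:R by rewrite /s divfK // pnatr_eq0.
have s1S : (1 - s) * m.+1%:R = 1 by rewrite mulrBl sS mul1r -natr1; ring.
have h1 : `|f x u - f x w| <= k * (s * `|u - v|).
  rewrite -uw; apply: IH => //; rewrite uw mulrCA -sS ler_wpM2l //; lra.
have h2 : `|f x w - f x v| <= k * ((1 - s) * `|u - v|).
  rewrite -wv; apply: hk => //; rewrite wv mulrCA -[leRHS]s1S ler_wpM2l //; lra.
apply: (le_trans (ler_distD (f x w) _ _)); apply: (le_trans (lerD h1 h2)).
by rewrite -mulrDr -mulrDl addrC subrK mul1r.
Qed.

Lemma local_lipschitz_continuous u : 0 <= u -> continuous (f ^~ u).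
Proof.
move=> u0 x; have [M [r [M0 r0 h]]] := local_bound x u0.
apply/(@cvgrPdist_le _ _ _ (nbhs x) (nbhs_filter x)) => e e0; apply/nbhs_ballP; exists (Num.min r (e / M)) => /=.
  by rewrite lt_min r0 divr_gt0.
move=> y; rewrite -ball_normE /= lt_min => /andP[xyr xye].
apply: le_trans (h x u y u _ _ _ _ u0 u0) _; rewrite ?subrr ?normr0 //.
by rewrite max_l // -ler_pdivlMl // mulrC ltW.
Qed.

End Nonlinearity.

(** * Assembling the coefficients *)

Section Coefficients.
Context {R : realType} {N : nat}.
Variables (per : 'I_N -> R) (A : 'rV[R]_N -> 'M[R]_N) (q : 'rV[R]_N -> 'rV[R]_N).
Hypothesis per_gt0 : forall i, 0 < per i.

Lemma periodic_comp (T U : Type) (h : 'rV[R]_N -> T) (g : T -> U) :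
  Defs.periodic per h -> Defs.periodic per (fun x => g (h x)).
Proof. by move=> hper k x; rewrite hper. Qed.

Lemma Ck_continuous k (g : 'rV[R]_N -> R) : Ck k g -> continuous g.
Proof. by case: k => [|k] // []. Qed.

Lemma CkS k (g : 'rV[R]_N -> R) : Ck k.+1 g -> Ck k g.
Proof.
elim: k g => [|k IH] g [gc gp pg] //.
by split=> // i; exact: IH.
Qed.

Lemma diffusion_lipschitz : Defs.periodic per A -> (forall i j, Ck 1 (fun x => A x i j)) ->
  exists2 K, 0 <= K & forall x y xi,
    `|qf (A x) xi - qf (A y) xi| <= K * nrm (x - y) * dot xi xi.
Proof.
move=> Aper A1.
have /choice[K hK] : forall p : 'I_N * 'I_N, exists K : R, 0 <= K /\
    forall x y, `|A x p.1 p.2 - A y p.1 p.2| <= K * nrm (x - y).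
  move=> [i j].
  have [K K0 hK] := Ck1_lipschitz per_gt0 (periodic_comp (fun M : 'M[R]_N => M i j) Aper) (A1 i j).
  by exists K.
exists (\sum_i \sum_j K (i, j)) => [|x y xi].
  by apply: sumr_ge0 => i _; apply: sumr_ge0 => j _; case: (hK (i, j)).
rewrite !qfE -sumrB -mulrA mulr_suml; apply: (le_trans (ler_norm_sum _ _ _)).
apply: ler_sum => i _; rewrite -sumrB mulr_suml; apply: (le_trans (ler_norm_sum _ _ _)).
apply: ler_sum => j _; have [K0 /(_ x y) /= Kxy] := hK (i, j).
rewrite -nrm_sqr expr2 [leRHS]mulrA -!(mulrA (A _ _ _)) -mulrBl !normrM.
by apply: ler_pM => //; apply: ler_pM => //; exact: coord_le_nrm.
Qed.

Lemma drift_bounded : Defs.periodic per A -> (forall i j, Ck 1 (fun x => A x i j)) ->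
  Defs.periodic per q -> (forall i, continuous (fun x => q x 0 i)) ->
  exists2 B, 0 <= B & forall x, nrm (drift A q x) <= B.
Proof.
move=> Aper A1 qper qc.
have /choice[B hB] : forall j, exists B : R, 0 <= B /\ forall x, `|drift A q x 0 j| <= B.
  move=> j; have [Bq [Bq0 hBq]] :=
    periodic_bounded per_gt0 (periodic_comp (fun v : 'rV[R]_N => v 0 j) qper) (qc j).
  have [Ba hBa] := choice (fun i => periodic_bounded per_gt0
    (periodic_partial i (periodic_comp (fun M : 'M[R]_N => M i j) Aper))
    (let: And3 _ _ h := A1 i j in h i)).
  exists (\sum_i Ba i + Bq); split=> [|x].
    by apply: addr_ge0 => //; apply: sumr_ge0 => i _; case: (hBa i).
  rewrite mxE; apply: (le_trans (ler_normD _ _)); apply: lerD => //.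
  by apply: (le_trans (ler_norm_sum _ _ _)); apply: ler_sum => i _; case: (hBa i).
exists (\sum_j B j) => [|x]; first by apply: sumr_ge0 => j _; case: (hB j).
by apply: (le_trans (nrm_le_sum _)); apply: ler_sum => j _; case: (hB j).
Qed.

Lemma setting_of_hyp g th : diffusion_hyp per A -> advection_hyp per q -> ignition per g th ->
  exists S : setting R N,
    [/\ L S = per, a S = A, b S = drift A q, f S = g & theta S = th].
Proof.
move=> [Aper A3 Asym [a1 [a2 [a10 a12 ell]]]] [qper [delta _ q1] _ _].
move=> [[fper floc] [th_itv f0 f1 fpos [rh rh0 fmono]]].
have A1 i j : Ck 1 (fun x => A x i j) by do 2!apply: CkS; exact: A3.
have [Ka Ka0 hKa] := diffusion_lipschitz Aper A1.
have qc i : continuous (fun x => q x 0 i) by case: (q1 i) => /Ck_continuous.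
have [Cb Cb0 hCb] := drift_bounded Aper A1 qper qc.
have [Kf Kf0 hKf] := local_lipschitz_uniform per_gt0 fper floc.
have sym x i j : A x i j = A x j i by rewrite -[in LHS]Asym mxE.
have low x xi : a1 * dot xi xi <= qf (A x) xi by rewrite qfE; case/andP: (ell x xi).
have tr x : \tr (A x) <= \sum_(i < N) a2.
  apply: ler_sum => i _; have /andP[_] := ell x (basis_vec i).
  by rewrite -qfE /qf bf_basis2 dot_basis !mxE !eqxx mulr1.
have fc u : 0 <= u <= 1 -> continuous (g ^~ u).
  by move=> /andP[u0 _]; exact: local_lipschitz_continuous.
by exists (Setting per_gt0 sym a10 low tr Ka0 hKa Cb0 hCb Kf0 hKf fc th_itv f0 f1 fpos rh0 fmono).
Qed.

End Coefficients.

(** * Pulsating waves as waves of a setting *)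

Section PulsatingWaves.
Context {R : realType} {N : nat}.

Lemma compact_cvg (F : set_system R) {FF : Filter F} (u : R -> 'rV[R]_N -> R) (l B e : R) :
  {family compact, u t @[t --> F] --> (fun=> l)} -> 0 < e ->
  \forall t \near F, forall x, nrm x <= B -> `|l - u t x| < e.
Proof.
move=> /fam_cvgP /(_ (ball_nrm B) (@ball_nrm_compact R N B)) hu e0.
apply: (hu [set h | forall x, nrm x <= B -> `|l - h x| < e]).
apply/uniform_nbhs; exists [set p : R * R | `|p.1 - p.2| < e]; split=> //.
by rewrite -entourage_from_ballE; exists e => // -[x y]; rewrite -ball_normE.
Qed.

Lemma wave_of_pulsating (S : setting R N) A q n c u :
  a S = A -> b S = drift A q -> (forall i j, has_partials (fun x => A x i j)) ->
  dot n n = 1 -> pulsating_wave (L S) A q (f S) n c u ->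
  wave S n c u (fun t x => derive1 (u ^~ x) t).
Proof.
move=> aS bS hA n1 [c0 sol pul u01 [ul ur]]; split=> //.
  by rewrite aS bS; exact: entire_solution_solves.
move=> B e e0.
have [T1 [_ h1]] := compact_cvg B ul e0; have [T2 [_ h2]] := compact_cvg B ur e0.
(* Neighborhoods of infinity give strict inequalities on [t]; the offset by 1 turns them into the
   closed ones of [w_lim]. *)
exists (Num.max (1 - T1) (T2 + 1)) => t x xB.
have m1 : 1 - T1 <= Num.max (1 - T1) (T2 + 1) by rewrite le_max lexx.
have m2 : T2 + 1 <= Num.max (1 - T1) (T2 + 1) by rewrite le_max lexx orbT.
split=> ht.
  have /(_ _ _ xB) := h1 t; rewrite ltr_norml => hh.
  have := hh ltac:(lra); lra.
have /(_ _ _ xB) := h2 t; rewrite ltr_norml => hh.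
have := hh ltac:(lra); lra.
Qed.

End PulsatingWaves.

Theorem theorem2p6 (R : realType) (N : nat) (L : 'I_N -> R)
    (A : 'rV[R]_N -> 'M[R]_N) (q : 'rV[R]_N -> 'rV[R]_N)
    (f : 'rV[R]_N -> R -> R) (theta : R)
    (hL : forall i, 0 < L i)
    (hA : diffusion_hyp L A)
    (hq : advection_hyp L q)
    (hf : ignition L f theta)
    (cstar : 'rV[R]_N -> R)
    (ustar Ustar : 'rV[R]_N -> R -> 'rV[R]_N -> R)
    (hwave : forall n, unit_sphere n ->
       pulsating_wave L A q f n (cstar n) (ustar n))
    (hprofile : forall n, unit_sphere n -> forall t x,
       ustar n t x = Ustar n (dot x n - cstar n * t) x)
    (hnorm : forall n, unit_sphere n ->
       (exists x, Ustar n 0 x = (1 + theta) / 2) /\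
       (forall x, (1 + theta) / 2 <= Ustar n 0 x)) :
  {within unit_sphere, continuous
     (fun n => (fun zx => Ustar n zx.1 zx.2) : {uniform R * 'rV[R]_N -> R})}.
Proof.
have [S [SL Sa Sb Sf Sth]] := setting_of_hyp hL hA hq hf.
have hA1 i j : has_partials (fun x => A x i j) by case: hA => _ /(_ i j)[].
have W n : unit_sphere n ->
    wave S n (cstar n) (ustar n) (fun t x => derive1 (ustar n ^~ x) t).
  by move=> n1; apply: (wave_of_pulsating Sa Sb hA1 n1); rewrite SL Sf; exact: hwave.
have UE n z x : unit_sphere n -> Ustar n z x = prof n (cstar n) (ustar n) z x.
  move=> n1; rewrite /prof hprofile // mulrC divfK ?subKr //.
  by rewrite gt_eqF //; case: (hwave n n1).
have hmin n : unit_sphere n -> (exists x, prof n (cstar n) (ustar n) 0 x = (1 + theta) / 2) /\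
    (forall x, (1 + theta) / 2 <= prof n (cstar n) (ustar n) 0 x).
  move=> n1; have [[x hx] h] := hnorm n n1.
  by split=> [|y]; [exists x|]; rewrite -UE.
apply/subspace_continuousP => n0 n01 P /uniform_nbhs[E [entE EP]].
have [e /= e0 eE] : filter_from [set x : R | 0 < x]
  (fun e : R => [set xy : R * R | ball xy.1 e xy.2]) E by rewrite entourage_from_ballE.
have [m1 m2] := hmin _ n01.
have [sg sg0 close] := profile_close (W _ n01) m1 m2 (divr_gt0 e0 (ltr0n _ 2)).
(* Neighborhoods of [n0] are taken in the sup norm, and [nrm] is at most [N] times it; [N + 1]
   avoids a division by zero. *)
have sN : 0 < sg / (N%:R + 1) by rewrite divr_gt0 // ltr_wpDl ?ler0n.
apply/nbhs_ballP; exists (sg / (N%:R + 1)) => //= n; rewrite -ball_normE /= => n0n n1.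
apply: EP => -[z x] _; apply: eE; rewrite -ball_normE /from_subspace /= distrC !UE //.
have [q1 q2] := hmin _ n1.
apply: le_lt_trans (close n _ _ _ (W _ n1) _ q1 q2 z x) _; last by rewrite ltr_pdivrMr //; lra.
apply: (le_trans (nrm_le_norm _)); rewrite distrC.
apply: (@le_trans _ _ ((N%:R + 1) * (sg / (N%:R + 1)))).
  by apply: ler_pM => //; [rewrite lerDl|exact: ltW].
by rewrite mulrC divfK // gt_eqF // ltr_wpDl.
Qed.
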